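(* Let $m=m_n$ and let $m,n\to\infty$. Assume that $\frac{m}{n}\to\mu\in(0,\infty)$ and that $P^{(n)}\to P$ weakly for some probability measure $P$ on $\mathbb{Z}_+\times[0,1]$. Let $f_{2,n}$ be the model bidegree distribution of the superposition random graph $G_n$. (i) If $P^{(n)}_{rs}\to P_{rs}\in(0,\infty)$ for $rs=10,21$, then $f_{2,n}\to\bar f_2$ weakly, where $$\bar f_2=\delta_{(1,1)}\ast(\bar f_1\otimes\bar f_1)\ast f_2'.$$ (ii) If in addition $P^{(n)}_{rs}\to P_{rs}<\infty$ for $rs=32,43$, then $\int\phi\,df_{2,n}\to\int\phi\,d\bar f_2$ for all $\phi:\mathbb{Z}_+^2\to\mathbb{R}$ such that $|\phi(x,y)|\le c(1+x^2+y^2)$ for some constant $c<\infty$.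
   Context: Notation: $\mathbb{Z}_+=\{0,1,2,\dots\}$, $[n]=\{1,\dots,n\}$, $(x)_r=x(x-1)\cdots(x-r+1)$. $\delta_x$ is the Dirac measure at $x$; $\otimes$ is the product of measures and $\ast$ the convolution (here of probability measures on $\mathbb{Z}_+^2$). $\mathrm{Bin}(x,y)(s)=\binom{x}{s}(1-y)^{x-s}y^s$. For a probability measure on a countable space, $f(x)=f(\{x\})$. Model: For each $n$, let $m=m_n$ be the number of layers and $P^{(n)}$ a probability measure on $\{0,\dots,n\}\times[0,1]$. The triples $(G_{n,k},X_{n,k},Y_{n,k})$, $k=1,\dots,m$, are mutually independent, where $(X_{n,k},Y_{n,k})$ has distribution $P^{(n)}$ (size and strength of layer $k$, possibly dependent on each other) and $G_{n,k}$ is a random undirected graph with node set contained in $[n]$ such that: given $(X_{n,k},Y_{n,k})$, $V(G_{n,k})$ is uniformly distributed on the subsets of $[n]$ of size $X_{n,k}$; and given $(V(G_{n,k}),X_{n,k},Y_{n,k})$, each unordered node pair of $V(G_{n,k})$ is linked in $G_{n,k}$ with probability $Y_{n,k}$, independently of other pairs. The superposition graph $G_n$ has $V(G_n)=[n]$ and $E(G_n)=E(G_{n,1})\cup\cdots\cup E(G_{n,m})$. Cross moments: $P^{(n)}_{rs}=\mathbb{E}\big((X_{n,k})_rY_{n,k}^s\big)$ and $P_{rs}=\mathbb{E}\big((X)_rY^s\big)$ with $(X,Y)\sim P$. Model bidegree distribution: $f_{2,n}(s,t)=\mathbb{P}\big(\deg_{G_n}(1)=s,\ \deg_{G_n}(2)=t\mid\{1,2\}\in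 E(G_n)\big)$, where $\deg_{G_n}(i)$ is the number of nodes adjacent to $i$ in $G_n$ (by exchangeability, the nodes $1,2$ may equivalently be replaced by a uniformly random ordered pair of distinct nodes independent of $E(G_n)$). Limiting objects: $\bar f_1$ is the compound Poisson law of $\sum_{k=1}^{\Lambda}H_k$, where $\Lambda,H_1,H_2,\dots$ are independent, $\Lambda$ is Poisson with mean $\mu P_{10}$, and each $H_k$ has law $g(s)=\int_{\mathbb{Z}_+\times[0,1]}\mathrm{Bin}(x-1,y)(s)\frac{x\,P(dx,dy)}{P_{10}}$, $s\in\mathbb{Z}_+$. The measure $f_2'$ on $\mathbb{Z}_+^2$ is $$f_2'(s,t)=\int_{\mathbb{Z}_+\times[0,1]}\mathrm{Bin}(x-2,y)(s)\,\mathrm{Bin}(x-2,y)(t)\,\frac{(x)_2\,y\,P(dx,dy)}{P_{21}}.$$ *)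

(* Defs.v *)
From HB Require Import structures.
From mathcomp Require Import all_boot all_order all_algebra finmap.
From mathcomp Require Import all_classical all_reals all_analysis.

Set Implicit Arguments.
Unset Strict Implicit.
Unset Printing Implicit Defensive.
Import Order.TTheory GRing.Theory Num.Theory.
Import numFieldNormedType.Exports.

Local Open Scope classical_set_scope.
Local Open Scope ring_scope.

(* The node set [n] is ['I_n], so the nodes 1, 2, ... are the ordinals of
   value 0, 1, ...; an unordered node pair is a set of cardinality 2. *)
Definition node_pairs n (A : {set 'I_n}) : {set {set 'I_n}} :=
  [set e : {set 'I_n} | (e \subset A) && (#|e| == 2)].

Definition is_lgraph n (g : {set 'I_n} * {set {set 'I_n}}) : bool :=
  g.2 \subset node_pairs g.1.

Record lgraph n := LGraph {
  lgraph_val :> ({set 'I_n} * {set {set 'I_n}})%type;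
  _ : is_lgraph lgraph_val }.

HB.instance Definition _ n := [isSub for @lgraph_val n].
HB.instance Definition _ n := [Finite of lgraph n by <:].

Definition lgraph_vertices n (g : lgraph n) : {set 'I_n} := (lgraph_val g).1.
Definition lgraph_edges n (g : lgraph n) : {set {set 'I_n}} := (lgraph_val g).2.

Lemma is_lgraph0 n : is_lgraph (finset.set0, finset.set0 : {set {set 'I_n}}).
Proof. by apply/fintype.subsetP => e; rewrite inE. Qed.

HB.instance Definition _ n := isPointed.Build (lgraph n) (LGraph (is_lgraph0 n)).
HB.instance Definition _ n := @isMeasurable.Build default_measure_display
  (lgraph n) discrete_measurable discrete_measurable0
  discrete_measurableC discrete_measurableU.

Definition mutually_independent d d' (Omega : measurableType d)
    (T : measurableType d') (R : realType) (Pr : probability Omega R)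
    (I : choiceType) (X : I -> Omega -> T) : Prop :=
  forall (F : {fset I}) (B : I -> set T),
    (forall i, i \in F -> measurable (B i)) ->
    Pr (\bigcap_(i in [set` F]) (X i @^-1` B i)) =
    (\prod_(i <- F) Pr (X i @^-1` B i))%E.

(* The space Z_+ x [0,1], as a closed subset of [nat * R]. *)
Definition layer_space (R : realType) : set (nat * R) :=
  [set z | 0 <= z.2 <= 1].

Definition bounded_continuous_on (R : realType) (T : topologicalType)
    (D : set T) (phi : T -> R) : Prop :=
  {within D, continuous phi} /\ exists M : R, forall z, D z -> `|phi z| <= M.

Definition weak_cvg_layer (R : realType) (Pn : nat -> set (nat * R) -> \bar R)
    (P : set (nat * R) -> \bar R) : Prop :=
  forall phi : nat * R -> R, bounded_continuous_on (@layer_space R) phi ->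
    (\int[Pn n]_(z in @layer_space R) (phi z)%:E)%E @[n --> \oo] -->
    (\int[P]_(z in @layer_space R) (phi z)%:E)%E.

Definition weak_cvg_nat2 (R : realType) (fn : nat -> set (nat * nat) -> \bar R)
    (f : set (nat * nat) -> \bar R) : Prop :=
  forall phi : nat * nat -> R,
    bounded_continuous_on [set: (nat * nat)%type] phi ->
    (\int[fn n]_z (phi z)%:E)%E @[n --> \oo] --> (\int[f]_z (phi z)%:E)%E.

Definition conv_nat2 (R : realType) (f g : set (nat * nat) -> \bar R) :
    set (nat * nat) -> \bar R :=
  pushforward (f \x g)%E
    (fun z : (nat * nat) * (nat * nat) =>
       ((z.1.1 + z.2.1)%N, (z.1.2 + z.2.2)%N)).

(* [Z w = (G, (X, Y))] is a random layer: (X,Y) has law [Pn]; given (X,Y) the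
   node set of G is uniform on the subsets of [n] of size X; given also the node
   set, each of its pairs is linked with probability Y independently of the
   others.  The two conditional laws are expressed through the defining property
   of a conditional probability given (X,Y), respectively (V(G),X,Y): equality
   of the integrals over every event of the conditioning sigma-algebra. *)
Record random_layer (R : realType) (n : nat) d (Omega : measurableType d)
    (Pr : probability Omega R) (Pn : probability (nat * R)%type R)
    (Z : Omega -> lgraph n * (nat * R)) : Prop := {
  size_strength_law : forall B : set (nat * R), measurable B ->
    Pr [set w | B (Z w).2] = Pn B;
  nodes_given_size_strength :
    forall (A : {set 'I_n}) (B : set (nat * R)), measurable B ->
    Pr [set w | B (Z w).2 /\ lgraph_vertices (Z w).1 = A] =
    (\int[Pr]_(w in [set w | B (Z w).2])
       (if #|A| == (Z w).2.1 then ('C(n, (Z w).2.1)%:R)^-1 else 0)%:E)%E;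
  links_given_nodes_size_strength :
    forall (A : {set 'I_n}) (F : {set {set 'I_n}}) (B : set (nat * R)),
    F \subset node_pairs A -> measurable B ->
    Pr [set w | [/\ B (Z w).2, lgraph_vertices (Z w).1 = A
                  & lgraph_edges (Z w).1 = F]] =
    (\int[Pr]_(w in [set w | B (Z w).2 /\ lgraph_vertices (Z w).1 = A])
       (\prod_(e in node_pairs A)
          (if e \in F then (Z w).2.2 else 1 - (Z w).2.2))%:E)%E }.

Record layer_model (R : realType) (n m : nat) d (Omega : measurableType d)
    (Pr : probability Omega R) (Pn : probability (nat * R)%type R)
    (Z : 'I_m -> {RV Pr >-> (lgraph n * (nat * R))%type}) : Prop := {
  layer_support : Pn [set z | (z.1 <= n)%N /\ layer_space z] = 1%E;
  layers_independent :
    mutually_independent Pr (fun k => (Z k : Omega -> lgraph n * (nat * R)));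
  layers_law : forall k, random_layer Pr Pn (Z k) }.

Section superposition.
Variables (R : realType) (n m : nat) (d : measure_display).
Variables (Omega : measurableType d).
Variable Z : 'I_m -> Omega -> lgraph n * (nat * R).

Definition superposition_edges (w : Omega) : {set {set 'I_n}} :=
  (\bigcup_(k < m) lgraph_edges (Z k w).1)%SET.

Definition adjacent (w : Omega) (i j : 'I_n) : bool :=
  [set i; j]%SET \in superposition_edges w.

Definition deg (w : Omega) (i : 'I_n) : nat := #|[set j | adjacent w i j]%SET|.

(* The law of (deg i, deg j) given that {i, j} is an edge; the null measure if
   that event has probability 0. *)
Definition bidegree_law (Pr : probability Omega R) (i j : 'I_n) :
    set (nat * nat) -> \bar R :=
  fun S => (fine (Pr [set w | S (deg w i, deg w j) /\ adjacent w i j])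
            / fine (Pr [set w | adjacent w i j]))%:E.

End superposition.

(* The nodes 1 and 2 of [n.+2]. *)
Definition node1 n : 'I_n.+2 := @Ordinal n.+2 0 isT.
Definition node2 n : 'I_n.+2 := @Ordinal n.+2 1 isT.

(* Extended real: the moment may be infinite. *)
Definition cross_moment (R : realType) (P : set (nat * R) -> \bar R)
    (r s : nat) : \bar R :=
  (\int[P]_(z in @layer_space R) ((z.1 ^_ r)%:R * z.2 ^+ s)%:E)%E.

(* The truncated subtraction [z.1.-1] is harmless: the weight [z.1] vanishes
   at 0. *)
Definition g_pmf (R : realType) (P : set (nat * R) -> \bar R) (s : nat) : \bar R :=
  (\int[P]_(z in @layer_space R)
     (binomial_pmf z.1.-1 z.2 s * (z.1%:R / fine (cross_moment P 1 0)))%:E)%E.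

(* Independent Lambda, H_1, H_2, ... with Lambda Poisson of mean [lambda] > 0
   and each H_k of law [g]; here H_1, H_2, ... are [H 0], [H 1], ... *)
Record compound_poisson_variables (R : realType) (lambda : R)
    (g : nat -> \bar R) d (Omega : measurableType d) (Q : probability Omega R)
    (Lambda : {RV Q >-> nat}) (H : nat -> {RV Q >-> nat}) : Prop := {
  cp_independent : mutually_independent Q
    (fun k : nat => if k is j.+1 then (H j : Omega -> nat) else Lambda);
  cp_Lambda : forall k : nat,
    Q [set w | Lambda w = k] = (poisson_pmf lambda k)%:E;
  cp_H : forall k s : nat, Q [set w | H k w = s] = g s }.

Definition compound_law (R : realType) d (Omega : measurableType d)
    (Q : probability Omega R) (Lambda : Omega -> nat) (H : nat -> Omega -> nat) :
    set nat -> \bar R :=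
  pushforward Q (fun w => (\sum_(k < Lambda w) H k w)%N).

(* Truncated subtraction is harmless here too, because of the factor
   [z.1 ^_ 2]. *)
Definition f2'_pmf (R : realType) (P : set (nat * R) -> \bar R) (s t : nat) :
    \bar R :=
  (\int[P]_(z in @layer_space R)
     (binomial_pmf (z.1 - 2) z.2 s * binomial_pmf (z.1 - 2) z.2 t
      * ((z.1 ^_ 2)%:R * z.2 / fine (cross_moment P 2 1)))%:E)%E.

Definition f2' (R : realType) (P : set (nat * R) -> \bar R) :
    set (nat * nat) -> \bar R :=
  fun S => (\esum_(z in S) f2'_pmf P z.1 z.2)%E.

Definition f2bar (R : realType) (f1bar : set nat -> \bar R)
    (P : set (nat * R) -> \bar R) : set (nat * nat) -> \bar R :=
  conv_nat2 (conv_nat2 (@dirac _ (nat * nat)%type (1%N, 1%N) R)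
                       (f1bar \x f1bar)%E)
            (f2' P).

(* Main.v *)
(* A node pair is linked by at most one layer up to an error of smaller order, and
   degrees are sums of degrees over the layers up to neighbours shared by two
   layers.  Hence, n times the bivariate generating function of the degrees of the
   nodes 1, 2 on the event that they are adjacent is asymptotically n m times the
   contribution of the layer linking them, which is 1/(n)_2 times the integral of
   (x)_2 y s t (1 - y + y s)^(x-2) (1 - y + y t)^(x-2) against P^(n), times the
   (m-1)-st power of the generating function of a single layer, which is
   1 - (a(s) + a(t)) / n + o(1/n) with a(s) the integral of
   x (1 - (1 - y + y s)^(x-1)), so that the power tends to the compound Poisson
   factor exp(- mu (a(s) + a(t))).  Convergence of the moments P_10 and P_21 makes
   the integrands uniformly integrable.  Convergence of generating functions on
   (0,1)^2 to that of a probability measure gives weak convergence.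

   For test functions of quadratic growth, the second moments of the degrees must
   be uniformly integrable.  A large degree comes either from the layer linking the
   pair, whose tail is controlled by P_32 and P_43, or from the remaining layers,
   independent of it, whose third factorial moment is bounded by means of P_21,
   P_32 and P_43. *)
Require Import Defs.
From HB Require Import structures.
From mathcomp Require Import all_boot all_order all_algebra finmap.
From mathcomp Require Import all_classical all_reals all_analysis.
From mathcomp Require Import measurable_realfun lra ring zify.
Set Implicit Arguments.
Unset Strict Implicit.
Unset Printing Implicit Defensive.
Import Order.TTheory GRing.Theory Num.Theory.
Import numFieldNormedType.Exports.
Local Open Scope classical_set_scope.
Local Open Scope ring_scope.

(** * Degrees in one layer *)

(** Sizes and strengths are integrated out at the start: the layer graphs become independent draws
    from a finite type, and the bidegree law becomes a quotient of two finite sums. For given size x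
    and strength y the means over one layer are polynomials in y, hence continuous test functions
    once the size is cut off.

    The obstacle in (i) is that the error terms contain moments on which nothing is assumed: that of
    [(x)_2] when both nodes lie in one layer, that of [(x)_3 y^2] when a link meets a degree in the
    same layer. Each carries an additional factor 1/n. Since x <= n, this factor absorbs one power
    of x and leaves the integrand of P_10 or P_21 as a dominating function; for each fixed size the
    term is O(1/n), so it vanishes in the limit.

    In (ii) the remaining layers are measured by a cubic moment because it exceeds the square by the
    factor 1/K that makes a tail small. A degree inside one layer has r-th factorial moment
    [(x)_(r+1) y^r / n] given x and y, which explains the orders 21, 32, 43. *)

Lemma sum_subset_prod (C : comNzRingType) (T : finType) (E : {set T})
    (a b : T -> C) :
  \sum_(F : {set T} | F \subset E) \prod_(e in E) (if e \in F then a e else b e)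
  = \prod_(e in E) (a e + b e).
Proof.
have -> : \prod_(e in E) (a e + b e) =
    \prod_e ((if e \in E then a e else 0) + (if e \in E then b e else 1)).
  by rewrite big_mkcond; apply: eq_bigr => e _; case: (e \in E) => //; rewrite add0r.
rewrite bigA_distr big_mkcond /=; apply: eq_bigr => F _.
case: ifPn => [FE|/subsetPn[e eF eE]]; last first.
  by rewrite (bigD1 e) //= eF (negbTE eE) mul0r.
rewrite big_mkcond; apply: eq_bigr => e _.
case: ifPn => // eE; case: ifPn => // /(fintype.subsetP FE).
by rewrite (negbTE eE).
Qed.

(** Taken on a bare edge set so as to serve one layer and the union alike. When [F] consists of node
    pairs, [v = i] counts nothing, as [[set i; i]] has one element. *)
Definition ldeg n (F : {set {set 'I_n}}) (i : 'I_n) : nat :=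
  #|[set v | [set i; v]%SET \in F]%SET|.

Section degree_in_layer.
Variable n : nat.
Implicit Types (A : {set 'I_n}) (F : {set {set 'I_n}}) (i j : 'I_n).

Lemma pair_in_node_pairs A i j :
  ([set i; j]%SET \in node_pairs A) = [&& i \in A, j \in A & i != j].
Proof.
rewrite inE finset.subUset !finset.sub1set cards2 -andbA.
by case: (i \in A) (j \in A) (i == j) => [] [] [].
Qed.

Lemma set2_injr i : {in predC1 i &, injective (fun v => [set i; v]%SET)}.
Proof.
move=> u v; rewrite !inE => ui vi /= /setP/(_ u).
by rewrite !inE eqxx orbT (negbTE ui) /= => /esym/eqP.
Qed.

Lemma node_pair_other A e i : e \in node_pairs A -> i \in e ->
  exists2 v, v != i & e = [set i; v]%SET.
Proof.
rewrite inE => /andP[_ /cards2P[a [b [ab ->]]]]; rewrite !inE => /orP[] /eqP->.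
  by exists b => //; rewrite eq_sym.
by exists a => //; rewrite finset.setUC.
Qed.

Lemma ldeg_incident A F i : F \subset node_pairs A ->
  ldeg F i = #|[set e in F | i \in e]%SET|.
Proof.
move=> FA; rewrite /ldeg -(card_in_imset (f := fun v => [set i; v]%SET)).
  apply: eq_card => e; apply/imsetP/idP.
    by case=> v; rewrite !inE => vF ->; rewrite vF !inE eqxx.
  rewrite !inE => /andP[eF ie].
  have [v vi ev] := node_pair_other (fintype.subsetP FA e eF) ie.
  by exists v => //; rewrite inE -ev.
move=> u v; rewrite !inE => uF vF; apply: set2_injr; rewrite !inE.
  move/(fintype.subsetP FA): uF; rewrite pair_in_node_pairs => /and3P[_ _].
  by rewrite eq_sym.
move/(fintype.subsetP FA): vF; rewrite pair_in_node_pairs => /and3P[_ _].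
by rewrite eq_sym.
Qed.

Lemma card_node_pairs_incident A i : i \in A ->
  #|[set e in node_pairs A | i \in e]%SET| = (#|A|).-1.
Proof.
move=> iA; rewrite -(@ldeg_incident A) // /ldeg.
rewrite (cardsD1 i A) iA add1n /=; apply: eq_card => v.
by rewrite inE pair_in_node_pairs iA !inE /= eq_sym andbC.
Qed.

(** As a product over node pairs the power can be absorbed, pair by pair, into the product of
    independent link probabilities. *)
Lemma expr_ldeg (C : comNzRingType) A F i (s : C) : F \subset node_pairs A ->
  s ^+ ldeg F i = \prod_(e in node_pairs A) (if (e \in F) && (i \in e) then s else 1).
Proof.
move=> FA; rewrite (ldeg_incident i FA) -prodr_const -big_mkcondr /=.
apply: eq_bigl => e; rewrite !inE; case: (boolP (e \in F)) => eF; last first.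
  by rewrite andbF.
by have := fintype.subsetP FA e eF; rewrite inE => ->.
Qed.

(** The degree is binomial: pairs that contain [i] contribute [1 - y + y * s], all others
    [1 - y + y = 1]. *)
Lemma ldeg_gf (C : comNzRingType) A i (y s : C) : i \in A ->
  \sum_(F : {set {set 'I_n}} | F \subset node_pairs A)
     (\prod_(e in node_pairs A) (if e \in F then y else 1 - y)) * s ^+ ldeg F i
  = (1 - y + y * s) ^+ (#|A|).-1.
Proof.
move=> iA.
under eq_bigr => F FA.
  rewrite (expr_ldeg i s FA) -big_split /=.
  under eq_bigr => e eA.
    rewrite (_ : _ * _ = if e \in F then y * (if i \in e then s else 1) else 1 - y).
      over.
    by case: ifP => //=; rewrite mulr1.
  over.
rewrite sum_subset_prod -(card_node_pairs_incident iA) -prodr_const.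
rewrite [RHS]big_mkcond [LHS]big_mkcond /=; apply: eq_bigr => e _.
rewrite [e \in [set _ in _ | _]%SET]finset.in_set.
case: ifP => //= _; case: ifP => _; first by rewrite addrC.
by rewrite mulr1 addrC subrK.
Qed.

(** On the link, the two degrees are one plus independent binomials, because no other pair contains
    both [i] and [j]. *)
Lemma ldeg_edge_gf (C : comNzRingType) A i j (y s t : C) :
  i \in A -> j \in A -> i != j ->
  \sum_(F : {set {set 'I_n}} | F \subset node_pairs A)
     (\prod_(e in node_pairs A) (if e \in F then y else 1 - y))
     * (([set i; j]%SET \in F)%:R * s ^+ ldeg F i * t ^+ ldeg F j)
  = y * s * t * (1 - y + y * s) ^+ (#|A| - 2) * (1 - y + y * t) ^+ (#|A| - 2).
Proof.
move=> iA jA ij; set ij2 := [set i; j]%SET.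
have ijA : ij2 \in node_pairs A by rewrite pair_in_node_pairs iA jA.
pose q (e : {set 'I_n}) x k : C := if k \in e then x else 1.
under eq_bigr => F FA.
  (* The indicator of the link is also a product over pairs: its only factor that can vanish is the
     one of [ij2] when this pair is not linked. *)
  have -> : (ij2 \in F)%:R =
      \prod_(e in node_pairs A) (if e \in F then 1 else (e != ij2)%:R) :> C.
    rewrite (bigD1 ij2) //= eqxx /=; case: ifP => _; last by rewrite mul0r.
    by rewrite big1 ?mulr1// => e /andP[_ ->]; case: ifP.
  rewrite (expr_ldeg i s FA) (expr_ldeg j t FA) -!big_split /=.
  under eq_bigr => e eA.
    rewrite (_ : _ * _ = if e \in F then y * (q e s i * q e t j)
                         else (1 - y) * (e != ij2)%:R).
      over.
    by rewrite /q; case: ifP => //=; rewrite ?mul1r ?mulr1.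
  over.
rewrite sum_subset_prod (bigD1 ij2) //= eqxx /= mulr0 addr0.
rewrite /q !inE !eqxx orbT -!mulrA; congr (_ * (_ * (_ * _))).
transitivity (\prod_(e in node_pairs A | e != ij2)
   (q e (1 - y + y * s) i * q e (1 - y + y * t) j)).
  apply: eq_bigr => e /andP[eA eij]; rewrite eij mulr1 /q.
  case: ifPn => ie; case: ifPn => je; rewrite ?mulr1 ?mul1r ?(addrC (1 - y)) //.
  - case/negP: eij; have [v vi ev] := node_pair_other eA ie.
    move: je; rewrite ev !inE => /orP[/eqP ji|/eqP <-//].
    by rewrite ji eqxx in ij.
  - by rewrite addrC subrK.
have H (k : 'I_n) (x : C) : k \in A -> k \in ij2 ->
    \prod_(e in node_pairs A | e != ij2) q e x k = x ^+ (#|A| - 2).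
  move=> kA kij.
  rewrite (_ : (#|A| - 2)%N = #|[set e in node_pairs A | k \in e] :\ ij2|%SET); last first.
    have := cardsD1 ij2 [set e in node_pairs A | k \in e]%SET.
    by rewrite card_node_pairs_incident // inE ijA kij subn2 => ->.
  rewrite -prodr_const /q -big_mkcondr /=; apply: eq_bigl => e.
  by rewrite !inE andbCA andbA.
by rewrite big_split /= !H // !inE eqxx ?orbT.
Qed.

End degree_in_layer.

(** * Superposition of iid layers *)

(** The expectation of [F] at [m] independent draws of law [w]. The ring is arbitrary because
    [iid_sum_ffact3] takes weights in [{poly R}]. *)
Definition iid_sum (C : comNzRingType) (T : finType) (w : T -> C) m
    (F : {ffun 'I_m -> T} -> C) : C :=
  \sum_(g : {ffun 'I_m -> T}) (\prod_k w (g k)) * F g.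

Section iid_sum.
Variables (C : comNzRingType) (T : finType) (w : T -> C) (m : nat).
Hypothesis w1 : \sum_x w x = 1.
Let mean (f : T -> C) := \sum_x w x * f x.

Lemma eq_iid_sum (F G : {ffun 'I_m -> T} -> C) : F =1 G -> iid_sum w F = iid_sum w G.
Proof. by move=> FG; apply: eq_bigr => g _; rewrite FG. Qed.

Lemma iid_sumD (F G : {ffun 'I_m -> T} -> C) :
  iid_sum w (fun g => F g + G g) = iid_sum w F + iid_sum w G.
Proof. by rewrite -big_split; apply: eq_bigr => g _; rewrite mulrDr. Qed.

Lemma iid_sumZ a (F : {ffun 'I_m -> T} -> C) :
  iid_sum w (fun g => a * F g) = a * iid_sum w F.
Proof. by rewrite /iid_sum big_distrr; apply: eq_bigr => g _; rewrite mulrCA. Qed.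

Lemma iid_sum_sum (I : Type) (r : seq I) (P : pred I)
    (F : I -> {ffun 'I_m -> T} -> C) :
  iid_sum w (fun g => \sum_(i <- r | P i) F i g) = \sum_(i <- r | P i) iid_sum w (F i).
Proof.
rewrite /iid_sum exchange_big; apply: eq_bigr => g _.
by rewrite big_distrr.
Qed.

Lemma iid_sum_prod (h : 'I_m -> T -> C) :
  iid_sum w (fun g => \prod_k h k (g k)) = \prod_k mean (h k).
Proof. by rewrite bigA_distr_bigA; apply: eq_bigr => g _; rewrite -big_split. Qed.

(** The draw [j] plays the linking layer, separated from the [m.-1] others. *)
Lemma iid_sum_own (j : 'I_m) (f h : T -> C) :
  iid_sum w (fun g => f (g j) * \prod_(k | k != j) h (g k))
  = mean f * mean h ^+ m.-1.
Proof.
transitivity (\prod_k mean (if k == j then f else h)).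
  rewrite -iid_sum_prod; apply: eq_iid_sum => g.
  rewrite [RHS](bigD1 j) //= eqxx; congr (_ * _).
  by apply: eq_bigr => k /negbTE ->.
rewrite (bigD1 j) //= eqxx; congr (_ * _).
rewrite (eq_bigr (fun=> mean h)) ?prodr_const; last by move=> k /negbTE ->.
by rewrite cardC1 card_ord.
Qed.

Lemma mean1 : mean (fun=> 1) = 1.
Proof. by rewrite -[RHS]w1; apply: eq_bigr => x _; rewrite mulr1. Qed.

Lemma iid_sum1 (j : 'I_m) (f : T -> C) : iid_sum w (fun g => f (g j)) = mean f.
Proof.
have := iid_sum_own j f (fun=> 1); rewrite mean1 expr1n mulr1 => <-.
by apply: eq_iid_sum => g; rewrite big1 ?mulr1.
Qed.

Lemma iid_sum2 (j k : 'I_m) (f g : T -> C) : j != k ->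
  iid_sum w (fun x => f (x j) * g (x k)) = mean f * mean g.
Proof.
move=> jk; transitivity (\prod_i mean (if i == j then f else if i == k then g else fun=> 1)).
  rewrite -iid_sum_prod; apply: eq_iid_sum => x.
  rewrite (bigD1 j) //= eqxx (bigD1 k) /=; last by rewrite eq_sym.
  rewrite eq_sym (negbTE jk) eqxx big1 ?mulr1 // => i /andP[/negbTE -> /negbTE ->] //.
rewrite (bigD1 j) //= eqxx (bigD1 k) /=; last by rewrite eq_sym.
rewrite eq_sym (negbTE jk) eqxx big1 ?mulr1 // => i /andP[/negbTE -> /negbTE ->].
exact: mean1.
Qed.

Lemma iid_sum3 (j k l : 'I_m) (f g h : T -> C) : j != k -> j != l -> k != l ->
  iid_sum w (fun x => f (x j) * g (x k) * h (x l)) = mean f * mean g * mean h.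
Proof.
move=> jk jl kl.
transitivity (\prod_i mean (if i == j then f else if i == k then g
                            else if i == l then h else fun=> 1)).
  rewrite -iid_sum_prod; apply: eq_iid_sum => x.
  rewrite (bigD1 j) //= eqxx (bigD1 k) /=; last by rewrite eq_sym.
  rewrite (bigD1 l) /=; last by rewrite 2![l == _]eq_sym jl kl.
  rewrite ![k == j]eq_sym (negbTE jk) ![l == _]eq_sym (negbTE jl) (negbTE kl) !eqxx.
  rewrite big1 ?mulr1 ?mulrA //.
  by move=> i /andP[/andP[/negbTE -> /negbTE ->] /negbTE ->].
rewrite (bigD1 j) //= eqxx (bigD1 k) /=; last by rewrite eq_sym.
rewrite (bigD1 l) /=; last by rewrite 2![l == _]eq_sym jl kl.
rewrite ![k == j]eq_sym (negbTE jk) ![l == _]eq_sym (negbTE jl) (negbTE kl) !eqxx.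
rewrite big1 ?mulr1 ?mulrA //.
by move=> i /andP[/andP[/negbTE -> /negbTE ->] /negbTE ->]; exact: mean1.
Qed.

End iid_sum.

Lemma le_iid_sum (R : numDomainType) (T : finType) (w : T -> R) m
    (F G : {ffun 'I_m -> T} -> R) :
  (forall x, 0 <= w x) -> (forall g, F g <= G g) -> iid_sum w F <= iid_sum w G.
Proof.
by move=> w0 FG; apply: ler_sum => g _; apply: ler_wpM2l => //; apply: prodr_ge0.
Qed.

(* The third factorial moment of a sum of iid variables, read off from the
   third derivative at 1 of the polynomial [q ^+ m]. *)
Lemma iid_sum_ffact3 (R : comNzRingType) (T : finType) (w : T -> R) m
    (j : 'I_m) (f : T -> R) (d : T -> nat) :
  \sum_x w x = 1 ->
  let M r := \sum_x w x * (d x ^_ r)%:R in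
  iid_sum w (fun g : {ffun 'I_m -> T} =>
      f (g j) * ((\sum_(k | k != j) d (g k)) ^_ 3)%:R)
  = (\sum_x w x * f x) *
    ((m.-1 ^_ 3)%:R * M 1%N ^+ 3 + 3%:R * (m.-1 ^_ 2)%:R * M 1%N * M 2%N
     + m.-1%:R * M 3%N).
Proof.
move=> w1 M.
pose q : {poly R} := \sum_x (w x)%:P * 'X^(d x).
pose Q : {poly R} := (\sum_x w x * f x)%:P * q ^+ m.-1.
have derivP (c : R) (a : nat) r : (c%:P * 'X^a)^`(r).[1] = c * (a ^_ r)%:R.
  by rewrite -[_%:P * _]/(_ * _) mul_polyC derivnZ derivnXn hornerZ hornerMn hornerXn expr1n.
have -> : iid_sum w (fun g : {ffun 'I_m -> T} =>
      f (g j) * ((\sum_(k | k != j) d (g k)) ^_ 3)%:R) = Q^`(3).[1].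
  have -> : Q = iid_sum (fun x => (w x)%:P)
      (fun g : {ffun 'I_m -> T} => (f (g j))%:P * \prod_(k | k != j) 'X^(d (g k))).
    rewrite (iid_sum_own _ j (fun x => (f x)%:P) (fun x => 'X^(d x))) /Q; congr (_ * _).
    by rewrite rmorph_sum; apply: eq_bigr => x _; rewrite rmorphM.
  rewrite /iid_sum linear_sum horner_sum; apply: eq_bigr => g _.
  rewrite mulrA -derivP; congr (_.[1]); congr (_^`(3)).
  by rewrite prodrXr polyCM (rmorph_prod polyC) mulrA.
have qr r : q^`(r).[1] = M r.
  by rewrite /q linear_sum horner_sum; apply: eq_bigr => x _; rewrite derivP.
have M0 : q.[1] = 1.
  by rewrite -[q]derivn0 qr /M -[RHS]w1; apply: eq_bigr => x _; rewrite ffactn0 mulr1.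
(* Since [q] equals 1 at the point 1, the third derivative of its power sorts the choice of three
   units by the number of draws, three, two or one, that supply them. *)
rewrite /Q mul_polyC derivnZ hornerZ; congr (_ * _).
rewrite -!qr; set N := m.-1; clearbody N.
have [q1 q2 q3] : [/\ q^`(1) = q^`(), q^`(2) = q^`()^`() & q^`(3) = q^`()^`()^`()].
  by rewrite !derivnS derivn0.
rewrite q1 q2 q3 !derivnS derivn0 deriv_exp.
rewrite !(derivMn, derivM, deriv_exp, derivD).
rewrite !(hornerMn, hornerD, hornerM, horner_exp).
rewrite M0 !expr1n !mulr1.
clear Q derivP qr M0 q1 q2 q3.
move: (q^`().[1]) (q^`()^`().[1]) (q^`()^`()^`().[1]) => a b c.
rewrite !ffactnS ffactn0 !muln1.
rewrite !natrM; move: (N.-1) (N.-2) (N.-1.-2) => y z ?.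
ring.
Qed.

Definition union_edges n m (x : {ffun 'I_m -> lgraph n}) : {set {set 'I_n}} :=
  (\bigcup_(k < m) lgraph_edges (x k))%SET.

Definition edge n (i j : 'I_n) (g : lgraph n) : bool :=
  [set i; j]%SET \in lgraph_edges g.

Definition gdeg n (i : 'I_n) (g : lgraph n) : nat := ldeg (lgraph_edges g) i.

Section superposition_overlaps.
Variables (n m : nat).
Implicit Types (x : {ffun 'I_m -> lgraph n}) (i j v : 'I_n).

Lemma edge_irr i (g : lgraph n) : edge i i g = false.
Proof.
apply/negbTE/negP => /(fintype.subsetP (valP g)).
by rewrite pair_in_node_pairs eqxx /= !andbF.
Qed.

Lemma gdegE i (g : lgraph n) : gdeg i g = (\sum_v edge i v g)%N.
Proof. by rewrite /gdeg /ldeg -sum1_card big_mkcond; apply: eq_bigr => v _; rewrite inE. Qed.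

(** One true index [k] pays 1, and every other true [l] is charged to the ordered pair [(k, l)]. *)
Lemma sum_le_has (b : 'I_m -> bool) :
  (\sum_k b k <= [exists k, b k] + \sum_k \sum_(l | l != k) b k * b l)%N.
Proof.
have [/existsP[k bk]|/existsPn b0] := boolP [exists k, b k]; last first.
  by rewrite big1 // => k _; rewrite (negbTE (b0 k)).
rewrite (bigD1 k) //= bk leq_add // [leqRHS](bigD1 k) //= bk.
by rewrite (leq_trans _ (leq_addr _ _)) // leq_sum // => l _; rewrite mul1n.
Qed.

Lemma union_edgeE x i j :
  ([set i; j]%SET \in union_edges x) = [exists k, edge i j (x k)].
Proof.
by apply/bigcupP/existsP => [[k _ kE]|[k kE]]; exists k.
Qed.

Lemma ldeg_union x i :
  ldeg (union_edges x) i = (\sum_v [exists k, edge i v (x k)])%N.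
Proof.
rewrite /ldeg -sum1_card big_mkcond; apply: eq_bigr => v _.
by rewrite inE union_edgeE; case: ifP.
Qed.

Lemma sum_gdegE x i : (\sum_k gdeg i (x k) = \sum_v \sum_k edge i v (x k))%N.
Proof. by rewrite exchange_big; apply: eq_bigr => k _; rewrite gdegE. Qed.

Lemma ldeg_union_le x i : (ldeg (union_edges x) i <= \sum_k gdeg i (x k))%N.
Proof.
rewrite ldeg_union sum_gdegE; apply: leq_sum => v _.
by case: existsP => // -[k kE]; rewrite (bigD1 k) //= kE.
Qed.

Lemma sum_gdeg_le x i : (\sum_k gdeg i (x k) <= ldeg (union_edges x) i
  + \sum_v \sum_k \sum_(l | l != k) edge i v (x k) * edge i v (x l))%N.
Proof.
by rewrite ldeg_union sum_gdegE -big_split; apply: leq_sum => v _; apply: sum_le_has.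
Qed.

End superposition_overlaps.

Section superposition_gf.
Variables (R : realFieldType) (n m : nat) (w : lgraph n -> R).
Hypotheses (w0 : forall g, 0 <= w g) (w1 : \sum_g w g = 1).
Let mean (f : lgraph n -> R) := \sum_g w g * f g.
Variable p : R.
Hypothesis mean_edge : forall i j : 'I_n, i != j -> mean (fun g => (edge i j g)%:R) = p.
Hypothesis p0 : 0 <= p.
Implicit Types (i j : 'I_n).

Let mean_edge_le i v : 0 <= mean (fun g => (edge i v g)%:R) <= p.
Proof.
have [->|iv] := eqVneq i v; last by rewrite mean_edge // p0 lexx.
by rewrite /mean big1 ?lexx // => g _; rewrite edge_irr mulr0.
Qed.

Let mean_ge0 f : (forall g, 0 <= f g) -> 0 <= mean f.
Proof. by move=> f0; apply: sumr_ge0 => g _; rewrite mulr_ge0. Qed.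

(** If the linking layer [q] differs from [k] and [l], three independent edges occur, each of
    probability at most [p], for each of the [n] possible shared neighbours. If [q] is one of [k],
    [l], the link and an edge at [u] lie in the same layer, which sums over [v] to the mean of link
    times degree, and the other edge still costs [p]. *)
Lemma overlap_mean i j u (k l q : 'I_m) : i != j -> k != l ->
  \sum_v iid_sum w (fun x => (edge i j (x q))%:R
     * ((edge u v (x k) * edge u v (x l))%N)%:R)
  <= n%:R * p ^+ 3 + ((q == k) + (q == l))%:R * (p
      * mean (fun g => (edge i j g)%:R * (gdeg u g)%:R)).
Proof.
move=> ij kl; pose e g : R := (edge i j g)%:R; pose b v g : R := (edge u v g)%:R.
have -> : mean (fun g => (edge i j g)%:R * (gdeg u g)%:R) =
    \sum_v mean (fun g => e g * b v g).
  rewrite /mean exchange_big; apply: eq_bigr => g _.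
  by rewrite -!big_distrr gdegE natr_sum.
rewrite [X in X + _](_ : _ = \sum_(v < n) p ^+ 3); last first.
  by rewrite sumr_const card_ord mulr_natl.
rewrite !big_distrr -big_split; apply: ler_sum => v _ /=.
have /andP[b0 bp] := mean_edge_le u v.
have eb0 : 0 <= mean (fun g => e g * b v g) by apply: mean_ge0 => g; rewrite mulr_ge0.
have p30 : 0 <= p ^+ 3 by rewrite exprn_ge0.
have [qk|qk] := eqVneq q k.
  rewrite qk (negbTE kl) addn0 mul1r.
  rewrite (@eq_iid_sum _ _ _ _ _ (fun x => (e (x k) * b v (x k)) * b v (x l))); last first.
    by move=> x; rewrite natrM mulrA.
  rewrite (iid_sum2 w1 (fun g => e g * b v g) (b v) kl) -/(mean _) mulrC.
  by rewrite -[leLHS]add0r lerD // ler_wpM2r.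
have [ql|ql] := eqVneq q l.
  rewrite ql add0n mul1r.
  rewrite (@eq_iid_sum _ _ _ _ _ (fun x => (e (x l) * b v (x l)) * b v (x k))); last first.
    by move=> x; rewrite natrM mulrA mulrAC.
  rewrite (@iid_sum2 _ _ _ _ w1 _ _ (fun g => e g * b v g) (b v)) 1?eq_sym //.
  by rewrite -/(mean _) mulrC -[leLHS]add0r lerD // ler_wpM2r.
rewrite mul0r addr0.
rewrite (@eq_iid_sum _ _ _ _ _ (fun x => e (x q) * b v (x k) * b v (x l))); last first.
  by move=> x; rewrite natrM mulrA.
rewrite (iid_sum3 w1 e (b v) (b v) qk ql kl) -/(mean e) -/(mean (b v)).
rewrite (mean_edge ij) -mulrA exprS.
by rewrite ler_wpM2l // expr2 ler_pM.
Qed.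

(* Except for overlaps, that is a neighbour shared by two layers, an edge between
   [i] and [j] lies in a single layer and degrees add up over the layers, so the
   expectation factorizes. *)
Lemma union_gf_error i j (s t : R) : i != j -> 0 <= s <= 1 -> 0 <= t <= 1 ->
  `| iid_sum w (fun x : {ffun 'I_m -> lgraph n} =>
       [exists k, edge i j (x k)]%:R
       * (s ^+ ldeg (union_edges x) i * t ^+ ldeg (union_edges x) j))
     - m%:R * (mean (fun g => (edge i j g)%:R * (s ^+ gdeg i g * t ^+ gdeg j g))
               * mean (fun g => s ^+ gdeg i g * t ^+ gdeg j g) ^+ m.-1) |
  <= (m%:R * p) ^+ 2 + \sum_(u <- [:: i; j])
       (n%:R * (m%:R * p) ^+ 3 + 2 * m%:R * (m%:R * p)
          * mean (fun g => (edge i j g)%:R * (gdeg u g)%:R)).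
Proof.
move=> ij /andP[s0 s1] /andP[t0 t1].
pose h g := s ^+ gdeg i g * t ^+ gdeg j g.
pose ov u (x : {ffun 'I_m -> lgraph n}) : R := \sum_v \sum_k \sum_(l | l != k)
  ((edge u v (x k) * edge u v (x l))%N)%:R.
pose W' (x : {ffun 'I_m -> lgraph n}) := \prod_k h (x k).
pose e k (x : {ffun 'I_m -> lgraph n}) : R := (edge i j (x k))%:R.
have -> : m%:R * (mean (fun g => (edge i j g)%:R * (s ^+ gdeg i g * t ^+ gdeg j g))
               * mean (fun g => s ^+ gdeg i g * t ^+ gdeg j g) ^+ m.-1)
    = iid_sum w (fun x : {ffun 'I_m -> lgraph n} => \sum_k e k x * W' x).
  rewrite iid_sum_sum.
  rewrite (eq_bigr (fun=> mean (fun g => (edge i j g)%:R * h g) * mean h ^+ m.-1)).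
    by rewrite sumr_const card_ord mulr_natl.
  move=> k _; rewrite -(iid_sum_own w k); apply: eq_iid_sum => x.
  by rewrite /W' (bigD1 k) //= mulrA.
rewrite -[X in _ - X]mul1r -mulNr -iid_sumZ -iid_sumD.
apply: (le_trans (y := iid_sum w (fun x : {ffun 'I_m -> lgraph n} =>
   \sum_k \sum_(l | l != k) e k x * e l x
   + \sum_(u <- [:: i; j]) \sum_k e k x * ov u x))).
  rewrite /iid_sum (le_trans (ler_norm_sum _ _ _)) //; apply: ler_sum => x _.
  rewrite normrM ger0_norm; last by apply: prodr_ge0.
  apply: ler_wpM2l; first by apply: prodr_ge0.
  set N := \sum_k \sum_(l | l != k) e k x * e l x.
  have eE : \sum_k e k x = (\sum_k edge i j (x k))%N%:R by rewrite natr_sum.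
  have NE : N = (\sum_k \sum_(l | l != k) edge i j (x k) * edge i j (x l))%N%:R.
    rewrite natr_sum; apply: eq_bigr => k _; rewrite natr_sum.
    by apply: eq_bigr => l _; rewrite natrM.
  have I1 : \sum_k e k x <= [exists k, edge i j (x k)]%:R + N.
    by rewrite eE NE -natrD ler_nat sum_le_has.
  have I2 : [exists k, edge i j (x k)]%:R <= \sum_k e k x.
    rewrite eE ler_nat; case: existsP => // -[k kE].
    by rewrite (bigD1 k) //= kE.
  have ov_ge0 u : 0 <= ov u x by do 3!apply: sumr_ge0 => ? _.
  have ovE u : (\sum_k gdeg u (x k))%:R <= (ldeg (union_edges x) u)%:R + ov u x.
    rewrite /ov -[X in _ + X](_ : (\sum_v \sum_k \sum_(l | l != k)
       edge u v (x k) * edge u v (x l))%N%:R = _); last first.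
      rewrite natr_sum; apply: eq_bigr => v _; rewrite natr_sum.
      by apply: eq_bigr => k _; rewrite natr_sum.
    by rewrite -natrD ler_nat sum_gdeg_le.
  set W := s ^+ _ * _.
  have WE : W' x = s ^+ (\sum_k gdeg i (x k)) * t ^+ (\sum_k gdeg j (x k)).
    by rewrite /W' big_split !prodrXr.
  have W01 : 0 <= W <= 1.
    by rewrite mulr_ge0 ?exprn_ge0 //= mulr_ile1 ?exprn_ge0 ?exprn_ile1.
  have W'0 : 0 <= W' x by rewrite WE mulr_ge0 ?exprn_ge0.
  have W'W : W' x <= W.
    by rewrite WE ler_pM ?exprn_ge0 // ler_wiXn2l ?ldeg_union_le.
  have W'W1 : W - W' x <= 1.
    by case/andP: W01 => _ W1; rewrite (le_trans _ W1) // gerBl.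
  have ov1 u : (ldeg (union_edges x) u < \sum_k gdeg u (x k))%N -> 1 <= ov u x.
    rewrite -(ler_nat R) -natr1 => /le_trans/(_ (ovE u)).
    by rewrite lerD2l.
  (* Either both degrees add up exactly and [W = W'], or some overlap is at least 1, which already
     bounds [W - W']. *)
  have WW' : W - W' x <= ov i x + ov j x.
    have := ldeg_union_le x i; rewrite leq_eqVlt => /orP[/eqP Ei|/ov1 ovi]; last first.
      by rewrite (le_trans W'W1) // -[leLHS]addr0 lerD.
    have := ldeg_union_le x j; rewrite leq_eqVlt => /orP[/eqP Ej|/ov1 ovj]; last first.
      by rewrite (le_trans W'W1) // -[leLHS]add0r lerD.
    by rewrite WE -Ei -Ej subrr addr_ge0.
  rewrite big_cons big_seq1 -!big_distrl -mulrDr /=.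
  have e0 : 0 <= \sum_k e k x by apply: sumr_ge0.
  (* Two replacements are separated: the indicator of adjacency by the number of linking layers,
     with error at most the number of pairs of linking layers, and the degrees in the union by their
     sums over the layers, with error at most the overlaps. *)
  rewrite (_ : _ + _ = (\sum_k e k x) * (W - W' x)
    - (\sum_k e k x - [exists k, edge i j (x k)]%:R) * W); last by ring.
  clearbody W; set e' := \sum_k e k x in I1 I2 e0 *.
  case/andP: W01 => W0 W1; clearbody e' N.
  rewrite (le_trans (ler_normB _ _)) // addrC lerD // normrM !ger0_norm ?subr_ge0 //.
    by rewrite (le_trans (ler_piMr _ _)) ?subr_ge0 // lerBlDl.
  by rewrite ler_wpM2l.
rewrite iid_sumD lerD //.
  rewrite iid_sum_sum.
  apply: (le_trans (y := \sum_(k < m) \sum_(l < m) p ^+ 2)); last first.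
    by rewrite !sumr_const !card_ord -mulrnA -[leLHS]mulr_natl natrM exprMn expr2.
  apply: ler_sum => k _; rewrite iid_sum_sum.
  rewrite [leRHS](bigID (fun l => l != k)) /= -[leLHS]addr0 lerD //.
    apply: ler_sum => l lk.
    by rewrite (@iid_sum2 _ _ _ _ w1 k l (fun g => (edge i j g)%:R)
      (fun g => (edge i j g)%:R)) 1?eq_sym // -/(mean _) mean_edge.
  by apply: sumr_ge0 => l _; rewrite exprn_ge0.
rewrite iid_sum_sum; apply: ler_sum => u _.
set Mu := mean _.
have Mu0 : 0 <= Mu by apply: mean_ge0 => g; rewrite mulr_ge0.
have pM0 : 0 <= p * Mu by rewrite mulr_ge0.
apply: (le_trans (y := \sum_(q < m) \sum_(k < m) \sum_(l < m)
   (n%:R * p ^+ 3 + ((q == k) + (q == l))%:R * (p * Mu)))).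
  rewrite iid_sum_sum; apply: ler_sum => q _.
  rewrite (@eq_iid_sum _ _ _ _ _ (fun x => \sum_k \sum_(l | l != k) \sum_v
      (edge i j (x q))%:R * ((edge u v (x k) * edge u v (x l))%N)%:R)); last first.
    move=> x; rewrite /ov exchange_big big_distrr; apply: eq_bigr => k _ /=.
    rewrite exchange_big big_distrr; apply: eq_bigr => l _ /=.
    by rewrite big_distrr.
  rewrite iid_sum_sum; apply: ler_sum => k _; rewrite iid_sum_sum.
  rewrite [leRHS](bigID (fun l => l != k)) /= -[leLHS]addr0 lerD //.
    apply: ler_sum => l lk; rewrite iid_sum_sum; apply: overlap_mean => //.
    by rewrite eq_sym.
  by apply: sumr_ge0 => l _; rewrite addr_ge0 ?mulr_ge0 ?exprn_ge0.
rewrite (eq_bigr (fun q => \sum_(k < m) \sum_(l < m) n%:R * p ^+ 3 +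
   \sum_(k < m) \sum_(l < m) ((q == k) + (q == l))%:R * (p * Mu))); last first.
  by move=> q _; rewrite -big_split; apply: eq_bigr => k _; rewrite -big_split.
rewrite big_split lerD //=.
  rewrite !sumr_const !card_ord -!mulrnA -[leLHS]mulr_natl !natrM exprMn mulrCA.
  by rewrite mulrA (exprS _ 2) expr2.
have delta (q : 'I_m) : (\sum_(k < m) (q == k) = 1)%N.
  by rewrite (bigD1 q) //= eqxx big1 // => k /negbTE; rewrite eq_sym => ->.
rewrite (_ : \sum_q _ = (\sum_(q < m) \sum_(k < m) \sum_(l < m)
    ((q == k) + (q == l)))%N%:R * (p * Mu)).
  rewrite (eq_bigr (fun=> (m + m)%N)) ?sum_nat_const ?card_ord; last first.
    move=> q _; rewrite (eq_bigr (fun k => m * (q == k) + 1)%N).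
      by rewrite big_split sum_nat_const card_ord -big_distrr /= delta !muln1.
    by move=> k _; rewrite big_split sum_nat_const card_ord delta.
  rewrite addnn -muln2 !natrM le_eqVlt; apply/orP; left; apply/eqP.
  by clearbody Mu; ring.
rewrite natr_sum big_distrl; apply: eq_bigr => q _.
rewrite natr_sum big_distrl; apply: eq_bigr => k _.
by rewrite natr_sum big_distrl.
Qed.

End superposition_gf.

(** * Factorial moments and generating functions of a layer *)

Section layer_kernel.
Variables (R : realFieldType) (n : nat).
Implicit Types (A : {set 'I_n}) (F : {set {set 'I_n}}) (i j : 'I_n) (g : lgraph n).

Lemma sum_lgraph (G : {set 'I_n} -> {set {set 'I_n}} -> R) :
  \sum_(g : lgraph n) G (lgraph_vertices g) (lgraph_edges g)
  = \sum_A \sum_(F : {set {set 'I_n}} | F \subset node_pairs A) G A F.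
Proof.
rewrite pair_big_dep /=.
rewrite (reindex_omap (fun g : lgraph n => lgraph_val g) insub); last first.
  by move=> [A F] /= AF; rewrite insubT.
by apply: eq_bigl => g; rewrite valK eqxx andbT; apply/esym/(valP g).
Qed.

(** The conditional expectation of [h] of the edge set, given the node set [A] and the strength
    [y]. *)
Definition links_mean A (y : R) (h : {set {set 'I_n}} -> R) : R :=
  \sum_(F : {set {set 'I_n}} | F \subset node_pairs A)
    (\prod_(e in node_pairs A) (if e \in F then y else 1 - y)) * h F.

Lemma links_mean1 A y : links_mean A y (fun=> 1) = 1.
Proof.
rewrite /links_mean; under eq_bigr do rewrite mulr1.
by rewrite sum_subset_prod big1 // => e _; rewrite addrC subrK.
Qed.

Lemma ldeg_out A F i : F \subset node_pairs A -> i \notin A -> ldeg F i = 0%N.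
Proof.
move=> FA iA; apply: eq_card0 => v; rewrite inE; apply/negbTE/negP.
by move=> /(fintype.subsetP FA); rewrite pair_in_node_pairs (negbTE iA).
Qed.

Lemma edge_out A F i j : F \subset node_pairs A -> ~~ ((i \in A) && (j \in A)) ->
  ([set i; j]%SET \in F) = false.
Proof.
move=> FA ijA; apply/negbTE/negP => /(fintype.subsetP FA).
by rewrite pair_in_node_pairs andbA (negbTE ijA).
Qed.

Lemma links_mean_gf A i (y s : R) :
  links_mean A y (fun F => s ^+ ldeg F i)
  = if i \in A then (1 - y + y * s) ^+ (#|A|).-1 else 1.
Proof.
case: ifPn => iA; first exact: ldeg_gf.
rewrite -(links_mean1 A y); apply: eq_bigr => F FA.
by rewrite (ldeg_out FA iA) expr0.
Qed.

Lemma links_mean_edge_gf A i j (y s t : R) : i != j ->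
  links_mean A y (fun F => ([set i; j]%SET \in F)%:R * (s ^+ ldeg F i * t ^+ ldeg F j))
  = ((i \in A) && (j \in A))%:R *
    (y * s * t * (1 - y + y * s) ^+ (#|A| - 2) * (1 - y + y * t) ^+ (#|A| - 2)).
Proof.
move=> ij; case: (boolP ((i \in A) && (j \in A))) => [/andP[iA jA]|ijA].
  by rewrite mul1r -(ldeg_edge_gf y s t iA jA ij); apply: eq_bigr => F _; rewrite !mulrA.
by rewrite mul0r /links_mean big1 // => F FA; rewrite (edge_out FA ijA) mul0r mulr0.
Qed.

(* Differentiating the generating functions at 1 gives the factorial moments. *)
Lemma links_mean_poly A y (h : {set {set 'I_n}} -> R) (d : {set {set 'I_n}} -> nat) r :
  links_mean A y (fun F => h F * (d F ^_ r)%:R) =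
  (\sum_(F : {set {set 'I_n}} | F \subset node_pairs A)
    (\prod_(e in node_pairs A) (if e \in F then y%:P else 1 - y%:P))
    * ((h F)%:P * 'X^(d F)))^`(r).[1].
Proof.
rewrite linear_sum horner_sum; apply: eq_bigr => F FA.
transitivity ((((\prod_(e in node_pairs A) (if e \in F then y else 1 - y)) * h F)%:P
    * 'X^(d F))^`(r).[1]).
  by rewrite mul_polyC derivnZ derivnXn hornerZ hornerMn hornerXn expr1n mulrA.
congr (_.[1]); congr (_^`(r)).
rewrite polyCM rmorph_prod mulrA; congr (_ * _ * _); apply: eq_bigr => e _.
by case: ifP => // _; rewrite -polyC1 -polyCB.
Qed.

Lemma derivn_affine_exp (y : R) N r : ((1 - y%:P + y%:P * 'X) ^+ N)^`(r)
  = ((N ^_ r)%:R * y ^+ r) *: (1 - y%:P + y%:P * 'X) ^+ (N - r).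
Proof.
elim: r => [|r IHr]; first by rewrite derivn0 ffactn0 expr0 mul1r scale1r subn0.
have D : (1 - y%:P + y%:P * 'X)^`() = y%:P :> {poly R}.
  by rewrite derivD derivM derivX -polyC1 -polyCB !derivC mul0r !add0r mulr1.
rewrite derivnS IHr derivZ deriv_exp D subnS ffactnSr exprSr natrM.
set q := _ ^+ _.-1; rewrite mul_polyC -[(_ *: q) *+ _]scaler_nat !scalerA.
by congr (_ *: _); ring.
Qed.

Lemma affine1 (y : R) : (1 - y%:P + y%:P * 'X).[1] = 1.
Proof. by rewrite !hornerE subrK. Qed.

(** This is [ldeg_edge_gf] over [{poly R}] with [s] the indeterminate and [t = 1]. *)
Lemma edge_poly A i j (y : R) : i \in A -> j \in A -> i != j ->
  \sum_(F : {set {set 'I_n}} | F \subset node_pairs A)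
    (\prod_(e in node_pairs A) (if e \in F then y%:P else 1 - y%:P))
    * ((([set i; j]%SET \in F)%:R)%:P * 'X^(ldeg F i))
  = y%:P * 'X * (1 - y%:P + y%:P * 'X) ^+ (#|A| - 2).
Proof.
move=> iA jA ij; have := ldeg_edge_gf y%:P 'X 1 iA jA ij.
rewrite !mulr1 subrK expr1n mulr1 => <-; apply: eq_bigr => F _.
by rewrite expr1n mulr1; case: (_ \in F).
Qed.

Lemma links_mean_ffact A i y r :
  links_mean A y (fun F => (ldeg F i ^_ r)%:R)
  = if i \in A then ((#|A|).-1 ^_ r)%:R * y ^+ r else (r == 0%N)%:R.
Proof.
case: ifPn => iA; last first.
  rewrite -[RHS]mulr1 -(links_mean1 A y) big_distrr; apply: eq_bigr => F FA /=.
  by rewrite (ldeg_out FA iA) mulr1 mulrC; case: r.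
transitivity (links_mean A y (fun F => 1 * (ldeg F i ^_ r)%:R)).
  by apply: eq_bigr => F _; rewrite mul1r.
rewrite links_mean_poly.
rewrite (eq_bigr (fun F : {set {set 'I_n}} =>
   (\prod_(e in node_pairs A) (if e \in F then y%:P else 1 - y%:P)) * 'X^(ldeg F i))).
  2: by move=> F _; rewrite mul1r.
rewrite ldeg_gf //; set N := (#|A|).-1.
by rewrite derivn_affine_exp hornerZ horner_exp affine1 expr1n mulr1.
Qed.

Lemma links_mean_edge_ffact2 A i j y : i != j ->
  links_mean A y (fun F => ([set i; j]%SET \in F)%:R * (ldeg F i ^_ 2)%:R)
  = ((i \in A) && (j \in A))%:R *
    (2 * ((#|A| - 2)%N%:R * y ^+ 2) + ((#|A| - 2) ^_ 2)%:R * y ^+ 3).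
Proof.
move=> ij; case: (boolP ((i \in A) && (j \in A))) => [/andP[iA jA]|ijA]; last first.
  by rewrite mul0r /links_mean big1 // => F FA; rewrite (edge_out FA ijA) mul0r mulr0.
rewrite links_mean_poly (edge_poly y iA jA ij); set N := (#|A| - 2)%N.
rewrite !derivnS derivn0 !(derivM, derivC, derivX, derivD).
have -> : ((1 - y%:P + y%:P * 'X) ^+ N)^`() = (N%:R * y) *: (1 - y%:P + y%:P * 'X) ^+ N.-1.
  by have := derivn_affine_exp y N 1; rewrite derivn1 ffactn1 expr1 subn1.
rewrite derivZ.
have -> : ((1 - y%:P + y%:P * 'X) ^+ N.-1)^`() = (N.-1%:R * y) *: (1 - y%:P + y%:P * 'X) ^+ N.-2.
  by have := derivn_affine_exp y N.-1 1; rewrite derivn1 ffactn1 expr1 subn1.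
rewrite !hornerE /= subrK !expr1n ffactnS ffactn1 natrM.
by ring.
Qed.

Lemma links_mean_edge_ffact1 A i j y : i != j ->
  links_mean A y (fun F => ([set i; j]%SET \in F)%:R * (ldeg F i)%:R)
  = ((i \in A) && (j \in A))%:R * (y + (#|A| - 2)%N%:R * y ^+ 2).
Proof.
move=> ij; case: (boolP ((i \in A) && (j \in A))) => [/andP[iA jA]|ijA]; last first.
  by rewrite mul0r /links_mean big1 // => F FA; rewrite (edge_out FA ijA) mul0r mulr0.
transitivity (links_mean A y (fun F => ([set i; j]%SET \in F)%:R * (ldeg F i ^_ 1)%:R)).
  by apply: eq_bigr => F _; rewrite ffactn1.
rewrite links_mean_poly (edge_poly y iA jA ij); set N := (#|A| - 2)%N.
rewrite derivn1 !(derivM, derivC, derivX, derivD).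
have -> : ((1 - y%:P + y%:P * 'X) ^+ N)^`() = (N%:R * y) *: (1 - y%:P + y%:P * 'X) ^+ N.-1.
  by have := derivn_affine_exp y N 1; rewrite derivn1 ffactn1 expr1 subn1.
rewrite !hornerE /= subrK !expr1n.
by ring.
Qed.

(** The conditional probability of the graph [g] given size and strength [z]. It is defined for
    every [z], and is 0 when [z.1 > n] since no node set has that size. *)
Definition layer_kernel g (z : nat * R) : R :=
  (if #|lgraph_vertices g| == z.1 then ('C(n, z.1)%:R)^-1 else 0)
  * \prod_(e in node_pairs (lgraph_vertices g))
      (if e \in lgraph_edges g then z.2 else 1 - z.2).

Definition kernel_mean (h : lgraph n -> R) (z : nat * R) : R :=
  \sum_g layer_kernel g z * h g.

Lemma kernel_meanE (h : {set 'I_n} -> {set {set 'I_n}} -> R) (z : nat * R) :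
  kernel_mean (fun g => h (lgraph_vertices g) (lgraph_edges g)) z
  = ('C(n, z.1)%:R)^-1 * \sum_(A : {set 'I_n} | #|A| == z.1) links_mean A z.2 (h A).
Proof.
rewrite /kernel_mean /layer_kernel.
rewrite (sum_lgraph (fun A F => (if #|A| == z.1 then ('C(n, z.1)%:R)^-1 else 0)
  * \prod_(e in node_pairs A) (if e \in F then z.2 else 1 - z.2) * h A F)).
rewrite big_distrr [RHS]big_mkcond /=; apply: eq_bigr => A _.
case: ifP => _; first by rewrite big_distrr; apply: eq_bigr => F _ /=; rewrite mulrA.
by rewrite big1 // => F _; rewrite !mul0r.
Qed.

Lemma sum_draws_out (B : {set 'I_n}) x :
  \sum_(A : {set 'I_n} | #|A| == x) (A \subset B)%:R = 'C(#|B|, x)%:R :> R.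
Proof.
rewrite -cards_draws -sum1_card natr_sum big_mkcond [RHS]big_mkcond /=.
by apply: eq_bigr => A _; rewrite inE andbC; case: (_ == x); case: (_ \subset _).
Qed.

Lemma subsetC2 A i j : (A \subset ~: [set i; j])%SET = (i \notin A) && (j \notin A).
Proof.
by rewrite finset.setCU finset.subsetI -!finset.disjoints_subset !(fintype.disjoint_sym A) !disjoints1.
Qed.

Lemma sum_draws x : \sum_(A : {set 'I_n} | #|A| == x) 1 = 'C(n, x)%:R :> R.
Proof.
rewrite -[n in RHS]card_ord -cardsT -sum_draws_out.
by apply: eq_bigr => A _; rewrite finset.subsetT.
Qed.

Lemma draws0 x : (x <= n)%N ->
  ('C(n, x)%:R)^-1 * \sum_(A : {set 'I_n} | #|A| == x) 1 = 1 :> R.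
Proof. by move=> xn; rewrite sum_draws mulVf // pnatr_eq0 -lt0n bin_gt0. Qed.

(** Counted through the complement: the sets avoiding [i] are the subsets of size [x] of the [n - 1]
    other nodes. For two nodes, inclusion and exclusion is used in the same way. *)
Lemma draws1 i x : (x <= n)%N ->
  ('C(n, x)%:R)^-1 * \sum_(A : {set 'I_n} | #|A| == x) (i \in A)%:R = x%:R / n%:R :> R.
Proof.
move=> xn; have n0 : (0 < n)%N by case: (n) i => [[]|].
have -> : \sum_(A : {set 'I_n} | #|A| == x) (i \in A)%:R
    = 'C(n, x)%:R - 'C(n.-1, x)%:R :> R.
  have <- : #|~: [set i]%SET| = n.-1 by rewrite cardsC1 card_ord.
  rewrite -sum_draws -sum_draws_out -sumrB; apply: eq_bigr => A _.
  rewrite -finset.disjoints_subset fintype.disjoint_sym disjoints1.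
  by case: (i \in A); rewrite ?subr0 ?subrr.
have C0 : ('C(n, x)%:R : R) != 0 by rewrite pnatr_eq0 -lt0n bin_gt0.
have n0' : (n%:R : R) != 0 by rewrite pnatr_eq0 -lt0n.
apply: (mulfI C0); rewrite mulrA divff // mul1r mulrA.
apply: (mulIf n0'); rewrite mulfVK // -natrB; last first.
  by case: (n) n0 => // N _; apply: leq_bin2l.
rewrite -!natrM; congr (_%:R).
case: (n) n0 => // N _; case: (x) => [|k]; first by rewrite !bin0 subnn mul0n muln0.
rewrite /= binS addKn; have := mul_bin_diag N.+1 k; rewrite /= binS => H.
by rewrite mulnC H mulnC.
Qed.

Lemma draws2 i j x : i != j -> (x <= n)%N ->
  ('C(n, x)%:R)^-1 * \sum_(A : {set 'I_n} | #|A| == x) ((i \in A) && (j \in A))%:R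
  = (x ^_ 2)%:R / (n ^_ 2)%:R :> R.
Proof.
move=> ij xn; have n2 : (1 < n)%N.
  case: (n) i j ij => [[]//|[i j|//]]; by rewrite !ord1 eqxx.
have -> : \sum_(A : {set 'I_n} | #|A| == x) ((i \in A) && (j \in A))%:R
    = 'C(n, x)%:R - 2 * 'C(n.-1, x)%:R + 'C(n.-2, x)%:R :> R.
  have <- : #|~: [set i; j]%SET| = n.-2 by rewrite cardsCs finset.setCK cards2 ij card_ord subn2.
  rewrite mulr_natl mulr2n.
  have H (k : 'I_n) : 'C(n.-1, x)%:R =
      \sum_(A : {set 'I_n} | #|A| == x) (k \notin A)%:R :> R.
    have <- : #|~: [set k]%SET| = n.-1 by rewrite cardsC1 card_ord.
    rewrite -sum_draws_out; apply: eq_bigr => A _.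
    by rewrite -finset.disjoints_subset fintype.disjoint_sym disjoints1.
  rewrite {1}(H i) (H j) -sum_draws -sum_draws_out -big_split -sumrB -big_split.
  apply: eq_bigr => A _ /=; rewrite subsetC2.
  by case: (i \in A); case: (j \in A) => /=; ring.
have C0 : ('C(n, x)%:R : R) != 0 by rewrite pnatr_eq0 -lt0n bin_gt0.
have n0' : ((n ^_ 2)%:R : R) != 0 by rewrite pnatr_eq0 -lt0n ffact_gt0.
apply: (mulfI C0); rewrite mulrA divff // mul1r mulrA.
apply: (mulIf n0'); rewrite mulfVK //.
case: (n) n2 => [//|[//|N _]] /=; case: (x) => [|[|k]].
- by rewrite !bin0 [in RHS]ffact_small //; ring.
- rewrite !bin1 /= [in RHS]ffact_small //; ring.
(* Pascal's rule, applied twice, collapses the alternating sum to the number of sets that contain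
   both nodes. *)
rewrite !binS !natrD.
rewrite (_ : _ + _ = 'C(N, k)%:R); last by ring.
rewrite -!natrD -!binS -!natrM; congr (_%:R).
have := mul_bin_diag N.+1 k; have := mul_bin_diag N.+2 k.+1.
rewrite /= !ffactnS ffactn0 !muln1 /=; set a := 'C(_, _).
set b := 'C(_, _); set c := 'C(_, _) => H1 H2.
nia.
Qed.

Section kernel_means.
Variable z : nat * R.
Hypothesis zn : (z.1 <= n)%N.

(** For statistics whose mean over the links depends on [A] only through the membership of the nodes
    concerned: links and node set are then averaged one after the other. *)
Let kernel_mean_const (h : {set 'I_n} -> {set {set 'I_n}} -> R)
    (I : {set 'I_n} -> R) (c : R) :
  (forall A, #|A| = z.1 -> links_mean A z.2 (h A) = I A * c) ->
  kernel_mean (fun g => h (lgraph_vertices g) (lgraph_edges g)) z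
  = ('C(n, z.1)%:R)^-1 * (\sum_(A : {set 'I_n} | #|A| == z.1) I A) * c.
Proof.
move=> hI; rewrite kernel_meanE -mulrA; congr (_ * _).
by rewrite big_distrl; apply: eq_bigr => A /eqP /hI.
Qed.

Lemma kernel_mean1 : kernel_mean (fun=> 1) z = 1.
Proof.
rewrite (@kernel_mean_const (fun _ _ => 1) (fun=> 1) 1); first by rewrite draws0 ?mulr1.
by move=> A _; rewrite links_mean1 mulr1.
Qed.

Lemma kernel_mean_edge_gf i j (s t : R) : i != j ->
  kernel_mean (fun g => (edge i j g)%:R * (s ^+ gdeg i g * t ^+ gdeg j g)) z
  = (z.1 ^_ 2)%:R * z.2 * (s * t * (1 - z.2 + z.2 * s) ^+ (z.1 - 2)
     * (1 - z.2 + z.2 * t) ^+ (z.1 - 2)) / (n ^_ 2)%:R.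
Proof.
move=> ij; rewrite (@kernel_mean_const
   (fun A F => ([set i; j]%SET \in F)%:R * (s ^+ ldeg F i * t ^+ ldeg F j))
   (fun A => ((i \in A) && (j \in A))%:R) (z.2 * s * t * (1 - z.2 + z.2 * s) ^+ (z.1 - 2)
     * (1 - z.2 + z.2 * t) ^+ (z.1 - 2))).
  by rewrite draws2 //; ring.
by move=> A Ax; rewrite links_mean_edge_gf // Ax.
Qed.

Lemma kernel_mean_gf i (s : R) :
  kernel_mean (fun g => s ^+ gdeg i g) z
  = 1 - z.1%:R * (1 - (1 - z.2 + z.2 * s) ^+ z.1.-1) / n%:R.
Proof.
set q := (1 - z.2 + z.2 * s) ^+ z.1.-1.
rewrite (kernel_meanE (fun A F => s ^+ ldeg F i)).
rewrite (eq_bigr (fun A => 1 + (i \in A)%:R * (q - 1))); last first.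
  move=> A /eqP Ax; rewrite links_mean_gf Ax; case: (i \in A) => /=.
    by rewrite mul1r [RHS]addrC subrK.
  by rewrite mul0r addr0.
rewrite big_split /= mulrDr draws0 // -big_distrl /= mulrA draws1 //.
by ring.
Qed.

Lemma kernel_mean_edge i j : i != j ->
  kernel_mean (fun g => (edge i j g)%:R) z = (z.1 ^_ 2)%:R * z.2 / (n ^_ 2)%:R.
Proof.
move=> ij; have := kernel_mean_edge_gf 1 1 ij; rewrite !mulr1 subrK !expr1n !mulr1 => <-.
by apply: eq_bigr => g _; rewrite !expr1n !mulr1.
Qed.

Lemma kernel_mean_edge_deg i j : i != j ->
  kernel_mean (fun g => (edge i j g)%:R * (gdeg i g)%:R) z
  = (z.1 ^_ 2)%:R * z.2 * (1 + (z.1 - 2)%N%:R * z.2) / (n ^_ 2)%:R.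
Proof.
move=> ij; rewrite (@kernel_mean_const
   (fun A F => ([set i; j]%SET \in F)%:R * (ldeg F i)%:R)
   (fun A => ((i \in A) && (j \in A))%:R) (z.2 + (z.1 - 2)%N%:R * z.2 ^+ 2)).
  by rewrite draws2 //; ring.
by move=> A Ax; rewrite links_mean_edge_ffact1 // Ax.
Qed.

(** The node lies in the layer with probability [x / n], and its degree is then binomial with
    [x - 1] trials; [x (x - 1)_r = (x)_(r+1)] is why the moments of order [r+1, r] enter. *)
Lemma kernel_mean_ffact i r : (0 < r)%N ->
  kernel_mean (fun g => (gdeg i g ^_ r)%:R) z = (z.1 ^_ r.+1)%:R * z.2 ^+ r / n%:R.
Proof.
move=> r0; rewrite (@kernel_mean_const (fun A F => (ldeg F i ^_ r)%:R)
   (fun A => (i \in A)%:R) ((z.1.-1 ^_ r)%:R * z.2 ^+ r)).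
  by rewrite draws1 // ffactnS natrM; ring.
move=> A Ax; rewrite links_mean_ffact Ax; case: (i \in A); rewrite ?mul1r //.
by rewrite mul0r; case: (r) r0.
Qed.

(** On the link the degree is [1 + B] with [B] binomial with [x - 2] trials, and
    [(1 + B)_2 = 2 B + (B)_2]. The factor [(x)_2 y] of the link turns this into the integrands of
    orders 32 and 43. The restriction to more than [K] nodes depends on the size only and factors
    out. *)
Lemma kernel_mean_edge_ffact2 i j K : i != j ->
  kernel_mean (fun g => (K < #|lgraph_vertices g|)%N%:R
     * ((edge i j g)%:R * (gdeg i g ^_ 2)%:R)) z
  = (K < z.1)%N%:R * (2 * ((z.1 ^_ 3)%:R * z.2 ^+ 2) + (z.1 ^_ 4)%:R * z.2 ^+ 3) / (n ^_ 2)%:R.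
Proof.
move=> ij; rewrite (@kernel_mean_const
   (fun A F => (K < #|A|)%N%:R * (([set i; j]%SET \in F)%:R * (ldeg F i ^_ 2)%:R))
   (fun A => ((i \in A) && (j \in A))%:R)
   ((K < z.1)%N%:R * (2 * ((z.1 - 2)%N%:R * z.2 ^+ 2) + ((z.1 - 2) ^_ 2)%:R * z.2 ^+ 3))).
  rewrite draws2 // (ffactnSr z.1 2) (_ : z.1 ^_ 4 = z.1 ^_ 2 * (z.1 - 2) ^_ 2)%N ?natrM.
    by ring.
  by rewrite !ffactnS !ffactn0 !subn2; lia.
move=> A Ax; rewrite -Ax mulrCA -links_mean_edge_ffact2 // /links_mean big_distrr.
by apply: eq_bigr => F _; rewrite [RHS]mulrCA.
Qed.

Lemma kernel_mean_le (f h : lgraph n -> R) : 0 <= z.2 <= 1 ->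
  (forall g, f g <= h g) -> kernel_mean f z <= kernel_mean h z.
Proof.
move=> /andP[y0 y1] fh; apply: ler_sum => g _; apply: ler_wpM2l => //.
apply: mulr_ge0; first by case: ifP => // _; rewrite invr_ge0.
by apply: prodr_ge0 => e _; case: ifP => // _; rewrite subr_ge0.
Qed.

(** The factor [1 - s ^+ gdeg i g] lies between 0 and 1 and vanishes unless [i] belongs to the
    layer, so the product is at most the indicator that both nodes do. *)
Lemma kernel_mean_both i j (s t : R) : i != j -> 0 <= z.2 <= 1 ->
  0 <= s <= 1 -> 0 <= t <= 1 ->
  0 <= kernel_mean (fun g => (1 - s ^+ gdeg i g) * (1 - t ^+ gdeg j g)) z
    <= (z.1 ^_ 2)%:R / (n ^_ 2)%:R.
Proof.
move=> ij y01 /andP[s0 s1] /andP[t0 t1].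
have s' g : 0 <= 1 - s ^+ gdeg i g <= (i \in lgraph_vertices g)%:R.
  case: (boolP (i \in _)) => iV; last first.
    by rewrite /gdeg (ldeg_out (valP g) iV) subrr lexx.
  by rewrite subr_ge0 exprn_ile1 //= gerBl exprn_ge0.
have t' g : 0 <= 1 - t ^+ gdeg j g <= (j \in lgraph_vertices g)%:R.
  case: (boolP (j \in _)) => jV; last first.
    by rewrite /gdeg (ldeg_out (valP g) jV) subrr lexx.
  by rewrite subr_ge0 exprn_ile1 //= gerBl exprn_ge0.
apply/andP; split.
  apply: (le_trans (y := kernel_mean (fun=> 0) z)).
    by rewrite /kernel_mean big1 // => g _; rewrite mulr0.
  apply: kernel_mean_le => // g; have /andP[a _] := s' g; have /andP[b _] := t' g.
  by rewrite mulr_ge0.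
rewrite -(draws2 ij zn) -[leRHS]mulr1.
rewrite -(@kernel_mean_const (fun A _ => ((i \in A) && (j \in A))%:R)); last first.
  move=> A _; rewrite -(links_mean1 A z.2) [RHS]big_distrr; apply: eq_bigr => F _ /=.
  by rewrite mulr1 mulrC.
apply: kernel_mean_le => // g; have /andP[a a'] := s' g; have /andP[b b'] := t' g.
by rewrite -mulnb natrM ler_pM.
Qed.

End kernel_means.

End layer_kernel.

(** * The law of the graph of one layer *)

Lemma ge0_integral_mrestr d (T : measurableType d) (R : realType)
    (mu : {measure set T -> \bar R}) (E D : set T) (mD : measurable D)
    (f : T -> \bar R) : measurable E -> measurable_fun E f ->
  (forall x, E x -> (0 <= f x)%E) ->
  (\int[mrestr mu mD]_(x in E) f x = \int[mu]_(x in E `&` D) f x)%E.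
Proof.
move=> mE mf f0.
have mED : measurable (E `&` D) by exact: measurableI.
have mED' : measurable (E `\` D) by exact: measurableD.
rewrite -[in LHS](setUIDK E D) ge0_integral_setU ?setUIDK //; last first.
  by rewrite disj_set2E; apply/eqP; rewrite setDE setIACA setICr setI0.
rewrite [X in (_ + X)%E]null_set_integral ?adde0 //.
- apply: eq_measure_integral => A mA AED.
  by rewrite /= /mrestr setIidl // => x /AED[].
- by apply: (measurable_funS mE) => // x [].
- by rewrite /= /mrestr setDE -setIA setICl setI0 measure0.
Qed.

Section size_strength_functions.
Variable R : realType.
Implicit Type f : nat * R -> R.

Lemma measurable_nat_section d (T : measurableType d) (f : nat * R -> T) :
  (forall x, measurable_fun setT (fun y => f (x, y))) -> measurable_fun setT f.
Proof.
move=> mf _ B mB; rewrite setTI.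
have -> : f @^-1` B = \bigcup_x (fst @^-1` [set x] `&` snd @^-1` ((fun y => f (x, y)) @^-1` B)).
  apply/seteqP; split => [[x y] /= fB|[x y] [x' _] /= [-> ]] //.
  by exists x.
apply: bigcupT_measurable => x; apply: measurableI.
  by rewrite -[X in measurable X]setTI; exact: measurable_fst.
rewrite -[X in measurable X]setTI; apply: measurable_snd => //.
by rewrite -[X in measurable X]setTI; exact: mf.
Qed.

Lemma measurable_layer_space : measurable (@layer_space R).
Proof.
rewrite (_ : @layer_space R = snd @^-1` `[0, 1]%classic); last first.
  by apply/seteqP; split => [[x y]|[x y]] /=; rewrite /layer_space /= in_itv.
by rewrite -[X in measurable X]setTI; exact: measurable_snd.
Qed.

(* Sizes being discrete, continuity on [nat * R] is continuity in the strength. *)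
Definition strength_continuous f := forall x, continuous (fun y => f (x, y)).

Lemma strength_continuous_measurable f (D : set (nat * R)) :
  strength_continuous f -> measurable_fun D f.
Proof.
move=> cf; apply: measurable_funTS.
by apply: measurable_nat_section => x; apply: continuous_measurable_fun; exact: cf.
Qed.

Lemma strength_continuous_prod_topology f : strength_continuous f -> continuous f.
Proof.
move=> cf [x y]; have H : f (x, z.2) @[z --> (x, y)] --> f (x, y).
  by apply: (cvg_comp snd (fun y => f (x, y))); [exact: cvg_snd|exact: cf].
apply: cvg_trans H; apply: near_eq_cvg.
exists ([set x], setT) => /=.
  by split; [exact: discrete_set1|exact: filterT].
by move=> [x' y'] /= [-> _].
Qed.

End size_strength_functions.

Lemma continuous_prodr (R : realType) (I : Type) (r : seq I) (P : pred I) (f : I -> R -> R) :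
  (forall i, continuous (f i)) -> continuous (fun y => \prod_(i <- r | P i) f i y).
Proof.
move=> cf; elim: r => [|i r IHr] y.
  by under eq_fun do rewrite big_nil; exact: cvg_cst.
under eq_fun do rewrite big_cons.
case: (P i) => /=; last exact: IHr.
exact: (cvgM (cf i y) (IHr y)).
Qed.

Lemma probability_setI1 d (T : measurableType d) (R : realType)
    (P : probability T R) (A B : set T) :
  measurable A -> measurable B -> P B = 1%E -> P A = P (A `&` B).
Proof.
move=> mA mB PB; rewrite (measureDI P mA mB).
rewrite [X in (X + _)%E](_ : _ = 0%E) ?add0e //.
apply: (@subset_measure0 _ _ _ P _ (~` B)) => //; first exact: measurableD.
- exact: measurableC.
- by have := probability_setC P mB; rewrite PB subee.
Qed.

Section layer_law.
Variables (R : realType) (n : nat) (d : measure_display) (Omega : measurableType d).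
Variables (Pr : probability Omega R) (Pn : probability (nat * R)%type R).
Local Notation S0 := (@layer_space R).

Lemma layer_kernel_continuous (g : lgraph n) :
  strength_continuous (layer_kernel g : nat * R -> R).
Proof.
move=> x; rewrite /layer_kernel /= => y.
apply: cvgM; first exact: cvg_cst.
by apply: continuous_prodr => e {}y; case: (e \in _); [exact: cvg_id|
  apply: cvgB; [exact: cvg_cst|exact: cvg_id]].
Qed.

Lemma layer_kernel_le1 (g : lgraph n) (z : nat * R) : S0 z -> layer_kernel g z <= 1.
Proof.
move=> /andP[y0 y1]; apply: mulr_ile1.
- by case: ifP => // _; rewrite invr_ge0.
- by apply: prodr_ge0 => e _; case: ifP => // _; rewrite subr_ge0.
- case: ifP => // _; have [->|C0] := posnP 'C(n, z.1); first by rewrite invr0.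
  by rewrite invf_le1 ?ler1n ?ltr0n.
- apply: prodr_ile1 => e _; case: ifP => _; first by rewrite y0.
  by rewrite subr_ge0 y1 gerBl.
Qed.

Lemma layer_kernel_ge0 (g : lgraph n) (z : nat * R) : S0 z -> 0 <= layer_kernel g z.
Proof.
move=> /andP[y0 y1]; apply: mulr_ge0; first by case: ifP => // _; rewrite invr_ge0.
by apply: prodr_ge0 => e _; case: ifP => // _; rewrite subr_ge0.
Qed.

Variable Z : {RV Pr >-> (lgraph n * (nat * R))%type}.
Hypothesis PnS : Pn S0 = 1%E.
Hypothesis Zlaw : random_layer Pr Pn Z.

Let mZ2 : measurable_fun setT (fun w => (Z w).2).
Proof. by apply: (measurableT_comp measurable_snd); exact: measurable_funPT. Qed.

Let measurable_graph_event (Q : set (lgraph n)) : measurable [set w | Q (Z w).1].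
Proof.
apply: (measurable_funPTI Z (Y := fst @^-1` Q)).
by rewrite -[X in measurable X]setTI; exact: measurable_fst.
Qed.

(** By the law of the node set, on the event that it equals [A] the pair (X, Y) is distributed as
    [Pn] restricted to the size [#|A|], divided by ['C(n, #|A|)]. Integrating the link probabilities
    against this measure yields the kernel. *)
Lemma layer_law (g : lgraph n) :
  Pr [set w | (Z w).1 = g] = (\int[Pn]_(z in S0) (layer_kernel g z)%:E)%E.
Proof.
have mS := @measurable_layer_space R.
set A := lgraph_vertices g; set F := lgraph_edges g.
have FA : F \subset node_pairs A by exact: (valP g).
pose h (z : nat * R) : \bar R := (\prod_(e in node_pairs A) (if e \in F then z.2 else 1 - z.2))%:E.
have mh D : measurable_fun D h.
  apply/measurable_EFinP; apply: strength_continuous_measurable => x.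
  apply: continuous_prodr => e y; case: (e \in _); first exact: cvg_id.
  by apply: cvgB; [exact: cvg_cst|exact: cvg_id].
have h0 z : S0 z -> (0 <= h z)%E.
  move=> /andP[y0 y1]; rewrite lee_fin; apply: prodr_ge0 => e _.
  by case: ifP => // _; rewrite subr_ge0.
have mVA := measurable_graph_event [set g' | lgraph_vertices g' = A].
pose X : set (nat * R) := [set z | z.1 = #|A|].
have mX : measurable X.
  rewrite (_ : X = fst @^-1` [set #|A|]) //.
  by rewrite -[Y in measurable Y]setTI; exact: measurable_fst.
transitivity (Pr [set w | [/\ S0 (Z w).2, lgraph_vertices (Z w).1 = A
                  & lgraph_edges (Z w).1 = F]]).
  have mSZ : measurable [set w | S0 (Z w).2].
    by rewrite -[Y in measurable Y]setTI; exact: mZ2.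
  rewrite (probability_setI1 (measurable_graph_event [set g]) mSZ); last first.
    by rewrite (size_strength_law Zlaw mS).
  congr (Pr _); apply/seteqP; split => w /= [].
    by move=> -> Sw; split.
  by move=> Sw VA EF; split => //; apply: val_inj; apply: injective_projections.
rewrite (links_given_nodes_size_strength Zlaw FA mS).
rewrite (_ : [set w | _ /\ _] = (fun w => (Z w).2) @^-1` S0 `&`
  [set w | lgraph_vertices (Z w).1 = A]) //.
rewrite -(@ge0_integral_mrestr _ _ _ Pr _ _ mVA (h \o (fun w => (Z w).2))); last 3 first.
- by rewrite -[Y in measurable Y]setTI; exact: mZ2.
- by apply: measurable_funTS; apply: measurableT_comp.
- by move=> w; exact: h0.
rewrite -ge0_integral_pushforward //; last by move=> z; rewrite inE => /h0.
have c0 : 0 <= ('C(n, #|A|)%:R : R)^-1 by rewrite invr_ge0.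
rewrite (eq_measure_integral (mscale (NngNum c0) (mrestr Pn mX))); last first.
  move=> B mB _; rewrite /pushforward /mscale /= /mrestr.
  transitivity (Pr [set w | B (Z w).2 /\ lgraph_vertices (Z w).1 = A]) => //.
  rewrite (nodes_given_size_strength Zlaw A mB).
  pose k : nat * R -> \bar R := (cst (('C(n, #|A|)%:R)^-1)%:E) \_ X.
  have mk D : measurable_fun D k.
    apply: measurable_funTS; apply: (measurable_restrictT (cst _) mX).1; exact: measurable_cst.
  transitivity (\int[pushforward Pr (fun w => (Z w).2)]_(z in B) k z)%E.
    rewrite ge0_integral_pushforward //.
      apply: eq_integral => w _ /=; rewrite /k patchE.
      by case: eqP => e; [rewrite mem_set // -e|rewrite memNset // => /esym].
    by move=> z _; rewrite /k patchE; case: ifP => // _; rewrite lee_fin.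
  rewrite (eq_measure_integral Pn); last first.
    by move=> C mC _; exact: (size_strength_law Zlaw mC).
  by rewrite /k -integral_mkcondr integral_cst //; exact: measurableI.
rewrite ge0_integral_mscale // ge0_integral_mrestr //.
rewrite -ge0_integralZl //; last 2 first.
- exact: measurableI.
- by move=> z [/h0].
rewrite integral_mkcondr; apply: eq_integral => z _; rewrite patchE.
rewrite /layer_kernel -/A -/F EFinM.
case: eqP => [e|e]; first by rewrite mem_set //= -e.
by rewrite memNset ?mul0e // => /esym.
Qed.

End layer_law.

Lemma EFin_Rintegral d (T : measurableType d) (R : realType)
    (m : {measure set T -> \bar R}) (D : set T) (f : T -> R) :
  measurable D -> m.-integrable D (EFin \o f) ->
  (\int[m]_(x in D) f x)%:E = (\int[m]_(x in D) (f x)%:E)%E.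
Proof. by move=> mD i_f; rewrite /Rintegral fineK // integrable_fin_num. Qed.

(** * Uniform tails *)

Section uniform_integrability.
Variables (R : realType) (d : measure_display) (T : measurableType d).
Variables (mun : nat -> {measure set T -> \bar R}) (mu : {measure set T -> \bar R}).
Variables (D : set T) (B : nat -> set T) (psi : T -> R).
Hypotheses (mD : measurable D) (mB : forall K, measurable (B K)).
Hypothesis ndB : {homo B : K L / (K <= L)%N >-> K `<=` L}.
Hypothesis DB : D `<=` \bigcup_K B K.
Hypotheses (mpsi : measurable_fun D psi) (psi0 : forall x, D x -> 0 <= psi x).
Hypothesis ipsin : forall n K, (mun n).-integrable (D `&` B K) (EFin \o psi).
Hypothesis ipsi : forall K, mu.-integrable (D `&` B K) (EFin \o psi).
Hypothesis locpsi : forall K,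
  \int[mun n]_(x in D `&` B K) psi x @[n --> \oo] --> \int[mu]_(x in D `&` B K) psi x.

(** Uniform integrability along a sequence of measures, asymptotic in [n], with an exhaustion of the
    space in place of level sets of [psi]. It is used with sizes at most [K] for layers and with
    boxes for degree pairs. *)
Definition uniform_tails : Prop := forall eps : R, 0 < eps ->
  exists K, \forall n \near \oo,
    (\int[mun n]_(x in D `\` B K) (psi x)%:E <= eps%:E)%E.

Let mDB K : measurable (D `&` B K). Proof. exact: measurableI. Qed.
Let mDB' K : measurable (D `\` B K). Proof. exact: measurableD. Qed.

Let mpsiE A : A `<=` D -> measurable_fun A (EFin \o psi).
Proof. by move=> AD; apply/measurable_EFinP; exact: measurable_funS AD mpsi. Qed.

Let split_ball (m : {measure set T -> \bar R}) K (f : T -> R) :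
  m.-integrable D (EFin \o f) ->
  \int[m]_(x in D) f x = \int[m]_(x in D `&` B K) f x + \int[m]_(x in D `\` B K) f x.
Proof.
move=> i_f; rewrite -Rintegral_setU; [|exact: mDB|exact: mDB'| |].
- by rewrite setUIDK.
- by rewrite setUIDK.
- by rewrite disj_set2E; apply/eqP; rewrite setDE setIACA setICr setI0.
Qed.

(** An argument of Fatou type: the bound passes to the limit on each shell between [B K] and
    [B (K + L)], where integrals converge, and then monotone convergence lets [L] grow. *)
Lemma uniform_tails_limit eps K :
  (\forall n \near \oo, (\int[mun n]_(x in D `\` B K) (psi x)%:E <= eps%:E)%E) ->
  (\int[mu]_(x in D `\` B K) (psi x)%:E <= eps%:E)%E.
Proof.
move=> tail; pose F L := (D `&` B (K + L)) `\` B K.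
have FE : D `\` B K = \bigcup_L F L.
  apply/seteqP; split => [x [Dx Kx]|x [L _ [[Dx _] Kx]]] //.
  have [L _ BL] := DB Dx; exists L => //; split => //; split => //.
  by apply: ndB BL; rewrite leq_addl.
have mF L : measurable (F L) by apply: measurableD => //; exact: mDB.
have FD L : F L `<=` D by move=> x [[]].
have cF : (\int[mu]_(x in F L) (psi x)%:E)%E @[L --> \oo] -->
    (\int[mu]_(x in D `\` B K) (psi x)%:E)%E.
  rewrite FE; apply: ge0_nondecreasing_set_cvg_integral => //.
  - move=> L L' LL'; apply/subsetPset => x [[Dx BL] Kx]; split => //; split => //.
    by apply: ndB BL; rewrite leq_add2l.
  - by move=> L; exact: mpsiE.
  - by move=> L x /FD Dx; rewrite lee_fin psi0.
apply: (cvge_to_le cF); apply: nearW => L.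
have FE' (m : {measure set T -> \bar R}) :
    (forall K, m.-integrable (D `&` B K) (EFin \o psi)) ->
    \int[m]_(x in F L) psi x
    = \int[m]_(x in D `&` B (K + L)) psi x - \int[m]_(x in D `&` B K) psi x.
  move=> im; apply/esym/eqP; rewrite subr_eq addrC -Rintegral_setU //.
  - apply/eqP; congr (Rintegral _ _ _); apply/seteqP; split => x.
      move=> [Dx BL]; have [Bx|Bx] := pselect (B K x); [left|right] => //.
    by move=> [[Dx Bx]|[[Dx Bx] _]]; split => //; apply: ndB Bx; rewrite leq_addr.
  - apply: (integrableS (mDB (K + L))) => //; first by apply: measurableU.
    by move=> x [[Dx Bx]|[[Dx Bx] _]]; split => //; apply: ndB Bx; rewrite leq_addr.
  - rewrite disj_set2E; apply/eqP/seteqP; split => // x [[_ Bx] [_]].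
    by [].
have iF : mu.-integrable (F L) (EFin \o psi).
  by apply: (integrableS (mDB (K + L))) => // x [].
rewrite -(EFin_Rintegral (mF L) iF) lee_fin (FE' mu ipsi).
have cL : \int[mun n]_(x in D `&` B (K + L)) psi x - \int[mun n]_(x in D `&` B K) psi x
   @[n --> \oo] --> \int[mu]_(x in D `&` B (K + L)) psi x - \int[mu]_(x in D `&` B K) psi x.
  by apply: cvgB.
apply: (cvgr_to_le cL); near=> n.
rewrite -(FE' (mun n) (ipsin n)) -lee_fin EFin_Rintegral //; last first.
  by apply: (integrableS (mDB (K + L))) => // x [].
apply: (@le_trans _ _ (\int[mun n]_(x in D `\` B K) (psi x)%:E)%E).
  apply: ge0_subset_integral => //; first exact: mpsiE.
    by move=> x [Dx _]; rewrite lee_fin psi0.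
  by move=> x [[]].
by near: n.
Unshelve. all: by end_near. Qed.

Let ipsin_tail n K eps :
  (\int[mun n]_(x in D `\` B K) (psi x)%:E <= eps%:E)%E ->
  (mun n).-integrable D (EFin \o psi).
Proof.
move=> tail; apply/integrableP; split; first exact: mpsiE.
rewrite -(setUIDK D (B K)) ge0_integral_setU //; last 2 first.
- by rewrite setUIDK; apply: measurableT_comp => //; exact: mpsiE.
- by rewrite disj_set2E; apply/eqP; rewrite setDE setIACA setICr setI0.
apply: lte_add_pinfty; first by have /integrableP[] := ipsin n K.
apply: le_lt_trans (ltry eps); apply: le_trans tail.
rewrite le_eqVlt; apply/orP; left; apply/eqP; apply: eq_integral => x.
by rewrite inE => -[Dx _]; rewrite gee0_abs // lee_fin psi0.
Qed.

Lemma uniform_tails_integrable : uniform_tails -> mu.-integrable D (EFin \o psi).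
Proof.
move=> /(_ 1 ltr01)[K /uniform_tails_limit tail].
apply/integrableP; split; first exact: mpsiE.
rewrite -(setUIDK D (B K)) ge0_integral_setU //; last 2 first.
- by rewrite setUIDK; apply: measurableT_comp => //; exact: mpsiE.
- by rewrite disj_set2E; apply/eqP; rewrite setDE setIACA setICr setI0.
apply: lte_add_pinfty; first by have /integrableP[] := ipsi K.
apply: le_lt_trans (ltry 1); apply: le_trans tail.
rewrite le_eqVlt; apply/orP; left; apply/eqP; apply: eq_integral => x.
by rewrite inE => -[Dx _]; rewrite gee0_abs // lee_fin psi0.
Qed.

Lemma uniform_tails_near_integrable : uniform_tails ->
  \forall n \near \oo, (mun n).-integrable D (EFin \o psi).
Proof.
by move=> /(_ 1 ltr01)[K tail]; near=> n; apply: (@ipsin_tail n K 1); near: n.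
Unshelve. all: by end_near. Qed.

Lemma dominated_integrable (m : {measure set T -> \bar R}) (f : T -> R) :
  measurable_fun D f -> (forall x, D x -> `|f x| <= psi x) ->
  m.-integrable D (EFin \o psi) -> m.-integrable D (EFin \o f).
Proof.
move=> mf fpsi; apply: le_integrable => //; first exact/measurable_EFinP.
by move=> x Dx; rewrite lee_fin [leRHS]ger0_norm ?psi0 // fpsi.
Qed.

Let tail_bound (m : {measure set T -> \bar R}) K (f : T -> R) eps :
  measurable_fun D f -> (forall x, D x -> `|f x| <= psi x) ->
  m.-integrable D (EFin \o psi) ->
  (\int[m]_(x in D `\` B K) (psi x)%:E <= eps%:E)%E ->
  `|\int[m]_(x in D) f x - \int[m]_(x in D `&` B K) f x| <= eps.
Proof.
move=> mf fpsi im tail; have i_f := dominated_integrable mf fpsi im.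
rewrite (split_ball K i_f) addrAC subrr add0r -lee_fin.
have i_f' : m.-integrable (D `\` B K) (EFin \o f) by apply: (integrableS mD) => // x [].
have i_p' : m.-integrable (D `\` B K) (EFin \o psi) by apply: (integrableS mD) => // x [].
apply: le_trans tail; rewrite -(EFin_Rintegral (mDB' K) i_p') lee_fin.
apply: (le_trans (le_normr_Rintegral (mDB' K) i_f')).
apply: le_Rintegral => //; last by move=> x [Dx _]; exact: fpsi.
exact: (integrable_norm i_f').
Qed.

(** Cutting at [B K] costs [eps / 3] on either side, uniformly in large [n]. The integrand may vary
    with [n], as the error terms do. *)
Lemma uniform_tails_cvg (phin : nat -> T -> R) (phi : T -> R) :
  uniform_tails ->
  (forall n, measurable_fun D (phin n)) -> measurable_fun D phi ->
  (forall n x, D x -> `|phin n x| <= psi x) -> (forall x, D x -> `|phi x| <= psi x) ->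
  (forall K, \int[mun n]_(x in D `&` B K) phin n x @[n --> \oo]
     --> \int[mu]_(x in D `&` B K) phi x) ->
  \int[mun n]_(x in D) phin n x @[n --> \oo] --> \int[mu]_(x in D) phi x.
Proof.
move=> ut mphin mphi phinpsi phipsi loc.
have ip := uniform_tails_integrable ut; have ipn := uniform_tails_near_integrable ut.
apply/cvgrPdist_le => eps eps0; have e3 : 0 < eps / 3 by rewrite divr_gt0.
have [K tail] := ut _ e3; have tailmu := uniform_tails_limit tail.
have /cvgrPdist_le/(_ _ e3) cK := loc K.
near=> n.
have h1 := tail_bound mphi phipsi ip tailmu.
have h2 : `|\int[mun n]_(x in D) phin n x - \int[mun n]_(x in D `&` B K) phin n x| <= eps / 3.
  by apply: tail_bound => //; [exact: phinpsi|near: n|near: n].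
have h3 : `|\int[mu]_(x in D `&` B K) phi x - \int[mun n]_(x in D `&` B K) phin n x| <= eps / 3.
  by near: n.
move: h1 h2 h3; set a := Rintegral _ _ _; set b := Rintegral _ _ _.
set c := Rintegral _ _ _; set e := Rintegral _ _ _.
rewrite !ler_norml => /andP[? ?] /andP[? ?] /andP[? ?]; lra.
Unshelve. all: by end_near. Qed.

(** A tail is the total minus the local part. Both converge, and the tail of the limit is small by
    integrability, so no mass of [psi] escapes. *)
Lemma total_cvg_uniform_tails :
  (\forall n \near \oo, (mun n).-integrable D (EFin \o psi)) ->
  mu.-integrable D (EFin \o psi) ->
  \int[mun n]_(x in D) psi x @[n --> \oo] --> \int[mu]_(x in D) psi x ->
  uniform_tails.
Proof.
move=> ipn ip cpsi eps eps0.
have c1 : \int[mu]_(x in D `&` B K) psi x @[K --> \oo] --> \int[mu]_(x in D) psi x.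
  have : (\int[mu]_(x in D `&` B K) (psi x)%:E)%E @[K --> \oo] -->
      (\int[mu]_(x in D) (psi x)%:E)%E.
    rewrite [X in _ --> (\int[mu]_(x in X) _)%E](_ : D = \bigcup_K (D `&` B K)); last first.
      by rewrite -setI_bigcupr setIidl.
    apply: ge0_nondecreasing_set_cvg_integral.
    - by move=> K L KL; apply/subsetPset => x [Dx Bx]; split => //; exact: ndB Bx.
    - by move=> K.
    - by move=> K; apply: mpsiE => x [].
    - by move=> K x [Dx _]; rewrite lee_fin psi0.
  by rewrite -(EFin_Rintegral mD ip) => /fine_cvgP[].
have /cvgrPdist_lt/(_ _ eps0)[K _ /(_ K (leqnn K)) /= cK] := c1.
exists K.
have c2 : \int[mun n]_(x in D) psi x - \int[mun n]_(x in D `&` B K) psi x @[n --> \oo]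
  --> \int[mu]_(x in D) psi x - \int[mu]_(x in D `&` B K) psi x by apply: cvgB.
have lt_eps : \int[mu]_(x in D) psi x - \int[mu]_(x in D `&` B K) psi x < eps.
  exact: le_lt_trans (ler_norm _) cK.
near=> n.
have i_n : (mun n).-integrable D (EFin \o psi) by near: n.
have i_n' : (mun n).-integrable (D `\` B K) (EFin \o psi).
  by apply: (integrableS mD) => // x [].
rewrite -(EFin_Rintegral (mDB' K) i_n') lee_fin.
have : \int[mun n]_(x in D) psi x - \int[mun n]_(x in D `&` B K) psi x <= eps.
  by near: n; exact: (cvgr_le _ c2 _ lt_eps).
by rewrite (split_ball K i_n) addrAC subrr add0r.
Unshelve. all: by end_near. Qed.

End uniform_integrability.

Lemma Rintegral_cst0 d (T : measurableType d) (R : realType)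
    (m : {measure set T -> \bar R}) (D : set T) : \int[m]_(x in D) 0 = 0 :> R.
Proof. by rewrite /Rintegral integral0. Qed.

(** * Convergence of integrals against the layer laws *)

Section layer_convergence.
Variables (R : realType) (Pn : nat -> probability (nat * R)%type R).
Variable P : probability (nat * R)%type R.
Hypothesis wPn : weak_cvg_layer (fun n => Pn n) P.
Local Notation S0 := (@layer_space R).
Implicit Types (f phi psi : nat * R -> R).

Definition size_le (K : nat) : set (nat * R) := [set z | (z.1 <= K)%N].

Definition size_bounded f := forall K, exists M, forall z, S0 z -> (z.1 <= K)%N -> `|f z| <= M.

Let mS := @measurable_layer_space R.

Lemma measurable_size_le K : measurable (size_le K).
Proof.
rewrite (_ : size_le K = fst @^-1` [set x | (x <= K)%N]) //.
by rewrite -[X in measurable X]setTI; exact: measurable_fst.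
Qed.

Let mSK K : measurable (S0 `&` size_le K).
Proof. by apply: measurableI => //; exact: measurable_size_le. Qed.

Lemma size_bounded_integrable (Q : probability (nat * R)%type R) f K :
  strength_continuous f -> size_bounded f -> Q.-integrable (S0 `&` size_le K) (EFin \o f).
Proof.
move=> cf /(_ K)[M bM]; apply: measurable_bounded_integrable => //.
- exact: (le_lt_trans (probability_le1 Q (mSK K)) (ltry _)).
- exact: strength_continuous_measurable.
- exists M; split; first exact: num_real.
  by move=> M' /ltW MM' z [Sz zK] /=; rewrite (le_trans _ MM') // bM.
Qed.

(** Sizes being discrete, cutting at [K] preserves continuity and makes the function bounded, so
    that weak convergence applies. *)
Lemma layer_local_cvg f K : strength_continuous f -> size_bounded f ->
  \int[Pn n]_(z in S0 `&` size_le K) f z @[n --> \oo]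
  --> \int[P]_(z in S0 `&` size_le K) f z.
Proof.
move=> cf bf; pose g z := f z * (z.1 <= K)%N%:R.
have gE (Q : probability (nat * R)%type R) :
    (\int[Q]_(z in S0) (g z)%:E = (\int[Q]_(z in S0 `&` size_le K) f z)%:E)%E.
  rewrite (EFin_Rintegral (mSK K)); last exact: size_bounded_integrable.
  rewrite integral_mkcondr; apply: eq_integral => z _; rewrite patchE /g.
  case: ifPn => [|zK]; first by rewrite inE => /= ->; rewrite mulr1.
  suff -> : (z.1 <= K)%N = false by rewrite mulr0.
  by apply/negbTE; apply: contra zK => zK; rewrite inE.
have cg : {within S0, continuous g}.
  apply: continuous_subspaceT; apply: strength_continuous_prod_topology => x /= y.
  by apply: cvgM; [exact: cf|exact: cvg_cst].
have bg : exists M, forall z, S0 z -> `|g z| <= M.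
  have [M bM] := bf K; exists (Num.max M 0) => z Sz; rewrite /g normrM normr_nat.
  case: (leqP z.1 K) => zK; last by rewrite mulr0 le_max lexx orbT.
  by rewrite mulr1 le_max bM.
have := wPn (conj cg bg).
by rewrite /= gE; under eq_fun do rewrite gE; move=> /fine_cvgP[_].
Qed.

Let ndB : {homo size_le : K L / (K <= L)%N >-> K `<=` L}.
Proof. by move=> K L KL z /= zK; exact: leq_trans KL. Qed.

Let DB : S0 `<=` \bigcup_K size_le K.
Proof. by move=> z _; exists z.1 => //; exact: leqnn. Qed.

Section dominated.
Variable psi : nat * R -> R.
Hypotheses (cpsi : strength_continuous psi) (bpsi : size_bounded psi).
Hypothesis psi0 : forall z, S0 z -> 0 <= psi z.

Let mpsi : measurable_fun S0 psi.
Proof. exact: strength_continuous_measurable. Qed.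

Hypothesis total : (\int[Pn n]_(z in S0) (psi z)%:E)%E @[n --> \oo]
  --> (\int[P]_(z in S0) (psi z)%:E)%E.
Hypothesis finite : (\int[P]_(z in S0) (psi z)%:E < +oo)%E.

Let ge0_integrable (Q : probability (nat * R)%type R) :
  (\int[Q]_(z in S0) (psi z)%:E < +oo)%E -> Q.-integrable S0 (EFin \o psi).
Proof.
move=> fin; apply/integrableP; split; first exact/measurable_EFinP.
apply: le_lt_trans fin; rewrite le_eqVlt; apply/orP; left; apply/eqP.
by apply: eq_integral => z; rewrite inE => Sz; rewrite gee0_abs // lee_fin psi0.
Qed.

Lemma layer_limit_integrable : P.-integrable S0 (EFin \o psi).
Proof. exact: ge0_integrable. Qed.

Let total_fine : (\forall n \near \oo, (\int[Pn n]_(z in S0) (psi z)%:E)%E \is a fin_num) /\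
  (\int[Pn n]_(z in S0) psi z @[n --> \oo] --> \int[P]_(z in S0) psi z).
Proof. by apply/fine_cvgP; rewrite EFin_Rintegral //; exact: layer_limit_integrable. Qed.

Lemma layer_near_integrable : \forall n \near \oo, (Pn n).-integrable S0 (EFin \o psi).
Proof.
case: total_fine => fin _; near=> n; apply: ge0_integrable.
by rewrite ltey_eq; apply/orP; left; near: n.
Unshelve. all: by end_near. Qed.

Lemma layer_uniform_tails : uniform_tails (fun n => Pn n) S0 size_le psi.
Proof.
apply: (total_cvg_uniform_tails (mu := P)) => //.
- exact: measurable_size_le.
- by move=> K; exact: layer_local_cvg.
- exact: layer_near_integrable.
- exact: layer_limit_integrable.
- exact: total_fine.2.
Qed.

Lemma layer_dominated_cvg (phin : nat -> nat * R -> R) phi :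
  (forall n, measurable_fun S0 (phin n)) -> measurable_fun S0 phi ->
  (forall n z, S0 z -> `|phin n z| <= psi z) -> (forall z, S0 z -> `|phi z| <= psi z) ->
  (forall K, \int[Pn n]_(z in S0 `&` size_le K) phin n z @[n --> \oo]
     --> \int[P]_(z in S0 `&` size_le K) phi z) ->
  \int[Pn n]_(z in S0) phin n z @[n --> \oo] --> \int[P]_(z in S0) phi z.
Proof.
apply: uniform_tails_cvg => //.
- exact: measurable_size_le.
- by move=> n K; exact: size_bounded_integrable.
- by move=> K; exact: size_bounded_integrable.
- by move=> K; exact: layer_local_cvg.
- exact: layer_uniform_tails.
Qed.

Lemma layer_cvg phi : strength_continuous phi -> (forall z, S0 z -> `|phi z| <= psi z) ->
  \int[Pn n]_(z in S0) phi z @[n --> \oo] --> \int[P]_(z in S0) phi z.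
Proof.
move=> cphi phipsi; apply: layer_dominated_cvg => //.
- by move=> n; exact: strength_continuous_measurable.
- exact: strength_continuous_measurable.
- move=> K; apply: layer_local_cvg => // K'; have [M bM] := bpsi K'.
  by exists M => z Sz zK; rewrite (le_trans (phipsi _ Sz)) // (le_trans (ler_norm _)) // bM.
Qed.

(** For error terms whose rate [c] may have no moment: the rate settles bounded sizes, domination by
    [psi] settles the large ones. *)
Lemma layer_cvg0 (phin : nat -> nat * R -> R) (c : nat -> R) :
  (forall n, strength_continuous (phin n)) ->
  (forall n z, S0 z -> `|phin n z| <= psi z) ->
  (forall n z, S0 z -> `|phin n z| <= c z.1 / n.+1%:R) ->
  \int[Pn n]_(z in S0) phin n z @[n --> \oo] --> 0.
Proof.
move=> cphin phinpsi phinc.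
have mphin n D : measurable_fun D (phin n) by exact: strength_continuous_measurable.
rewrite -(Rintegral_cst0 P S0); apply: layer_dominated_cvg => //.
  by move=> z Sz; rewrite normr0 psi0.
move=> K; rewrite Rintegral_cst0.
pose C := \sum_(x < K.+1) `|c x|.
have Cc z : (z.1 <= K)%N -> c z.1 <= C.
  move=> zK; rewrite (le_trans (ler_norm _)) // /C.
  by rewrite (bigD1 (Ordinal (zK : (z.1 < K.+1)%N))) //= lerDl sumr_ge0.
have cvgC : C / n.+1%:R @[n --> \oo] --> 0.
  rewrite -(mulr0 C); apply: cvgM; first exact: cvg_cst.
  exact: cvg_harmonic.
apply/cvgr0Pnorm_le => eps eps0; near=> n.
have Ce : C / n.+1%:R <= eps.
  by near: n; apply: (cvgr_le _ cvgC).
apply: le_trans Ce.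
have i_n : (Pn n).-integrable (S0 `&` size_le K) (EFin \o phin n).
  apply: (@dominated_integrable _ _ _ _ psi) => //.
  - by move=> z [Sz _]; exact: psi0.
  - by move=> z [Sz _]; exact: phinpsi.
  - exact: size_bounded_integrable.
apply: (le_trans (le_normr_Rintegral (mSK K) i_n)).
apply: (le_trans (y := \int[Pn n]_(z in S0 `&` size_le K) (C / n.+1%:R))).
  apply: le_Rintegral => //.
  - exact: (integrable_norm i_n).
  - exact/finite_measure_integrable_cst.
  - move=> z [Sz zK]; apply: (le_trans (phinc _ _ Sz)).
    by rewrite ler_wpM2r ?invr_ge0 // Cc.
rewrite Rintegral_cst // ler_piMr //.
  by rewrite divr_ge0 // sumr_ge0.
rewrite -lee_fin fineK ?fin_num_measure //; exact: probability_le1.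
Unshelve. all: by end_near. Qed.

End dominated.

End layer_convergence.

(** * Weak convergence from generating functions *)

(* Point masses are uniform limits of linear combinations of the sequences
   [s ^+ x]: divide by [s ^+ a] after removing the atoms below [a], and let [s]
   tend to 0. *)
Lemma delta_of_geometric (R : realType) (W : (nat -> R) -> Prop) :
  (forall u v c, W u -> W v -> W (fun x => u x + c * v x)) ->
  (forall u, (forall eps : R, 0 < eps -> exists2 v, W v & forall x, `|u x - v x| <= eps) -> W u) ->
  (forall s, 0 < s < 1 -> W (fun x => s ^+ x)) ->
  forall a, W (fun x => (x == a)%:R).
Proof.
move=> Wlin Wunif Wgeo a; have [m] := ubnP a; elim: m a => // m IHm a am.
apply: Wunif => eps eps0; pose s := Num.min eps (1 / 2).
have s01 : 0 < s < 1.
  by rewrite lt_min eps0 divr_gt0 //= gt_min ltr_pdivrMr // mul1r ltr1n orbT.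
have s0 : s != 0 by case/andP: s01 => /lt0r_neq0.
pose w k x : R := s ^+ x - \sum_(b < k) s ^+ b * (x == b :> nat)%:R.
have Ww k : (k <= a)%N -> W (w k).
  elim: k => [|k IHk] ka.
    have -> : w 0%N = fun x => s ^+ x by apply/funext => x; rewrite /w big_ord0 subr0.
    exact: Wgeo.
  have -> : w k.+1 = fun x => w k x + (- s ^+ k) * (x == k)%:R.
    by apply/funext => x; rewrite /w big_ord_recr /= opprD addrA mulNr.
  by apply: Wlin; [exact: IHk (ltnW ka)|exact: IHm (leq_trans ka am)].
(* A multiple of [w a] in the form [u + c * v] under which [W] is closed; [u] is the null
   function. *)
exists (fun x => 0 * w a x + (s ^- a) * w a x).
  apply: (Wlin); last exact: Ww.
  have -> : (fun x => 0 * w a x) = fun x => w a x + (-1) * w a x.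
    by apply/funext => x; rewrite mul0r mulN1r subrr.
  by apply: Wlin; exact: Ww.
move=> x; rewrite mul0r add0r /w.
have [xa|ax] := ltnP x a.
  rewrite (bigD1 (Ordinal xa)) //= eqxx mulr1 big1 ?addr0; last first.
    by move=> b bx; rewrite eq_sym -(inj_eq val_inj) /= in bx; rewrite (negbTE bx) mulr0.
  by rewrite subrr mulr0 subr0 ltn_eqF // normr0 ltW.
rewrite big1 ?subr0; last by move=> b _; rewrite gtn_eqF ?mulr0 // (leq_trans _ ax).
have [->|xa] := eqVneq x a; first by rewrite mulVf ?expf_neq0 // subrr normr0 ltW.
have {ax xa} : (a < x)%N by rewrite ltn_neqAle eq_sym xa.
move=> ax; rewrite sub0r normrN -(subnK ax) -addSnnS addnC exprD mulrA mulVf ?expf_neq0 //.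
have s0' : 0 <= s by case/andP: s01 => /ltW.
rewrite mul1r ger0_norm ?exprn_ge0 // exprS (@le_trans _ _ s) ?ge_min ?lexx //.
by case/andP: s01 => ? ?; rewrite ger_pMr // exprn_ile1 // ltW.
Qed.

Lemma measurable_nat2 (A : set (nat * nat)) : measurable A.
Proof.
rewrite (_ : A = \bigcup_x \bigcup_y (A `&` [set (x, y)])); last first.
  apply/seteqP; split => [[x y] Axy|z [x _ [y _ []]]] //.
  by exists x => //; exists y.
apply: bigcupT_measurable => x; apply: bigcupT_measurable => y.
have [Axy|nAxy] := pselect (A (x, y)); last first.
  rewrite (_ : _ `&` _ = set0) //; apply/seteqP; split => // z [Az /= zE].
  by rewrite zE in Az.
rewrite setIidr; last by move=> z ->.
rewrite (_ : [set (x, y)] = [set x] `*` [set y]); first exact: measurableX.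
by apply/seteqP; split => [z ->|[z1 z2] [/= -> ->]].
Qed.

Lemma measurable_fun_nat2 d (T : measurableType d) (D : set (nat * nat)) (f : nat * nat -> T) :
  measurable_fun D f.
Proof. by move=> _ B _; exact: measurable_nat2. Qed.

Section nat2_convergence.
Variables (R : realType) (mun : nat -> {measure set (nat * nat) -> \bar R}).
Variable mu : {measure set (nat * nat) -> \bar R}.
Hypotheses (mun1 : forall n, (mun n setT <= 1)%E) (mu1 : (mu setT <= 1)%E).
Hypothesis gf : forall s t : R, 0 < s < 1 -> 0 < t < 1 ->
  \int[mun n]_z (s ^+ z.1 * t ^+ z.2) @[n --> \oo] --> \int[mu]_z (s ^+ z.1 * t ^+ z.2).
Implicit Types u v : nat * nat -> R.

Definition box K : set (nat * nat) := [set z | (z.1 <= K)%N /\ (z.2 <= K)%N].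

Let bounded u := exists M : R, forall z, `|u z| <= M.

Let bounded_int (m : {measure set (nat * nat) -> \bar R}) u :
  (m setT <= 1)%E -> bounded u -> m.-integrable setT (EFin \o u).
Proof.
move=> m1 [M uM]; apply: measurable_bounded_integrable => //.
- exact: le_lt_trans m1 (ltry _).
- exact: measurable_fun_nat2.
- by exists M; split=> [|M' /ltW MM' z _ /=]; [exact: num_real|exact: le_trans MM'].
Qed.

(** The bounded test functions whose integrals converge; it is shown to be closed under linear
    combinations and uniform limits, the two properties on which the extraction of point masses
    rests. *)
Let V u := bounded u /\ (\int[mun n]_z u z @[n --> \oo] --> \int[mu]_z u z).

Let Vlin u v c : V u -> V v -> V (fun z => u z + c * v z).
Proof.
move=> [bu cu] [bv cv].
have bcv : bounded (fun z => c * v z).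
  by case: bv => M vM; exists (`|c| * M) => z; rewrite normrM ler_wpM2l.
split.
  case: bu bcv => [M uM] [M' vM]; exists (M + M') => z.
  by rewrite (le_trans (ler_normD _ _)) // lerD.
have IE (m : {measure set (nat * nat) -> \bar R}) : (m setT <= 1)%E ->
    \int[m]_z (u z + c * v z) = \int[m]_z u z + c * \int[m]_z v z.
  move=> m1; rewrite RintegralD //; [|exact: bounded_int|exact: bounded_int].
  by rewrite RintegralZl //; exact: bounded_int.
rewrite IE //; under eq_fun do rewrite IE //.
by apply: cvgD => //; apply: cvgM => //; exact: cvg_cst.
Qed.

Let Vunif u : (forall eps : R, 0 < eps -> exists2 v, V v & forall z, `|u z - v z| <= eps) -> V u.
Proof.
move=> uV; have bu : bounded u.
  have [v [[M vM] _] uv] := uV 1 ltr01; exists (1 + M) => z.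
  by rewrite -(subrK (v z) (u z)) (le_trans (ler_normD _ _)) // lerD.
split => //; apply/cvgrPdist_le => eps eps0; have e3 : 0 < eps / 3 by rewrite divr_gt0.
have [v [bv cv] uv] := uV _ e3.
have close (m : {measure set (nat * nat) -> \bar R}) : (m setT <= 1)%E ->
    `|\int[m]_z u z - \int[m]_z v z| <= eps / 3.
  move=> m1; rewrite -RintegralB //; [|exact: bounded_int|exact: bounded_int].
  have buv : bounded (fun z => u z - v z) by exists (eps / 3).
  apply: (le_trans (le_normr_Rintegral _ _)) => //; first exact: bounded_int.
  apply: (le_trans (y := \int[m]_z (eps / 3))).
    apply: le_Rintegral => //; first exact/integrable_norm/bounded_int.
    by apply: (bounded_int (u := fun=> eps / 3)) => //; exists `|eps / 3|.
  rewrite Rintegral_cst // (ler_piMr (ltW e3)) // -lee_fin fineK //.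
  by rewrite ge0_fin_numE ?measure_ge0 // (le_lt_trans m1) ?ltry.
move/cvgrPdist_le/(_ _ e3) : cv => cv; near=> n.
have := close _ mu1; have := close _ (mun1 n).
have : `|\int[mu]_z v z - \int[mun n]_z v z| <= eps / 3 by near: n.
set a := Rintegral _ _ _; set b := Rintegral _ _ _.
set c := Rintegral _ _ _; set e := Rintegral _ _ _.
by rewrite !ler_norml => /andP[? ?] /andP[? ?] /andP[? ?]; lra.
Unshelve. all: by end_near. Qed.

Let Vgeo s t : 0 < s < 1 -> 0 < t < 1 -> V (fun z => s ^+ z.1 * t ^+ z.2).
Proof.
move=> s01 t01; split; last exact: gf.
case/andP: s01 t01 => s0 s1 /andP[t0 t1]; exists 1 => z.
have [s0' s1' t0' t1'] : [/\ 0 <= s, s <= 1, 0 <= t & t <= 1] by split; exact: ltW.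
by rewrite ger0_norm ?mulr_ge0 ?exprn_ge0 // mulr_ile1 ?exprn_ge0 ?exprn_ile1.
Qed.

(** Point masses are extracted one coordinate at a time: an atom in the first against each geometric
    sequence in the second, then an atom in the second. *)
Let Vdelta a b : V (fun z => (z.1 == a)%:R * (z.2 == b)%:R).
Proof.
pose W (v : nat -> R) := V (fun z => (z.1 == a)%:R * v z.2).
refine (@delta_of_geometric R W _ _ _ b); rewrite /W.
- move=> u v c Vu Vv.
  rewrite (_ : (fun z => _) = fun z => (z.1 == a)%:R * u z.2 + c * ((z.1 == a)%:R * v z.2)).
    exact: Vlin.
  by apply/funext => z; rewrite mulrDr mulrCA.
- move=> u uV; apply: Vunif => eps /uV[v Vv uv].
  exists (fun z => (z.1 == a)%:R * v z.2) => // z.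
  by rewrite -mulrBr normrM normr_nat; case: (_ == _); rewrite ?mul1r // mul0r (le_trans _ (uv 0%N)).
move=> t t01.
pose W' (u : nat -> R) := V (fun z => u z.1 * t ^+ z.2).
refine (@delta_of_geometric R W' _ _ _ a); rewrite /W'.
- move=> u v c Vu Vv.
  rewrite (_ : (fun z => _) = fun z => u z.1 * t ^+ z.2 + c * (v z.1 * t ^+ z.2)).
    exact: Vlin.
  by apply/funext => z; rewrite mulrDl mulrA.
- move=> u uV; apply: Vunif => eps /uV[v Vv uv].
  exists (fun z => v z.1 * t ^+ z.2) => // z.
  case/andP: t01 => /ltW t0 /ltW t1.
  rewrite -mulrBl normrM [X in _ * X]ger0_norm ?exprn_ge0 //.
  by rewrite (le_trans _ (uv z.1)) // ler_piMr // exprn_ile1.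
- by move=> s s01; exact: Vgeo.
Qed.

(** Cut to a box, any function is a finite combination of atoms. The set is written as an
    intersection with [setT] to match the local convergence required for uniform tails. *)
Lemma nat2_local_cvg u K :
  \int[mun n]_(z in setT `&` box K) u z @[n --> \oo] --> \int[mu]_(z in setT `&` box K) u z.
Proof.
pose w (z : nat * nat) : R := \sum_(a < K.+1) \sum_(b < K.+1) u (nat_of_ord a, nat_of_ord b) * ((z.1 == a :> nat)%:R * (z.2 == b :> nat)%:R).
have V0 : V (fun=> 0).
  rewrite (_ : (fun=> 0) = fun z : nat * nat => (z.1 == 0)%:R * (z.2 == 0)%:R
     + (-1) * ((z.1 == 0)%:R * (z.2 == 0)%:R) :> R); first exact: Vlin.
  by apply/funext => z; rewrite mulN1r subrr.
have Vsum (I : Type) (r : seq I) (F : I -> nat * nat -> R) :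
    (forall i, V (F i)) -> V (fun z => \sum_(i <- r) F i z).
  move=> VF; elim: r => [|i r IHr].
    by rewrite (_ : (fun z => _) = fun=> 0) //; apply/funext => z; rewrite big_nil.
  rewrite (_ : (fun z => _) = fun z => \sum_(i <- r) F i z + 1 * F i z); first exact: Vlin.
  by apply/funext => z; rewrite big_cons mul1r addrC.
have Vw : V w.
  apply: (Vsum) => a; apply: (Vsum) => b.
  rewrite (_ : (fun z => _) = fun z => 0 + u (nat_of_ord a, nat_of_ord b) * ((z.1 == a :> nat)%:R * (z.2 == b :> nat)%:R)).
    exact: Vlin.
  by apply/funext => z; rewrite add0r.
have wE (m : {measure set (nat * nat) -> \bar R}) :
    \int[m]_(z in setT `&` box K) u z = \int[m]_z w z.
  rewrite Rintegral_mkcondr; apply: eq_Rintegral => -[x y] _; rewrite patchE /w.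
  case: ifPn => [|xyK].
    rewrite inE => -[/= xK yK].
    rewrite (bigD1 (Ordinal (xK : (x < K.+1)%N))) //= (bigD1 (Ordinal (yK : (y < K.+1)%N))) //=.
    rewrite !eqxx !mulr1 !big1 ?addr0 //.
      move=> a ax; rewrite big1 // => b _; rewrite eq_sym -(inj_eq val_inj) /= in ax.
      by rewrite (negbTE ax) mul0r mulr0.
    move=> b bx; rewrite eq_sym -(inj_eq val_inj) /= in bx.
    by rewrite (negbTE bx) !mulr0.
  rewrite big1 // => a _; rewrite big1 // => b _.
  have [xa|] := eqVneq x a; last by rewrite mul0r mulr0.
  have [yb|] := eqVneq y b; last by rewrite !mulr0.
  case/negP: xyK; rewrite inE; split => /=.
    by rewrite xa -ltnS.
  by rewrite yb -ltnS.
by rewrite wE; under eq_fun do rewrite wE; exact: Vw.2.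
Qed.

End nat2_convergence.

Lemma mutually_independent_seq d d' (Omega : measurableType d) (T : measurableType d')
    (R : realType) (Pr : probability Omega R) (I : choiceType) (X : I -> Omega -> T)
    (s : seq I) (B : I -> set T) :
  mutually_independent Pr X -> uniq s -> (forall i, i \in s -> measurable (B i)) ->
  (Pr [set w | forall i, i \in s -> B i (X i w)] = \prod_(i <- s) Pr (X i @^-1` B i))%E.
Proof.
move=> indX us mB; pose F := [fset i in s]%fset.
have Fs : perm_eq F s.
  by apply: uniq_perm => // i; rewrite inE.
rewrite -(perm_big _ Fs) /= -indX; last by move=> i; rewrite inE => /mB.
congr (Pr _); apply/seteqP; split => w /= H i.
  by rewrite /= inE => /H.
by move=> si; apply: H; rewrite /= inE.
Qed.

Lemma integral_finite_valued d (Omega : measurableType d) (R : realType)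
    (Pr : probability Omega R) (X : finType) (G : Omega -> X) (F : X -> R) :
  (forall x, measurable [set w | G w = x]) ->
  \int[Pr]_w F (G w) = \sum_x fine (Pr [set w | G w = x]) * F x.
Proof.
move=> mG; have FE w : F (G w) = \sum_x F x * \1_[set w | G w = x] w.
  rewrite (bigD1 (G w)) //= indicE mem_set // mulr1 big1 ?addr0 // => x xG.
  by rewrite indicE memNset ?mulr0 // => /= Gx; rewrite Gx eqxx in xG.
have i1 x : Pr.-integrable setT (EFin \o (fun w => F x * \1_[set w | G w = x] w)).
  apply: measurable_bounded_integrable => //.
  - exact: (le_lt_trans (probability_le1 Pr measurableT) (ltry _)).
  - by apply: measurable_funM => //; exact: measurable_indic.
  - exists `|F x|; split; first exact: num_real.
    move=> M /ltW FM w _ /=; rewrite (le_trans _ FM) // normrM ler_piMr //.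
    by rewrite indicE; case: (_ \in _); rewrite /= ?normr0 ?normr1.
under eq_Rintegral do rewrite FE.
have Rsum (s : seq X) : \int[Pr]_w (\sum_(x <- s) F x * \1_[set w | G w = x] w)
    = \sum_(x <- s) fine (Pr [set w | G w = x]) * F x.
  rewrite /Rintegral (eq_integral (fun w => \sum_(x <- s) (F x * \1_[set w | G w = x] w)%:E)%E).
    rewrite integral_sum // -EFin_sum_fine /=; last first.
      by move=> x _; apply: integrable_fin_num => //; exact: (i1 x).
    apply: eq_bigr => x _.
    rewrite -[LHS]/(\int[Pr]_w (F x * \1_[set w | G w = x] w)) RintegralZl //.
      by rewrite /Rintegral integral_indic // setIT mulrC.
    apply: measurable_bounded_integrable => //.
    - exact: (le_lt_trans (probability_le1 Pr measurableT) (ltry _)).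
    - exists 1; split; first exact: num_real.
      move=> M /ltW FM w _ /=; rewrite (le_trans _ FM) //.
      by rewrite indicE; case: (_ \in _); rewrite /= ?normr0 ?normr1.
  by move=> w _; rewrite sumEFin.
exact: Rsum.
Qed.

Lemma integral_nat2 (R : realType) (mu : {measure set (nat * nat) -> \bar R})
    (h : nat * nat -> \bar R) : (forall z, (0 <= h z)%E) ->
  (\int[mu]_z h z = \sum_(a <oo) \sum_(b <oo) h (a, b) * mu [set (a, b)])%E.
Proof.
move=> h0; have UT : \bigcup_a [set z | z.1 = a] = [set: nat * nat].
  by apply/seteqP; split => // z _; exists z.1.
have UT' a : \bigcup_b [set (a, b)] = [set z : nat * nat | z.1 = a].
  by apply/seteqP; split => [z [b _ ->]|[a' b] /= ->] //; exists b.
have mh D : measurable_fun D h by exact: measurable_fun_nat2.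
rewrite -UT ge0_integral_bigcup //.
- apply: eq_eseriesr => a _; rewrite -UT' ge0_integral_bigcup //.
  + apply: eq_eseriesr => b _.
    rewrite (eq_integral (fun=> h (a, b))) ?integral_cst //.
    * exact: measurable_nat2.
    * by move=> c; rewrite inE /= => ->.
  + by move=> b; exact: measurable_nat2.
  + by move=> b c _ _ [z [-> []]].
- by move=> a; exact: measurable_nat2.
- by move=> a b _ _ [c [/= -> ->]].
Qed.

Lemma nneseries_expR (R : realType) (x : R) : 0 <= x ->
  (\sum_(k <oo) (x ^+ k / k`!%:R)%:E = (expR x)%:E)%E.
Proof.
move=> x0; rewrite expRE -EFin_lim; last first.
  rewrite /pseries/=; under eq_fun do rewrite mulrC.
  exact: is_cvg_series_exp_coeff.
apply/congr_lim/funext => n/=; rewrite /pseries/= /series/= -sumEFin//.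
by under eq_bigr do rewrite mulrC.
Qed.

Lemma nneseries_binomial_gf (R : realType) N (y s : R) :
  (\sum_(a <oo) (s ^+ a * binomial_pmf N y a)%:E = ((1 - y + y * s) ^+ N)%:E)%E.
Proof.
apply: cvg_lim => //; apply: cvg_near_cst; exists N.+1 => // n /= Nn.
rewrite sumEFin; congr (_%:E).
rewrite (@big_cat_nat _ _ _ N.+1) //= [X in _ + X]big1_seq ?addr0; last first.
  move=> a /andP[_]; rewrite mem_index_iota => /andP[Na _].
  by rewrite /binomial_pmf bin_small // mulr0n mulr0.
rewrite exprDn big_mkord; apply: eq_bigr => a _.
by rewrite /binomial_pmf mulrnAr exprMn /unstable.onem; congr (_ *+ _); ring.
Qed.

(** * The limit law *)

Section compound_poisson.
Variables (R : realType) (lambda : R) (g : nat -> \bar R).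
Variables (d : measure_display) (Omega : measurableType d) (Q : probability Omega R).
Variables (Lambda : {RV Q >-> nat}) (H : nat -> {RV Q >-> nat}).
Hypothesis lambda0 : 0 < lambda.
Hypothesis cp : compound_poisson_variables lambda g Lambda H.
Variables (s c : R).
Hypothesis s0 : 0 <= s.
Hypothesis gfg : (\sum_(a <oo) (s ^+ a)%:E * g a = c%:E)%E.

(** Jumps from index [j] on are constrained, those below [j] are left free; this asymmetry drives
    the induction on [j] below. *)
Definition jump_event l j (F : nat -> set nat) : set Omega :=
  [set w | Lambda w = l /\ forall k, (j <= k < l)%N -> F k (H k w)].

Let mLambda (B : set nat) : measurable [set w | B (Lambda w)].
Proof. exact: (measurable_funPTI Lambda (Y := B)). Qed.

Let mH k (B : set nat) : measurable [set w | B (H k w)].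
Proof. exact: (measurable_funPTI (H k) (Y := B)). Qed.

Let measurable_jump_event l j F : measurable (jump_event l j F).
Proof.
rewrite (_ : jump_event l j F = [set w | Lambda w = l] `&`
   \bigcap_(k in [set k | (j <= k < l)%N]) [set w | F k (H k w)]); last first.
  by apply/seteqP; split => w /=.
apply: measurableI; first exact: (mLambda [set l]).
by apply: bigcap_measurableType => k _; exact: mH.
Qed.

Let partial_gf j (w : Omega) : R := \prod_(k < j) s ^+ H k w.

Let measurable_partial_gf D j : measurable_fun D (EFin \o partial_gf j).
Proof.
apply/measurable_EFinP; apply: measurable_funTS; apply: measurable_prod => k _.
by apply: (measurableT_comp (f := fun a : nat => s ^+ a)) => //; exact: measurable_funPT.
Qed.

Let partial_gf_ge0 j w : (0 <= (partial_gf j w)%:E)%E.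
Proof. by rewrite lee_fin prodr_ge0 // => k _; rewrite exprn_ge0. Qed.

(** Slicing by the value [h] of jump [j] turns a free jump into a constrained one, and summing over
    [h] gives a factor [c]. At [j = 0] only a probability of a finite intersection remains, to which
    independence applies as stated for events. *)
Lemma integral_jump_event l j F : (j <= l)%N ->
  (\int[Q]_(w in jump_event l j F) (partial_gf j w)%:E =
   (c ^+ j)%:E * ((poisson_pmf lambda l)%:E
     * \prod_(j <= k < l) Q [set w | F k (H k w)]))%E.
Proof.
elim: j F => [|j IHj] F jl.
  rewrite (eq_integral (fun=> 1%E)); last by move=> w _; rewrite /partial_gf big_ord0.
  rewrite integral_cst // mul1e expr0 mul1e.
  (* Index 0 of the independent family is [Lambda], so that jump [k] has index [k.+1]. *)
  pose B k : set nat := if k is k'.+1 then F k' else [set l].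
  have := mutually_independent_seq (cp_independent cp) (iota_uniq 0 l.+1)
    (B := B) (fun k _ => I).
  set E := [set w | _]; rewrite /= big_cons => indep.
  rewrite (_ : jump_event l 0 F = E).
    rewrite indep -(cp_Lambda cp); congr (_ * _)%E.
    by rewrite (iotaDl 1 0) big_map /index_iota subn0.
  apply/seteqP; split => w /=.
    move=> [Ll FH] [|k] //; rewrite mem_iota /= add0n ltnS => kl.
    exact: FH.
  move=> H'; split; first by have := H' 0%N; apply; rewrite mem_iota.
  by move=> k kl; apply: (H' k.+1); rewrite mem_iota /= add0n ltnS.
pose Fh h k : set nat := if k == j then [set h] else F k.
have -> : jump_event l j.+1 F = \bigcup_h jump_event l j (Fh h).
  apply/seteqP; split => w.
    move=> [Ll FH]; exists (H j w) => //; split => // k /andP[jk kl]; rewrite /Fh.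
    by case: eqP => [->//|/eqP kj]; apply: FH; rewrite kl ltn_neqAle eq_sym kj jk.
  move=> [h _ [Ll FH]]; split => // k /andP[jk kl].
  by have := FH k; rewrite /Fh gtn_eqF //; apply; rewrite kl ltnW.
rewrite ge0_integral_bigcup //; last 2 first.
- exact: measurable_partial_gf.
- move=> h h' _ _ [w [[_ Fw] [_ Fw']]].
  by have := Fw j; have := Fw' j; rewrite /Fh eqxx leqnn jl => /(_ isT) <- /(_ isT).
have [q qE] : exists q : R, (\prod_(j.+1 <= k < l) Q [set w | F k (H k w)] = q%:E)%E.
  elim/big_ind: _ => [|_ _ [x ->] [y ->]|k _]; first by exists 1.
    by exists (x * y); rewrite EFinM.
  by exists (fine (Q [set w | F k (H k w)])); rewrite fineK // fin_num_measure.
pose K := c ^+ j * (poisson_pmf lambda l * q).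
transitivity (\sum_(h <oo) K%:E * ((s ^+ h)%:E * g h))%E.
  apply: eq_eseriesr => h _.
  rewrite (eq_integral (fun w => (s ^+ h)%:E * (partial_gf j w)%:E)%E); last first.
    move=> w; rewrite inE => -[_ Fw]; rewrite /partial_gf big_ord_recr /= EFinM muleC.
    by have := Fw j; rewrite /Fh eqxx leqnn jl => /(_ isT) ->.
  rewrite ge0_integralZl //; [|exact: measurable_partial_gf|by rewrite lee_fin exprn_ge0].
  rewrite IHj; last exact: ltnW.
  rewrite big_ltn // {1}/Fh eqxx (cp_H cp).
  have -> : (\prod_(j.+1 <= i < l) Q [set w | Fh h i (H i w)] =
     \prod_(j.+1 <= k < l) Q [set w | F k (H k w)])%E.
    apply: eq_big_nat => k /andP[jk _]; congr (Q _).
    by rewrite /Fh gtn_eqF.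
  rewrite qE -(cp_H cp j h) -(@fineK _ (Q _)) ?fin_num_measure //; last exact: (mH j [set h]).
  by rewrite -!EFinM; congr (_%:E); rewrite /K; ring.
rewrite nneseriesZl; last first.
  move=> h _; rewrite mule_ge0 ?lee_fin ?exprn_ge0 // -(cp_H cp 0 h).
  exact: measure_ge0.
by rewrite gfg qE -!EFinM; congr (_%:E); rewrite /K exprS; ring.
Qed.

(** On the slice where [Lambda] is [l], all [l] jumps are integrated out and give [c ^+ l]; with the
    Poisson weights this is an exponential series. *)
Lemma compound_poisson_gf :
  (\int[Q]_w (s ^+ (\sum_(k < Lambda w) H k w))%:E = (expR (lambda * (c - 1)))%:E)%E.
Proof.
have UT : \bigcup_l [set w | Lambda w = l] = [set: Omega].
  by apply/seteqP; split => // w _; exists (Lambda w).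
have E l w : Lambda w = l -> (s ^+ (\sum_(k < Lambda w) H k w))%:E = (partial_gf l w)%:E.
  by move=> ->; rewrite /partial_gf prodrXr.
have mF : measurable_fun setT (fun w => (s ^+ (\sum_(k < Lambda w) H k w))%:E).
  move=> _ B mB; rewrite setTI.
  rewrite (_ : _ @^-1` B = \bigcup_l ([set w | Lambda w = l] `&` (EFin \o partial_gf l) @^-1` B)).
    apply: bigcupT_measurable => l; apply: measurableI; first exact: (mLambda [set l]).
    by rewrite -[X in measurable X]setTI; exact: measurable_partial_gf.
  apply/seteqP; split => [w Bw|w [l _ [Ll]]] /=.
    by exists (Lambda w) => //; split => //=; rewrite -E.
  by rewrite /= -E.
rewrite -UT ge0_integral_bigcup //; last 4 first.
- by move=> l; exact: (mLambda [set l]).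
- by rewrite UT.
- by move=> w _; rewrite lee_fin exprn_ge0.
- by move=> l l' _ _ [w [/= -> ->]].
have c0 : 0 <= c.
  rewrite -lee_fin -gfg; apply: nneseries_ge0 => h _ _.
  rewrite mule_ge0 ?lee_fin ?exprn_ge0 // -(cp_H cp 0 h); exact: measure_ge0.
transitivity (\sum_(l <oo) (expR (- lambda))%:E * ((lambda * c) ^+ l / l`!%:R)%:E)%E.
  apply: eq_eseriesr => l _.
  have := integral_jump_event (fun=> setT) (leqnn l).
  rewrite (_ : jump_event l l _ = [set w | Lambda w = l]); last first.
    by apply/seteqP; split => [w []|w] //=; split.
  rewrite big_geq // mule1 => eq_l.
  rewrite (eq_integral (fun w => (partial_gf l w)%:E)).
    by rewrite eq_l /poisson_pmf lambda0 -!EFinM exprMn; congr (_%:E); ring.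
  by move=> w; rewrite inE /= => /E.
rewrite nneseriesZl; last by move=> l _; rewrite lee_fin divr_ge0 // exprn_ge0 // mulr_ge0 // ltW.
rewrite nneseries_expR ?mulr_ge0 // ?ltW // -EFinM -expRD; congr (expR _)%:E; ring.
Qed.

End compound_poisson.

(** The laws in the statement are bare set functions. Equality with a packaged probability makes the
    integration theory available for them. *)
Lemma probability_pushforward d d' (T : measurableType d) (T' : measurableType d')
    (R : realType) (Q : probability T R) (f : T -> T') : measurable_fun setT f ->
  exists nu : probability T' R, pushforward Q f = nu :> (set T' -> \bar R).
Proof.
move=> mf; pose X : {mfun T >-> T'} := HB.pack f (isMeasurableFun.Build _ _ _ _ f mf).
by exists (distribution Q X).
Qed.

(** Normalising a measure of mass 1 leaves it unchanged and supplies the structure of a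
    probability. *)
Lemma probability_of_measure d (T : measurableType d) (R : realType)
    (m : {measure set T -> \bar R}) : m setT = 1%E ->
  exists nu : probability T R, (m : set T -> \bar R) = nu.
Proof.
move=> m1; exists (mnormalize m \d_point); apply/funext => A.
by rewrite /= /mnormalize m1 onee_eq0 /= invr1 mule1.
Qed.

Lemma measurable_add_nat2 : measurable_fun setT (fun z : (nat * nat) * (nat * nat) =>
  ((z.1.1 + z.2.1)%N, (z.1.2 + z.2.2)%N)).
Proof.
rewrite (_ : (fun z => _) = fun z : (nat * nat) * (nat * nat) => ((fun u : nat * nat => (u.1 + u.2)%N) (z.1.1, z.2.1),
     (fun u : nat * nat => (u.1 + u.2)%N) (z.1.2, z.2.2))) //.
apply: measurable_fun_pair.
  apply: (measurableT_comp (f := fun u : nat * nat => (u.1 + u.2)%N)).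
    exact: measurable_fun_nat2.
  by apply: measurable_fun_pair; apply: measurableT_comp.
apply: (measurableT_comp (f := fun u : nat * nat => (u.1 + u.2)%N)).
  exact: measurable_fun_nat2.
by apply: measurable_fun_pair; apply: measurableT_comp.
Qed.

Section gf_of_convolution.
Variables (R : realType).
Implicit Types (f g : probability (nat * nat)%type R).
Variables (s t : R).
Hypotheses (s0 : 0 <= s) (t0 : 0 <= t).

Let h (z : nat * nat) : \bar R := (s ^+ z.1 * t ^+ z.2)%:E.
Let h0 z : (0 <= h z)%E.
Proof. by rewrite lee_fin mulr_ge0 ?exprn_ge0. Qed.

Lemma gf_conv_nat2 f g :
  (\int[conv_nat2 f g]_z h z = (\int[f]_z h z) * (\int[g]_z h z))%E.
Proof.
have mh : measurable_fun setT h by exact: measurable_fun_nat2.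
pose add (z : (nat * nat) * (nat * nat)) := ((z.1.1 + z.2.1)%N, (z.1.2 + z.2.2)%N).
have madd : measurable_fun setT add by exact: measurable_add_nat2.
rewrite /conv_nat2 ge0_integral_pushforward //.
rewrite preimage_setT fubini_tonelli1; [|exact: (measurableT_comp mh madd)|].
  2: by move=> z; exact: h0.
rewrite -ge0_integralZr //; last exact: integral_ge0.
apply: eq_integral => z _; rewrite /fubini_F /= -ge0_integralZl //.
by apply: eq_integral => z' _; rewrite /h /= -EFinM !exprD; congr (_%:E); ring.
Qed.

Lemma gf_product_nat (f g : probability nat R) :
  (\int[f \x g]_z h z = (\int[f]_a (s ^+ a)%:E) * (\int[g]_b (t ^+ b)%:E))%E.
Proof.
rewrite fubini_tonelli1 //; last exact: measurable_fun_nat2.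
rewrite -ge0_integralZr //; last 2 first.
- by move=> a _; rewrite lee_fin exprn_ge0.
- by apply: integral_ge0 => a _; rewrite lee_fin exprn_ge0.
apply: eq_integral => a _; rewrite /fubini_F -ge0_integralZl //.
- by move=> b _; rewrite lee_fin exprn_ge0.
- by rewrite lee_fin exprn_ge0.
Qed.

Lemma gf_dirac11 : (\int[\d_(1%N, 1%N)]_z h z = (s * t)%:E)%E.
Proof.
rewrite integral_dirac //; last exact: measurable_fun_nat2.
by rewrite diracT mul1e /h /= !expr1.
Qed.

End gf_of_convolution.

Section f2'_measure.
Variables (R : realType) (P : {measure set (nat * R) -> \bar R}).

Lemma cross_moment_ge0 r q : (0 <= cross_moment P r q)%E.
Proof.
apply: integral_ge0 => z /andP[y0 _]; by rewrite lee_fin mulr_ge0 ?exprn_ge0.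
Qed.

Lemma f2'_pmf_ge0 a b : (0 <= f2'_pmf P a b)%E.
Proof.
apply: integral_ge0 => z y01; have {}y01 : 0 <= z.2 <= 1 := y01.
rewrite lee_fin mulr_ge0 ?mulr_ge0 ?binomial_pmf_ge0 ?invr_ge0 ?fine_ge0 ?cross_moment_ge0 //.
by case/andP: y01.
Qed.

Let f2'0 : f2' P set0 = 0%E. Proof. by rewrite /f2' esum_set0. Qed.

Let f2'_ge0 A : (0 <= f2' P A)%E.
Proof. by apply: esum_ge0 => z _; exact: f2'_pmf_ge0. Qed.

Let f2'_sigma_additive : semi_sigma_additive (f2' P).
Proof.
move=> F mF tF mUF; apply: cvg_toP.
  apply: ereal_nondecreasing_is_cvgn => a b ab.
  by apply: lee_sum_nneg_natr => // n _ _; exact: f2'_ge0.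
by rewrite /f2' nneseries_sum_bigcup // => z; exact: f2'_pmf_ge0.
Qed.

HB.instance Definition _ := isMeasure.Build _ _ _ (f2' P)
  f2'0 f2'_ge0 f2'_sigma_additive.

Lemma f2'_set1 z : f2' P [set z] = f2'_pmf P z.1 z.2.
Proof. by rewrite /f2' esum_set1 // f2'_pmf_ge0. Qed.

End f2'_measure.

Section limit_law.
Variables (R : realType) (P : probability (nat * R)%type R).
Local Notation S0 := (@layer_space R).
Let p10 := fine (cross_moment P 1 0).
Let p21 := fine (cross_moment P 2 1).
Hypotheses (P10 : (0 < cross_moment P 1 0 < +oo)%E) (P21 : (0 < cross_moment P 2 1 < +oo)%E).

Let mS := @measurable_layer_space R.

(** The integrals of [size1_gf] and [size2_gf] against [P] are P_10 times the generating function of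
    [g] and P_21 times that of [f2']. *)
Definition size1_gf (s : R) (z : nat * R) : R :=
  z.1%:R * (1 - z.2 + z.2 * s) ^+ z.1.-1.

Definition size2_gf (s t : R) (z : nat * R) : R :=
  (z.1 ^_ 2)%:R * z.2 * ((1 - z.2 + z.2 * s) ^+ (z.1 - 2) * (1 - z.2 + z.2 * t) ^+ (z.1 - 2)).

Lemma affine_continuous (s : R) : continuous (fun y : R => 1 - y + y * s).
Proof.
move=> y; apply: cvgD; first by apply: cvgB; [exact: cvg_cst|exact: cvg_id].
by apply: cvgM; [exact: cvg_id|exact: cvg_cst].
Qed.

Lemma continuous_expr (f : R -> R) k : continuous f -> continuous (fun y => f y ^+ k).
Proof.
move=> cf y; elim: k => [|k IHk].
  by under eq_fun do rewrite expr0; exact: cvg_cst.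
by under eq_fun do rewrite exprS; apply: cvgM => //; exact: cf.
Qed.

Lemma size1_gf_continuous s : strength_continuous (size1_gf s).
Proof.
move=> x y; apply: cvgM; first exact: cvg_cst.
exact: (@continuous_expr _ x.-1 (@affine_continuous s)).
Qed.

Lemma size2_gf_continuous s t : strength_continuous (size2_gf s t).
Proof.
move=> x; rewrite /size2_gf /= => y.
apply: cvgM; first by apply: cvgM; [exact: cvg_cst|exact: cvg_id].
apply: cvgM; first exact: (@continuous_expr _ (x - 2) (@affine_continuous s)).
exact: (@continuous_expr _ (x - 2) (@affine_continuous t)).
Qed.

Lemma affine01 (s y : R) : 0 <= s <= 1 -> 0 <= y <= 1 -> 0 <= 1 - y + y * s <= 1.
Proof. by move=> /andP[? ?] /andP[? ?]; apply/andP; split; nra. Qed.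

Lemma size1_gf_bound s z : 0 <= s <= 1 -> S0 z -> 0 <= size1_gf s z <= z.1%:R.
Proof.
move=> s01 /(affine01 s01)/andP[q0 q1]; rewrite mulr_ge0 ?exprn_ge0 //=.
by rewrite ler_piMr // exprn_ile1.
Qed.

Lemma size2_gf_bound s t z : 0 <= s <= 1 -> 0 <= t <= 1 -> S0 z ->
  0 <= size2_gf s t z <= (z.1 ^_ 2)%:R * z.2.
Proof.
move=> s01 t01 Sz; have /andP[q0 q1] := affine01 s01 Sz; have /andP[r0 r1] := affine01 t01 Sz.
have /andP[y0 y1] := Sz.
rewrite mulr_ge0 ?mulr_ge0 ?exprn_ge0 //= ler_piMr ?mulr_ge0 //.
by rewrite mulr_ile1 ?exprn_ge0 ?exprn_ile1.
Qed.

Let finite_integrable (psi : nat * R -> R) : strength_continuous psi ->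
  (forall z, S0 z -> 0 <= psi z) -> (\int[P]_(z in S0) (psi z)%:E < +oo)%E ->
  P.-integrable S0 (EFin \o psi).
Proof.
move=> cpsi psi0 fin; apply/integrableP; split.
  by apply/measurable_EFinP; exact: strength_continuous_measurable.
apply: le_lt_trans fin; rewrite le_eqVlt; apply/orP; left; apply/eqP.
by apply: eq_integral => z; rewrite inE => Sz; rewrite gee0_abs // lee_fin psi0.
Qed.

Lemma size1_integrable : P.-integrable S0 (fun z => (z.1%:R : R)%:E).
Proof.
apply: (finite_integrable (psi := fun z => z.1%:R)) => [x y|//|].
  exact: cvg_cst.
case/andP: P10 => _; congr (_ < _)%E; apply: eq_integral => z _.
by rewrite ffactn1 expr0 mulr1.
Qed.

Lemma size2_integrable : P.-integrable S0 (fun z => ((z.1 ^_ 2)%:R * z.2)%:E).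
Proof.
apply: (finite_integrable (psi := fun z => (z.1 ^_ 2)%:R * z.2)) => [x /= y|z /andP[y0 _]|].
- by apply: cvgM; [exact: cvg_cst|exact: cvg_id].
- by rewrite mulr_ge0.
- by case/andP: P21 => _; congr (_ < _)%E; apply: eq_integral => z _; rewrite expr1.
Qed.

Lemma binomial_pmf_continuous N a : continuous (fun y : R => binomial_pmf N y a).
Proof.
move=> y; under eq_fun do rewrite /binomial_pmf -mulr_natl.
rewrite -mulr_natl; apply: cvgM; first exact: cvg_cst.
apply: cvgM; first exact: (@continuous_expr _ a (fun y => @cvg_id _ _)).
by apply: continuous_expr => {}y; apply: cvgB; [exact: cvg_cst|exact: cvg_id].
Qed.

(** Tonelli exchanges series and integral, and the binomial theorem sums the series inside. *)
Lemma g_pmf_gf (s : R) : 0 <= s <= 1 ->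
  (\sum_(a <oo) (s ^+ a)%:E * g_pmf P a = ((\int[P]_(z in S0) size1_gf s z) / p10)%:E)%E.
Proof.
move=> s01; have /andP[s0 s1] := s01.
have p0 : 0 <= p10^-1 by rewrite invr_ge0 fine_ge0 // cross_moment_ge0.
have cq a : strength_continuous (fun z : nat * R => binomial_pmf z.1.-1 z.2 a * (z.1%:R / p10)).
  move=> x /= y; apply: cvgM; [exact: binomial_pmf_continuous|exact: cvg_cst].
have q0 a z : S0 z -> 0 <= binomial_pmf z.1.-1 z.2 a * (z.1%:R / p10).
  by move=> y01; rewrite !mulr_ge0 ?binomial_pmf_ge0.
have mq a D : measurable_fun D (fun z : nat * R => (binomial_pmf z.1.-1 z.2 a * (z.1%:R / p10))%:E).
  by apply/measurable_EFinP; exact: strength_continuous_measurable.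
transitivity (\sum_(a <oo) \int[P]_(z in S0)
    ((s ^+ a)%:E * (binomial_pmf z.1.-1 z.2 a * (z.1%:R / p10))%:E))%E.
  apply: eq_eseriesr => a _; rewrite ge0_integralZl //.
  - by move=> z Sz; rewrite lee_fin q0.
  - by rewrite lee_fin exprn_ge0.
rewrite -integral_nneseries //; last 2 first.
- by move=> a; apply: emeasurable_funM => //; exact: measurable_cst.
- by move=> a z Sz; rewrite mule_ge0 ?lee_fin ?exprn_ge0 ?q0.
have i1 : P.-integrable S0 (EFin \o size1_gf s).
  apply: le_integrable size1_integrable => //.
    by apply/measurable_EFinP; apply: strength_continuous_measurable; exact: (@size1_gf_continuous s).
  move=> z Sz; have /andP[a0 a1] := size1_gf_bound s01 Sz.
  by rewrite lee_fin !ger0_norm.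
rewrite EFinM EFin_Rintegral // -integralZr //.
apply: eq_integral => z; rewrite inE => Sz.
transitivity (\sum_(a <oo) (z.1%:R / p10)%:E * (s ^+ a * binomial_pmf z.1.-1 z.2 a)%:E)%E.
  by apply: eq_eseriesr => a _; rewrite -!EFinM; congr (_%:E); ring.
rewrite nneseriesZl; last first.
  by move=> a _; rewrite lee_fin mulr_ge0 ?exprn_ge0 ?binomial_pmf_ge0.
by rewrite nneseries_binomial_gf -!EFinM /size1_gf; congr (_%:E); ring.
Qed.

Lemma f2'_gf (s t : R) : 0 <= s <= 1 -> 0 <= t <= 1 ->
  (\int[f2' P]_z (s ^+ z.1 * t ^+ z.2)%:E
   = ((\int[P]_(z in S0) size2_gf s t z) / p21)%:E)%E.
Proof.
move=> s01 t01; have /andP[s0 s1] := s01; have /andP[t0 t1] := t01.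
have p0 : 0 <= p21^-1 by rewrite invr_ge0 fine_ge0 // cross_moment_ge0.
pose q a b (z : nat * R) : R :=
  binomial_pmf (z.1 - 2) z.2 a * binomial_pmf (z.1 - 2) z.2 b * ((z.1 ^_ 2)%:R * z.2 / p21).
have cq a b : strength_continuous (q a b).
  move=> x; rewrite /q /= => y; apply: cvgM.
    by apply: cvgM; exact: binomial_pmf_continuous.
  by apply: cvgM; [apply: cvgM; [exact: cvg_cst|exact: cvg_id]|exact: cvg_cst].
have q0 a b z : S0 z -> 0 <= q a b z.
  move=> y01; have /andP[y0 _] := y01.
  by rewrite !mulr_ge0 ?binomial_pmf_ge0.
have mq a b D : measurable_fun D (fun z : nat * R => (q a b z)%:E).
  by apply/measurable_EFinP; exact: strength_continuous_measurable.
have st0 a b : 0 <= s ^+ a * t ^+ b by rewrite mulr_ge0 ?exprn_ge0.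
have msq a b D : measurable_fun D (fun z : nat * R => (s ^+ a * t ^+ b)%:E * (q a b z)%:E)%E.
  by apply: emeasurable_funM => //; exact: measurable_cst.
have sq0 a b z : S0 z -> (0 <= (s ^+ a * t ^+ b)%:E * (q a b z)%:E)%E.
  by move=> Sz; rewrite mule_ge0 ?lee_fin ?q0.
rewrite integral_nat2; last by move=> z; rewrite lee_fin.
transitivity (\sum_(a <oo) \sum_(b <oo) \int[P]_(z in S0)
    ((s ^+ a * t ^+ b)%:E * (q a b z)%:E))%E.
  apply: eq_eseriesr => a _; apply: eq_eseriesr => b _.
  rewrite ge0_integralZl //.
  - by congr (_ * _)%E; exact: (f2'_set1 P (a, b)).
  - by move=> z Sz; rewrite lee_fin q0.
  - by rewrite lee_fin.
transitivity (\sum_(a <oo) \int[P]_(z in S0) (\sum_(b <oo)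
    ((s ^+ a * t ^+ b)%:E * (q a b z)%:E)))%E.
  by apply: eq_eseriesr => a _; rewrite integral_nneseries // => b z; exact: sq0.
rewrite -integral_nneseries //; last 2 first.
- by move=> a; apply: ge0_emeasurable_sum => // b z Sz _; exact: sq0.
- by move=> a z Sz; apply: nneseries_ge0 => b _ _; exact: sq0.
have i2 : P.-integrable S0 (EFin \o size2_gf s t).
  apply: le_integrable size2_integrable => //.
    by apply/measurable_EFinP; apply: strength_continuous_measurable; exact: (@size2_gf_continuous s t).
  move=> z Sz; have /andP[a0 a1] := size2_gf_bound s01 t01 Sz.
  by rewrite lee_fin !ger0_norm // (le_trans a0).
rewrite EFinM EFin_Rintegral // -integralZr //.
apply: eq_integral => z; rewrite inE => Sz; have /andP[y0 _] := Sz.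
pose w : R := (z.1 ^_ 2)%:R * z.2 / p21.
have w0 : 0 <= w by rewrite !mulr_ge0.
have c0 : 0 <= (1 - z.2 + z.2 * t) ^+ (z.1 - 2).
  by rewrite exprn_ge0 //; case/andP: (affine01 t01 Sz).
transitivity (\sum_(a <oo) (w * (1 - z.2 + z.2 * t) ^+ (z.1 - 2))%:E
   * (s ^+ a * binomial_pmf (z.1 - 2) z.2 a)%:E)%E.
  apply: eq_eseriesr => a _.
  transitivity (\sum_(b <oo) (w * (s ^+ a * binomial_pmf (z.1 - 2) z.2 a))%:E
      * (t ^+ b * binomial_pmf (z.1 - 2) z.2 b)%:E)%E.
    by apply: eq_eseriesr => b _; rewrite -!EFinM /q /w; congr (_%:E); ring.
  rewrite nneseriesZl; last first.
    by move=> b _; rewrite lee_fin mulr_ge0 ?exprn_ge0 ?binomial_pmf_ge0.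
  by rewrite nneseries_binomial_gf -!EFinM; congr (_%:E); ring.
rewrite nneseriesZl; last first.
  by move=> a _; rewrite lee_fin mulr_ge0 ?exprn_ge0 ?binomial_pmf_ge0.
by rewrite nneseries_binomial_gf -!EFinM /size2_gf /w; congr (_%:E); ring.
Qed.

(** The total mass is the generating function at [s = t = 1], where the binomial factors are 1 and
    the integral reduces to P_21. *)
Lemma f2'_probability : exists nu : probability (nat * nat)%type R,
  f2' P = nu :> (set (nat * nat) -> \bar R).
Proof.
apply: probability_of_measure.
have : (\int[f2' P]_z (1 ^+ z.1 * 1 ^+ z.2 : R)%:E = 1)%E.
  rewrite f2'_gf ?ler01 ?lexx //.
  rewrite (_ : Rintegral _ _ _ = p21) ?divff // /p21.
    by rewrite gt_eqF // fine_gt0.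
  rewrite /Rintegral; congr fine; apply: eq_integral => z _.
  by rewrite /size2_gf !mulr1 subrK !expr1n !mulr1 expr1.
move=> <-; rewrite -[LHS]mul1e -integral_cst //; apply: eq_integral => z _.
by rewrite !expr1n mulr1.
Qed.

End limit_law.

Section f2bar_law.
Variables (R : realType) (P : probability (nat * R)%type R) (mu : R).
Local Notation S0 := (@layer_space R).
Let p10 := fine (cross_moment P 1 0).
Let p21 := fine (cross_moment P 2 1).
Hypotheses (P10 : (0 < cross_moment P 1 0 < +oo)%E) (P21 : (0 < cross_moment P 2 1 < +oo)%E).
Hypothesis mu0 : 0 < mu.
Variables (d : measure_display) (Omega : measurableType d) (Q : probability Omega R).
Variables (Lambda : {RV Q >-> nat}) (H : nat -> {RV Q >-> nat}).
Hypothesis cp : compound_poisson_variables (mu * p10) (g_pmf P) Lambda H.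

Let p10_gt0 : 0 < p10. Proof. exact: fine_gt0. Qed.

Let measurable_compound : measurable_fun setT (fun w => (\sum_(k < Lambda w) H k w)%N).
Proof.
have mS l : measurable_fun setT (fun w => (\sum_(k < l) H k w)%N).
  elim: l => [|l IHl]; first by under eq_fun do rewrite big_ord0; exact: measurable_cst.
  under eq_fun do rewrite big_ord_recr /=.
  rewrite (_ : (fun w => _) = (fun u : nat * nat => (u.1 + u.2)%N) \o
    (fun w => ((\sum_(k < l) H k w)%N, H l w))) //.
  apply: measurableT_comp; first exact: measurable_fun_nat2.
  by apply: measurable_fun_pair => //; exact: measurable_funPT.
move=> _ B mB; rewrite setTI.
rewrite (_ : _ @^-1` B = \bigcup_l (Lambda @^-1` [set l] `&` (fun w => (\sum_(k < l) H k w)%N) @^-1` B)).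
  apply: bigcupT_measurable => l; apply: measurableI; first exact: (measurable_funPTI Lambda).
  by rewrite -[X in measurable X]setTI; exact: mS.
apply/seteqP; split => [w Bw|w [l _ [/= <-]]] //=.
by exists (Lambda w).
Qed.

(** Generating functions of convolution factors multiply. In the compound Poisson factor the mean
    [mu P_10] meets a jump generating function with denominator P_10, which cancels in the
    exponent. *)
Lemma f2bar_law : exists nu : probability (nat * nat)%type R,
  f2bar (compound_law Q Lambda (fun k => H k)) P = nu :> (set (nat * nat) -> \bar R)
  /\ forall s t : R, 0 <= s <= 1 -> 0 <= t <= 1 ->
    \int[nu]_z (s ^+ z.1 * t ^+ z.2) = s * t
      * (expR (mu * (\int[P]_(z in S0) size1_gf s z - p10))
         * expR (mu * (\int[P]_(z in S0) size1_gf t z - p10)))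
      * ((\int[P]_(z in S0) size2_gf s t z) / p21).
Proof.
have [f1 f1E] := probability_pushforward Q measurable_compound.
have [f2 f2E] := f2'_probability P21.
have madd : measurable_fun setT (fun z : (nat * nat) * (nat * nat) =>
    ((z.1.1 + z.2.1)%N, (z.1.2 + z.2.2)%N)) by exact: measurable_add_nat2.
have [c1 c1E] := probability_pushforward
  (\d_(1%N, 1%N) \x (f1 \x f1))%E madd.
have [nu nuE] := probability_pushforward (c1 \x f2)%E madd.
exists nu; split.
  by rewrite /f2bar /compound_law f1E f2E /conv_nat2 c1E.
move=> s t s01 t01; have /andP[s0 s1] := s01; have /andP[t0 t1] := t01.
have f1_gf (r : R) : 0 <= r <= 1 ->
    (\int[f1]_a (r ^+ a)%:E = (expR (mu * (\int[P]_(z in S0) size1_gf r z - p10)))%:E)%E.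
  move=> r01; have /andP[r0 _] := r01.
  have := compound_poisson_gf (mulr_gt0 mu0 p10_gt0) cp r0 (g_pmf_gf P10 r01).
  rewrite -f1E ge0_integral_pushforward // => [->|a _]; last by rewrite lee_fin exprn_ge0.
  congr (expR _)%:E; rewrite -mulrA mulrBr mulr1 mulrCA divff ?mulr1 //.
  by rewrite gt_eqF.
have nu_gf : (\int[nu]_z (s ^+ z.1 * t ^+ z.2)%:E =
    (\int[conv_nat2 c1 f2]_z (s ^+ z.1 * t ^+ z.2)%:E))%E by rewrite /conv_nat2 nuE.
have c1_gf : (\int[c1]_z (s ^+ z.1 * t ^+ z.2)%:E =
    (\int[conv_nat2 (@dirac _ (nat * nat)%type (1%N, 1%N) R) (f1 \x f1)]_z
       (s ^+ z.1 * t ^+ z.2)%:E))%E by rewrite /conv_nat2 c1E.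
have f2_gf : (\int[f2]_z (s ^+ z.1 * t ^+ z.2)%:E =
    (\int[f2' P]_z (s ^+ z.1 * t ^+ z.2)%:E))%E by rewrite f2E.
rewrite /Rintegral nu_gf gf_conv_nat2 // c1_gf gf_conv_nat2 // f2_gf (f2'_gf P21) //.
by rewrite gf_dirac11 gf_product_nat // !f1_gf // -!EFinM.
Qed.

End f2bar_law.

(** The law of the graph of one layer, with size and strength integrated out. *)
Definition layer_pmf (R : realType) n (Pn : set (nat * R) -> \bar R) (g : lgraph n) : R :=
  fine (\int[Pn]_(z in @layer_space R) (layer_kernel g z)%:E)%E.

Definition layer_expectation (R : realType) n (Pn : set (nat * R) -> \bar R)
    (h : lgraph n -> R) : R := \sum_g layer_pmf Pn g * h g.

(** * The bidegree law as a finite sum over the layers *)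

Section finite_model.
Variables (R : realType) (n m : nat) (d : measure_display) (Omega : measurableType d).
Variables (Pr : probability Omega R) (Pn : probability (nat * R)%type R).
Variable Z : 'I_m -> {RV Pr >-> (lgraph n * (nat * R))%type}.
Hypothesis model : layer_model Pn Z.
Local Notation S0 := (@layer_space R).
Local Notation pmf := (layer_pmf (n := n) Pn).

Let mS := @measurable_layer_space R.

Let msupp : measurable [set z | (z.1 <= n)%N /\ S0 z].
Proof.
rewrite (_ : [set z | _] = size_le n `&` S0) //.
by apply: measurableI => //; exact: measurable_size_le.
Qed.

Let PnS : Pn S0 = 1%E.
Proof.
apply/eqP; rewrite eq_le probability_le1 //= -(layer_support model).
by apply: le_measure; rewrite ?inE // => z [].
Qed.

(** [Pn] charges only sizes at most [n], precisely those for which the closed formulas for the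
    kernel means hold. *)
Lemma layer_integral_ext (f h : nat * R -> R) :
  measurable_fun S0 f -> measurable_fun S0 h ->
  (forall z, (z.1 <= n)%N -> S0 z -> f z = h z) ->
  \int[Pn]_(z in S0) f z = \int[Pn]_(z in S0) h z.
Proof.
move=> mf mh fh; congr fine; apply: ae_eq_integral => //; [exact/measurable_EFinP|exact/measurable_EFinP|].
exists (~` [set z | (z.1 <= n)%N /\ S0 z]); split.
- exact: measurableC.
- by have := probability_setC Pn msupp; rewrite (layer_support model) subee.
- move=> z /= H [zn Sz]; apply: H => _; congr (_%:E); exact: fh.
Qed.

Lemma layer_pmfE k g : Pr [set w | (Z k w).1 = g] = (pmf g)%:E.
Proof.
have E := layer_law PnS (layers_law model k) g.
rewrite /layer_pmf -E fineK // fin_num_measure //.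
apply: (measurable_funPTI (Z k) (Y := fst @^-1` [set g])).
by rewrite -[X in measurable X]setTI; exact: measurable_fst.
Qed.

Lemma layer_pmf_ge0 g : 0 <= pmf g.
Proof. by apply: fine_ge0; apply: integral_ge0 => z Sz; rewrite lee_fin layer_kernel_ge0. Qed.

Let layer_kernel_integrable (g : lgraph n) :
  Pn.-integrable S0 (EFin \o layer_kernel g).
Proof.
apply: measurable_bounded_integrable => //.
- exact: (le_lt_trans (probability_le1 Pn mS) (ltry _)).
- by apply: strength_continuous_measurable; exact: (@layer_kernel_continuous _ _ g).
- exists 1; split => // M M1 z Sz /=.
  by rewrite ger0_norm ?layer_kernel_ge0 // (le_trans (layer_kernel_le1 _ Sz)) // ltW.
Qed.

Lemma kernel_mean_continuous (h : lgraph n -> R) : strength_continuous (kernel_mean h).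
Proof.
move=> x; rewrite /kernel_mean; elim: (index_enum _) => [|g r IHr] y.
  under eq_fun do rewrite big_nil.
  exact: cvg_cst.
under eq_fun do rewrite big_cons.
apply: cvgD; last exact: (IHr y).
by apply: cvgM; [exact: (@layer_kernel_continuous _ _ g)|exact: cvg_cst].
Qed.

Lemma layer_expectationE (h : lgraph n -> R) :
  layer_expectation Pn h = \int[Pn]_(z in S0) kernel_mean h z.
Proof.
have ih g : Pn.-integrable S0 (fun z => (layer_kernel g z * h g)%:E).
  under eq_fun do rewrite EFinM.
  by apply: integrableZr => //; exact: layer_kernel_integrable.
rewrite /layer_expectation /Rintegral.
rewrite (eq_integral (fun z : nat * R => \sum_(g : lgraph n) (layer_kernel g z * h g)%:E)%E); last first.
  by move=> z _; rewrite sumEFin.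
rewrite integral_sum // -EFin_sum_fine /=; last first.
  by move=> g _; exact: integrable_fin_num.
apply: eq_bigr => g _; rewrite -[RHS]/(\int[Pn]_(z in S0) (layer_kernel g z * h g)).
by rewrite RintegralZr.
Qed.

Lemma layer_expectation_ext (h : lgraph n -> R) (f : nat * R -> R) : measurable_fun S0 f ->
  (forall z, (z.1 <= n)%N -> S0 z -> kernel_mean h z = f z) ->
  layer_expectation Pn h = \int[Pn]_(z in S0) f z.
Proof.
move=> mf hf; rewrite layer_expectationE; apply: layer_integral_ext => //.
by apply: strength_continuous_measurable; exact: (@kernel_mean_continuous h).
Qed.

Lemma layer_pmf_sum1 : \sum_g pmf g = 1.
Proof.
have -> : \sum_g pmf g = layer_expectation Pn (fun _ : lgraph n => 1).
  by apply: eq_bigr => g _; rewrite mulr1.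
rewrite (@layer_expectation_ext _ (fun=> 1)) //; last by move=> z zn _; exact: kernel_mean1.
by rewrite Rintegral_cst // mul1r [X in fine X]PnS.
Qed.

Definition graphs (w : Omega) : {ffun 'I_m -> lgraph n} := [ffun k => (Z k w).1].

Let measurable_graph k (A : set (lgraph n)) : measurable [set w | A (Z k w).1].
Proof.
apply: (measurable_funPTI (Z k) (Y := fst @^-1` A)).
by rewrite -[X in measurable X]setTI; exact: measurable_fst.
Qed.

Let graphsE x : [set w | graphs w = x] =
  [set w | forall k, k \in enum 'I_m -> (fst @^-1` [set x k]) (Z k w)].
Proof.
apply/seteqP; split => w /=; first by move=> <- k _; rewrite ffunE.
by move=> H; apply/ffunP => k; rewrite ffunE H // mem_enum.
Qed.

Lemma measurable_graphs x : measurable [set w | graphs w = x].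
Proof.
rewrite graphsE (_ : [set w | _] = \big[setI/setT]_(k < m) [set w | (Z k w).1 = x k]).
  by apply: bigsetI_measurable => k _; exact: (measurable_graph k [set x k]).
apply/seteqP; split => w.
  move=> H; rewrite -bigcap_seq => k _ /=; apply: H; exact: mem_enum.
by rewrite -bigcap_seq => H k _; apply: (H k); rewrite /= mem_index_enum.
Qed.

Lemma graphs_law x : Pr [set w | graphs w = x] = (\prod_k pmf (x k))%:E.
Proof.
have mB k : k \in enum 'I_m -> measurable (fst @^-1` [set x k] : set (lgraph n * (nat * R))).
  by move=> _; rewrite -[X in measurable X]setTI; exact: measurable_fst.
rewrite graphsE [LHS](mutually_independent_seq (layers_independent model) (enum_uniq _) mB).
rewrite big_enum /= (eq_bigr (fun k => (pmf (x k))%:E)); last first.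
  by move=> k _; rewrite -(layer_pmfE k).
by rewrite prodEFin.
Qed.

(** The expectation of [h] of the two degrees on the event that [i] and [j] are adjacent, before
    division by the probability of that event, which is the value at [h = 1]. *)
Definition bidegree_sum (i j : 'I_n) (h : nat * nat -> R) : R :=
  iid_sum pmf (fun x : {ffun 'I_m -> lgraph n} => [exists k, edge i j (x k)]%:R
    * h (ldeg (union_edges x) i, ldeg (union_edges x) j)).

Let ZZ (k : 'I_m) (w : Omega) : lgraph n * (nat * R) := Z k w.

Let superposition_graphs w : superposition_edges ZZ w = union_edges (graphs w).
Proof. by apply: eq_bigr => k _; rewrite ffunE. Qed.

(** The conditional law is the law of the degrees under [Pr] restricted to adjacency and normalised.
    Every [h] is integrable because only finitely many families of graphs occur. *)
Lemma bidegree_probability (i j : 'I_n) : 0 < bidegree_sum i j (fun=> 1) ->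
  exists nu : probability (nat * nat)%type R,
    bidegree_law ZZ Pr i j = nu :> (set (nat * nat) -> \bar R)
    /\ forall h, nu.-integrable setT (EFin \o h)
         /\ \int[nu]_z h z = bidegree_sum i j h / bidegree_sum i j (fun=> 1).
Proof.
set N1 := bidegree_sum i j _ => N1_gt0.
pose dd (x : {ffun 'I_m -> lgraph n}) := (ldeg (union_edges x) i, ldeg (union_edges x) j).
pose adj := [set w | Defs.adjacent ZZ w i j].
have mgraphs (A : set {ffun 'I_m -> lgraph n}) : measurable (graphs @^-1` A).
  rewrite (_ : graphs @^-1` A = \big[setU/set0]_(x | x \in A) [set w | graphs w = x]).
    by apply: bigsetU_measurable => x _; exact: measurable_graphs.
  rewrite -bigcup_seq_cond; apply/seteqP; split => w /=.
    by move=> Aw; exists (graphs w) => //=; rewrite mem_index_enum inE.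
  by move=> [x /= /andP[_ /set_mem Ax] ->].
have adjE : adj = graphs @^-1` [set x : {ffun 'I_m -> lgraph n} | [exists k, edge i j (x k)]].
  by apply/seteqP; split => w; rewrite /adj /Defs.adjacent /= superposition_graphs union_edgeE.
have madj : measurable adj by rewrite adjE.
have Ex (x : {ffun 'I_m -> lgraph n}) : [set w | graphs w = x] `&` adj =
    if [exists k, edge i j (x k)] then [set w | graphs w = x] else set0.
  rewrite adjE; apply/seteqP; split => [w [/= <- ->]//|w].
  by case: ifP => // ex /= wx; split => //=; rewrite wx.
have Padj : Pr adj = N1%:E.
  rewrite -(fineK (fin_num_measure Pr _ madj)); congr (_%:E).
  pose I1 (x : {ffun 'I_m -> lgraph n}) : R := [exists k, edge i j (x k)]%:R.
  transitivity (\int[Pr]_w I1 (graphs w)).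
    transitivity (\int[Pr]_w (\1_adj w : R)).
      by rewrite /Rintegral integral_indic // setIT.
    apply: eq_Rintegral => w _; rewrite indicE adjE /I1; congr (nat_of_bool _)%:R.
    by apply/idP/idP; rewrite in_setE.
  rewrite (integral_finite_valued Pr I1 measurable_graphs).
  by apply: eq_bigr => x _; rewrite graphs_law mulr1.
(* The last argument [Pr] is the value taken by the normalisation when the mass is degenerate, which
   [N1_gt0] excludes. *)
pose P' : probability Omega R := mnormalize (mrestr Pr madj) Pr.
have P'E U : P' U = (Pr (U `&` adj) * (N1^-1)%:E)%E.
  rewrite /P' /= /mnormalize /= /mrestr setTI Padj /=.
  by rewrite gt_eqF ?lte_fin.
have mX : measurable_fun setT (dd \o graphs).
  by move=> _ B _; rewrite setTI; exact: (mgraphs (dd @^-1` B)).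
pose X : {mfun Omega >-> (nat * nat)%type} :=
  HB.pack (dd \o graphs) (isMeasurableFun.Build _ _ _ _ _ mX).
exists (distribution P' X); split.
  apply/funext => S; rewrite /bidegree_law.
  transitivity (P' ((dd \o graphs) @^-1` S)); last by [].
  have -> : [set w | S (deg ZZ w i, deg ZZ w j) /\ Defs.adjacent ZZ w i j]
      = (dd \o graphs) @^-1` S `&` adj.
    by apply/seteqP; split => w; rewrite /= /dd /= /ldeg -superposition_graphs.
  rewrite P'E (_ : Pr [set w | Defs.adjacent ZZ w i j] = N1%:E) // EFinM /=.
  by rewrite fineK // fin_num_measure //; apply: measurableI => //; exact: (mgraphs (dd @^-1` S)).
move=> h; have ih : P'.-integrable setT (EFin \o (h \o X)).
  apply: measurable_bounded_integrable => //.
  - exact: (le_lt_trans (probability_le1 P' measurableT) (ltry _)).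
  - by apply: (measurableT_comp (f := h)) => //; exact: measurable_fun_nat2.
  - exists (\sum_x `|h (dd x)|); split; first exact: num_real.
    move=> M /ltW hM w _ /=; rewrite (le_trans _ hM) //.
    by rewrite (bigD1 (graphs w)) //= lerDl sumr_ge0.
split.
  by apply: integrable_pushforward => //; exact: measurable_fun_nat2.
rewrite /Rintegral integral_pushforward //; last exact: measurable_fun_nat2.
rewrite -[LHS]/(\int[P']_w (h \o dd) (graphs w)).
rewrite (integral_finite_valued P' (h \o dd) measurable_graphs).
rewrite big_distrl; apply: eq_bigr => x _ /=.
rewrite P'E Ex; case: ifP => ex; last by rewrite measure0 mul0e /= !(mul0r, mulr0).
by rewrite graphs_law /= mul1r; ring.
Qed.

End finite_model.

(** Two uses of [1 + x <= expR x], at [u - 1] and at [u^-1 - 1], enclose [u] between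
    [expR (- ((1 - u) / u))] and [expR (- (1 - u))]; the powers of both bounds have the same
    limit. *)
Lemma cvg_expr_expR (R : realType) (u : nat -> R) (k : nat -> nat) (c : R) :
  (forall n, 0 < u n <= 1) -> u n @[n --> \oo] --> (1 : R) ->
  (k n)%:R * (1 - u n) @[n --> \oo] --> c ->
  u n ^+ k n @[n --> \oo] --> expR (- c).
Proof.
move=> u01 cu ck.
have ce (a : nat -> R) l : a n @[n --> \oo] --> l -> expR (a n) @[n --> \oo] --> expR l.
  by move=> ca; apply: continuous_cvg => //; exact: continuous_expR.
have ca : expR (- ((k n)%:R * ((1 - u n) / u n))) @[n --> \oo] --> expR (- c).
  apply: ce; apply: cvgN; under eq_fun do rewrite mulrA.
  have : (k n)%:R * (1 - u n) * (u n)^-1 @[n --> \oo] --> c * 1^-1.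
    by apply: cvgM => //; apply: cvgV => //; exact: oner_neq0.
  by rewrite invr1 mulr1.
have cb : expR (- ((k n)%:R * (1 - u n))) @[n --> \oo] --> expR (- c).
  by apply: ce; apply: cvgN.
apply: (squeeze_cvgr _ ca cb); near=> n; have /andP[u0 u1] := u01 n.
have u0' := ltW u0.
rewrite -(mulrN _ ((1 - u n) / u n)) -(mulrN _ (1 - u n)) !expRM_natl; apply/andP; split.
  rewrite lerXn2r ?nnegrE ?expR_ge0 //.
  rewrite expRN -[leRHS]invrK lef_pV2 ?posrE ?expR_gt0 ?invr_gt0 //.
  rewrite (le_trans _ (expR_ge1Dx _)) //.
  by rewrite mulrBl mul1r divff ?gt_eqF // addrC subrK.
rewrite lerXn2r ?nnegrE ?expR_ge0 //.
by rewrite (le_trans _ (expR_ge1Dx _)) // opprB addrC subrK.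
Unshelve. all: by end_near. Qed.

(** * Convergence of the generating functions *)

Section layer_moment.
Variable R : realType.
Local Notation S0 := (@layer_space R).

Definition layer_moment r q (z : nat * R) : R := (z.1 ^_ r)%:R * z.2 ^+ q.

Lemma layer_moment_continuous r q : strength_continuous (layer_moment r q).
Proof.
move=> x; rewrite /layer_moment /= => y; apply: cvgM; first exact: cvg_cst.
exact: (@continuous_expr _ _ q (fun y => @cvg_id _ _)).
Qed.

Lemma layer_moment_ge0 r q z : S0 z -> 0 <= layer_moment r q z.
Proof. by move=> /andP[y0 _]; rewrite mulr_ge0 ?exprn_ge0. Qed.

Lemma layer_moment_bounded r q : size_bounded (layer_moment r q).
Proof.
move=> K; exists (\sum_(x < K.+1) (x ^_ r)%:R) => z Sz zK.
rewrite ger0_norm ?layer_moment_ge0 //; have /andP[y0 y1] := Sz.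
rewrite (le_trans (y := (z.1 ^_ r)%:R)) ?ler_piMr ?exprn_ile1 //.
by rewrite (bigD1 (Ordinal (zK : (z.1 < K.+1)%N))) //= lerDl sumr_ge0.
Qed.

End layer_moment.

Section gf_limit.
Variables (R : realType) (m : nat -> nat) (mu : R).
Variables (Pn : nat -> probability (nat * R)%type R) (P : probability (nat * R)%type R).
Variables (d : nat -> measure_display) (Omega : forall n, measurableType (d n)).
Variables (Pr : forall n, probability (Omega n) R).
Variables (Z : forall n, 'I_(m n) -> {RV (Pr n) >-> (lgraph n.+2 * (nat * R))%type}).
Hypothesis model : forall n, layer_model (Pn n) (@Z n).
Hypothesis cm : ((m n)%:R / n.+2%:R : R) @[n --> \oo] --> mu.
Hypothesis mu0 : 0 < mu.
Hypothesis wPn : weak_cvg_layer (fun n => Pn n) P.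
Hypothesis c10 : cross_moment (Pn n) 1 0 @[n --> \oo] --> cross_moment P 1 0.
Hypothesis c21 : cross_moment (Pn n) 2 1 @[n --> \oo] --> cross_moment P 2 1.
Hypotheses (P10 : (0 < cross_moment P 1 0 < +oo)%E) (P21 : (0 < cross_moment P 2 1 < +oo)%E).
Local Notation S0 := (@layer_space R).
Let p10 := fine (cross_moment P 1 0).
Let p21 := fine (cross_moment P 2 1).
Let v1 n := node1 n.
Let v2 n := node2 n.

Let ex n (h : lgraph n.+2 -> R) := layer_expectation (Pn n) h.

Let near_psi10 : \forall n \near \oo, (Pn n).-integrable S0 (EFin \o layer_moment 1 0).
Proof.
apply: (layer_near_integrable (P := P)) => //.
- exact: layer_moment_continuous.
- exact: layer_moment_ge0.
- by case/andP: P10.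
Qed.

Let near_psi21 : \forall n \near \oo, (Pn n).-integrable S0 (EFin \o layer_moment 2 1).
Proof.
apply: (layer_near_integrable (P := P)) => //.
- exact: layer_moment_continuous.
- exact: layer_moment_ge0.
- by case/andP: P21.
Qed.

Let dominated_near r q (f : nat -> nat * R -> R) :
  (\forall n \near \oo, (Pn n).-integrable S0 (EFin \o layer_moment r q)) ->
  (forall n, strength_continuous (f n)) -> (forall n z, S0 z -> `|f n z| <= layer_moment r q z) ->
  \forall n \near \oo, (Pn n).-integrable S0 (EFin \o f n).
Proof.
move=> near_psi cf fpsi; near=> n.
apply: (@dominated_integrable _ _ _ _ (layer_moment r q)).
- exact: measurable_layer_space.
- exact: layer_moment_ge0.
- exact: strength_continuous_measurable.
- exact: fpsi.
- by near: n.
Unshelve. all: by end_near. Qed.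

Let cvg10 f : strength_continuous f -> (forall z, S0 z -> `|f z| <= layer_moment 1 0 z) ->
  \int[Pn n]_(z in S0) f z @[n --> \oo] --> \int[P]_(z in S0) f z.
Proof.
apply: layer_cvg => //; [exact: layer_moment_continuous|exact: layer_moment_bounded|exact: layer_moment_ge0|].
by case/andP: P10.
Qed.

Let cvg21 f : strength_continuous f -> (forall z, S0 z -> `|f z| <= layer_moment 2 1 z) ->
  \int[Pn n]_(z in S0) f z @[n --> \oo] --> \int[P]_(z in S0) f z.
Proof.
apply: layer_cvg => //; [exact: layer_moment_continuous|exact: layer_moment_bounded|exact: layer_moment_ge0|].
by case/andP: P21.
Qed.

Lemma cvg_inv_nat : (n.+2%:R : R)^-1 @[n --> \oo] --> 0.
Proof.
have := @cvg_harmonic R; rewrite -(cvg_shiftn 1); apply: cvg_trans.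
by apply: near_eq_cvg; near=> n; rewrite /= /harmonic /= addn1.
Unshelve. all: by end_near. Qed.

(** Here [Pn n] belongs to graphs on [n.+2] nodes. Of the denominator [n.+2 * n.+1] in the link
    probability the normalisation cancels [n.+2], and [n.+1] remains under the number of layers. *)
Lemma cvg_layers_pred : ((m n)%:R / n.+1%:R : R) @[n --> \oo] --> mu.
Proof.
have : (m n)%:R / n.+2%:R * (1 + n.+1%:R^-1) @[n --> \oo] --> mu * (1 + 0).
  apply: cvgM => //; apply: cvgD; first exact: cvg_cst.
  exact: cvg_harmonic.
rewrite addr0 mulr1; apply: cvg_trans; apply: near_eq_cvg; near=> n.
rewrite -[n.+2%:R]natr1; field.
by have n0 := ler0n R n; apply/andP; split; apply: lt0r_neq0; lra.
Unshelve. all: by end_near. Qed.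

Lemma mean_edge_limit (s t : R) : 0 <= s <= 1 -> 0 <= t <= 1 ->
  n.+2%:R * (m n)%:R * ex (fun g : lgraph n.+2 => (edge (v1 n) (v2 n) g)%:R
     * (s ^+ gdeg (v1 n) g * t ^+ gdeg (v2 n) g)) @[n --> \oo]
  --> mu * (s * t * \int[P]_(z in S0) size2_gf s t z).
Proof.
move=> s01 t01.
have bound z : S0 z -> `|size2_gf s t z| <= layer_moment 2 1 z.
  move=> Sz; have /andP[a b] := size2_gf_bound s01 t01 Sz.
  by rewrite ger0_norm // /layer_moment expr1.
have near_i : \forall n \near \oo, (Pn n).-integrable S0 (EFin \o size2_gf s t).
  apply: (dominated_near (f := fun=> size2_gf s t) near_psi21) => // n.
  exact: (@size2_gf_continuous _ s t).
have : (m n)%:R / n.+1%:R * (s * t * \int[Pn n]_(z in S0) size2_gf s t z) @[n --> \oo]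
  --> mu * (s * t * \int[P]_(z in S0) size2_gf s t z).
  apply: cvgM; first exact: cvg_layers_pred.
  apply: cvgM; first exact: cvg_cst.
  by apply: cvg21 => //; exact: (@size2_gf_continuous _ s t).
apply: cvg_trans; apply: near_eq_cvg; near=> n.
rewrite /ex (layer_expectation_ext (model n)
   (f := fun z => size2_gf s t z * (s * t / (n.+2 ^_ 2)%:R))); last 2 first.
- apply: strength_continuous_measurable => x y; apply: cvgM; last exact: cvg_cst.
  exact: (@size2_gf_continuous _ s t).
- by move=> z zn Sz; rewrite kernel_mean_edge_gf // /size2_gf; ring.
rewrite RintegralZr //; last 2 first.
- exact: measurable_layer_space.
- by near: n.
rewrite ffactnS ffactn1 natrM /=; field.
by have n0 := ler0n R n; apply/andP; split; apply: lt0r_neq0; lra.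
Unshelve. all: by end_near. Qed.

(** The integrand of [a(s)]. Divided by the number of nodes, it is one minus the generating function
    of the degree of one node in a layer of size and strength [z]. *)
Definition vertex_defect (s : R) (z : nat * R) : R :=
  z.1%:R * (1 - (1 - z.2 + z.2 * s) ^+ z.1.-1).

Lemma vertex_defect_continuous s : strength_continuous (vertex_defect s).
Proof.
move=> x; rewrite /vertex_defect /= => y; apply: cvgM; first exact: cvg_cst.
apply: cvgB; first exact: cvg_cst.
exact: (@continuous_expr _ _ x.-1 (@affine_continuous _ s)).
Qed.

Lemma vertex_defect_bound s z : 0 <= s <= 1 -> S0 z -> `|vertex_defect s z| <= layer_moment 1 0 z.
Proof.
move=> s01 Sz; have /andP[q0 q1] := affine01 s01 Sz.
have q01 : 0 <= (1 - z.2 + z.2 * s) ^+ z.1.-1 <= 1 by rewrite exprn_ge0 ?exprn_ile1.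
rewrite /vertex_defect /layer_moment ffactn1 expr0 mulr1 normrM normr_nat ler_piMr //.
by rewrite ler_norml; lra.
Qed.

(** The interaction of the two nodes in one layer, scaled by the number of nodes. The indicator
    keeps admissible sizes, so that the bounds below hold at every [z] with strength in the unit
    interval. *)
Let both n (s t : R) (z : nat * R) : R := (z.1 <= n.+2)%N%:R * (n.+2%:R *
  kernel_mean (fun g : lgraph n.+2 => (1 - s ^+ gdeg (v1 n) g) * (1 - t ^+ gdeg (v2 n) g)) z).

Let v12 n : v1 n != v2 n. Proof. by []. Qed.

Let both_bound n s t z : 0 <= s <= 1 -> 0 <= t <= 1 -> S0 z ->
  (z.1 <= n.+2)%N -> 0 <= both n s t z <= (z.1 ^_ 2)%:R / n.+1%:R.
Proof.
move=> s01 t01 Sz zn; rewrite /both zn mul1r.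
have /andP[a b] := kernel_mean_both zn (v12 n) Sz s01 t01.
rewrite mulr_ge0 //= -ler_pdivlMl // (le_trans b) // (ffactnS n.+2) ffactn1 natrM /=.
by rewrite invfM mulrCA.
Qed.

(** From [1 - a b = (1 - a) + (1 - b) - (1 - a) (1 - b)]. After scaling, the product term is at most
    [(x)_2 / n.+1]. No moment of order 20 is at hand, but [x <= n.+2] bounds this by [x], the
    integrand of P_10, and for each size it is O(1/n). *)
Lemma vertex_mean_limit (s t : R) : 0 <= s <= 1 -> 0 <= t <= 1 ->
  n.+2%:R * (1 - ex (fun g : lgraph n.+2 => s ^+ gdeg (v1 n) g * t ^+ gdeg (v2 n) g))
    @[n --> \oo]
  --> (\int[P]_(z in S0) vertex_defect s z + \int[P]_(z in S0) vertex_defect t z).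
Proof.
move=> s01 t01.
have near_i r : 0 <= r <= 1 ->
    \forall n \near \oo, (Pn n).-integrable S0 (EFin \o vertex_defect r).
  move=> r01; apply: (dominated_near (f := fun=> vertex_defect r) near_psi10) => n.
    exact: (@vertex_defect_continuous r).
  by move=> z; exact: vertex_defect_bound.
have near_s := near_i _ s01; have near_t := near_i _ t01.
have both_c n : strength_continuous (both n s t).
  move=> x y; rewrite /both; apply: cvgM; first exact: cvg_cst.
  by apply: cvgM; [exact: cvg_cst|exact: (@kernel_mean_continuous)].
have both_le n z : S0 z -> `|both n s t z| <= (z.1 ^_ 2)%:R / n.+1%:R.
  move=> Sz; have [zn|zn] := leqP z.1 n.+2.
    by have /andP[a b] := both_bound s01 t01 Sz zn; rewrite ger0_norm.
  by rewrite /both leqNgt zn mul0r normr0 divr_ge0.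
have both_psi n z : S0 z -> `|both n s t z| <= layer_moment 1 0 z.
  move=> Sz; have [zn|zn] := leqP z.1 n.+2; last first.
    by rewrite /both leqNgt zn mul0r normr0 layer_moment_ge0.
  rewrite (le_trans (both_le n z Sz)) // ler_pdivrMr // /layer_moment ffactn1 expr0 mulr1.
  by rewrite -natrM ler_nat ffactnS ffactn1 leq_mul2l; apply/orP; right; lia.
have near_b := dominated_near near_psi10 both_c both_psi.
have cb : \int[Pn n]_(z in S0) both n s t z @[n --> \oo] --> 0.
  apply: (@layer_cvg0 R Pn P wPn (layer_moment 1 0) _ _ _ _ _ (fun n => both n s t) (fun x => (x ^_ 2)%:R)) => //.
  - exact: layer_moment_continuous.
  - exact: layer_moment_bounded.
  - exact: layer_moment_ge0.
  - by case/andP: P10.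
have : \int[Pn n]_(z in S0) vertex_defect s z + \int[Pn n]_(z in S0) vertex_defect t z
   - \int[Pn n]_(z in S0) both n s t z @[n --> \oo]
  --> \int[P]_(z in S0) vertex_defect s z + \int[P]_(z in S0) vertex_defect t z - 0.
  apply: cvgB => //; apply: cvgD; apply: cvg10.
  - exact: (@vertex_defect_continuous s).
  - by move=> z; exact: vertex_defect_bound.
  - exact: (@vertex_defect_continuous t).
  - by move=> z; exact: vertex_defect_bound.
rewrite subr0; apply: cvg_trans; apply: near_eq_cvg; near=> n.
have mS := @measurable_layer_space R.
have i_s : (Pn n).-integrable S0 (EFin \o vertex_defect s) by near: n.
have i_t : (Pn n).-integrable S0 (EFin \o vertex_defect t) by near: n.
have i_b : (Pn n).-integrable S0 (EFin \o both n s t) by near: n.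
have i_st : (Pn n).-integrable S0 (EFin \o (fun z => vertex_defect s z + vertex_defect t z)).
  exact: (integrableD mS i_s i_t).
have i_stb : (Pn n).-integrable S0
    (EFin \o (fun z => vertex_defect s z + vertex_defect t z - both n s t z)).
  exact: (integrableB mS i_st i_b).
rewrite -RintegralD // -RintegralB //.
have -> : 1 - ex (fun g : lgraph n.+2 => s ^+ gdeg (v1 n) g * t ^+ gdeg (v2 n) g)
    = ex (fun g : lgraph n.+2 => 1 - s ^+ gdeg (v1 n) g * t ^+ gdeg (v2 n) g).
  rewrite -{1}(layer_pmf_sum1 (model n)) /ex /layer_expectation -sumrB.
  by apply: eq_bigr => g _; rewrite mulrBr mulr1.
rewrite /ex (layer_expectation_ext (model n)
  (f := fun z => (vertex_defect s z + vertex_defect t z - both n s t z) * n.+2%:R^-1)).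
- by rewrite RintegralZr // mulrCA divff ?mulr1 // pnatr_eq0.
- apply: strength_continuous_measurable => x y; apply: cvgM; last exact: cvg_cst.
  apply: cvgB; last exact: both_c.
  by apply: cvgD; [exact: (@vertex_defect_continuous s)|exact: (@vertex_defect_continuous t)].
move=> z zn Sz; rewrite /both zn mul1r.
have K1 := @kernel_mean1 R _ _ zn; have Ks := kernel_mean_gf zn (v1 n) s.
have Kt := kernel_mean_gf zn (v2 n) t.
have -> : kernel_mean (fun g : lgraph n.+2 => 1 - s ^+ gdeg (v1 n) g * t ^+ gdeg (v2 n) g) z
   = (kernel_mean (fun _ : lgraph n.+2 => 1) z - kernel_mean (fun g : lgraph n.+2 => s ^+ gdeg (v1 n) g) z)
   + (kernel_mean (fun _ : lgraph n.+2 => 1) z - kernel_mean (fun g : lgraph n.+2 => t ^+ gdeg (v2 n) g) z)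
   - kernel_mean (fun g : lgraph n.+2 => (1 - s ^+ gdeg (v1 n) g) * (1 - t ^+ gdeg (v2 n) g)) z.
  rewrite /kernel_mean -!sumrB -big_split -sumrB; apply: eq_bigr => g _ /=.
  by move: (layer_kernel g z) (s ^+ _) (t ^+ _) => a b c; ring.
rewrite K1 Ks Kt /vertex_defect.
move: (kernel_mean _ z) (1 - _ ^+ _) (1 - _ ^+ _) => k a b.
by field; have n0 := ler0n R n; apply: lt0r_neq0; lra.
Unshelve. all: by end_near. Qed.

Let U n (s t : R) := ex (fun g : lgraph n.+2 => s ^+ gdeg (v1 n) g * t ^+ gdeg (v2 n) g).

Lemma gdeg_le n (i : 'I_n) (g : lgraph n) : (gdeg i g <= n)%N.
Proof. by rewrite /gdeg /ldeg -[leqRHS]card_ord max_card. Qed.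

(** Positivity is needed for the exponential bounds on the power; it holds because a degree is at
    most the number of nodes and [s], [t] are positive. *)
Let U01 n s t : 0 < s <= 1 -> 0 < t <= 1 -> 0 < U n s t <= 1.
Proof.
move=> /andP[s0 s1] /andP[t0 t1]; have w0 := @layer_pmf_ge0 R n.+2 (Pn n).
have s0' := ltW s0; have t0' := ltW t0.
apply/andP; split.
  apply: (@lt_le_trans _ _ (s ^+ n.+2 * t ^+ n.+2)); first by rewrite mulr_gt0 ?exprn_gt0.
  rewrite -[leLHS]mul1r -(layer_pmf_sum1 (model n)) big_distrl; apply: ler_sum => g _.
  by rewrite ler_wpM2l // ler_pM ?exprn_ge0 // ler_wiXn2l // gdeg_le.
rewrite -(layer_pmf_sum1 (model n)); apply: ler_sum => g _.
by rewrite ler_piMr // mulr_ile1 ?exprn_ge0 ?exprn_ile1.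
Qed.

Let cvg_layers_pred' : ((m n).-1%:R / n.+2%:R : R) @[n --> \oo] --> mu.
Proof.
have : (m n)%:R / n.+2%:R - n.+2%:R^-1 @[n --> \oo] --> mu - 0.
  by apply: cvgB => //; exact: cvg_inv_nat.
rewrite subr0; apply: cvg_trans; apply: near_eq_cvg; near=> n.
have m0 : (0 < m n)%N.
  have : 0 < (m n)%:R / n.+2%:R :> R by near: n; apply: (cvgr_gt _ cm).
  by rewrite pmulr_lgt0 ?invr_gt0 // ltr0n.
by rewrite -[in (m n)%:R](prednK m0) -natr1 mulrDl mul1r addrK.
Unshelve. all: by end_near. Qed.

Lemma vertex_power_limit (s t : R) : 0 < s <= 1 -> 0 < t <= 1 ->
  U n s t ^+ (m n).-1 @[n --> \oo]
  --> expR (- (mu * (\int[P]_(z in S0) vertex_defect s z + \int[P]_(z in S0) vertex_defect t z))).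
Proof.
move=> s01 t01; have s01' : 0 <= s <= 1 by case/andP: s01 => /ltW -> ->.
have t01' : 0 <= t <= 1 by case/andP: t01 => /ltW -> ->.
set D := _ + _; have cU := vertex_mean_limit s01' t01'.
have cNU : n.+2%:R^-1 * (n.+2%:R * (1 - U n s t)) @[n --> \oo] --> 0 * D.
  by apply: cvgM => //; exact: cvg_inv_nat.
apply: cvg_expr_expR.
- by move=> n; exact: U01.
- have : 1 - n.+2%:R^-1 * (n.+2%:R * (1 - U n s t)) @[n --> \oo] --> 1 - 0 * D.
    by apply: cvgB => //; exact: cvg_cst.
  rewrite mul0r subr0; apply: cvg_trans; apply: near_eq_cvg; near=> n.
  by rewrite mulKf ?pnatr_eq0 // opprB addrC subrK.
- have : (m n).-1%:R / n.+2%:R * (n.+2%:R * (1 - U n s t)) @[n --> \oo] --> mu * D.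
    exact: cvgM.
  apply: cvg_trans; apply: near_eq_cvg; near=> n.
  by rewrite mulrA divfK ?pnatr_eq0.
Unshelve. all: by end_near. Qed.

Let edge_deg n (z : nat * R) : R := (z.1 <= n.+2)%N%:R *
  ((z.1 ^_ 2)%:R * z.2 * (1 + (z.1 - 2)%N%:R * z.2) * n.+2%:R^-1).

(** The hypotheses of (i) do not control the term [(x)_3 y^2] of this mean. For [x <= n.+2],
    however, [1 + (x - 2) y] is at most [n.+2], so the integrand [edge_deg] is dominated by that of
    P_21, while it is O(1/n) for each size. *)
Lemma edge_degree_limit (i j : forall n, 'I_n.+2) : (forall n, i n != j n) ->
  (m n)%:R * ex (fun g : lgraph n.+2 => (edge (i n) (j n) g)%:R * (gdeg (i n) g)%:R)
    @[n --> \oo] --> 0.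
Proof.
move=> ij; have cf n : strength_continuous (edge_deg n).
  move=> x; rewrite /edge_deg /= => y; apply: cvgM; first exact: cvg_cst.
  apply: cvgM; last exact: cvg_cst.
  apply: cvgM; first by apply: cvgM; [exact: cvg_cst|exact: cvg_id].
  by apply: cvgD; [exact: cvg_cst|apply: cvgM; [exact: cvg_cst|exact: cvg_id]].
have f0 n z : S0 z -> 0 <= edge_deg n z.
  by move=> /andP[y0 y1]; rewrite /edge_deg !mulr_ge0 ?addr_ge0 ?mulr_ge0 ?invr_ge0.
have fpsi n z : S0 z -> `|edge_deg n z| <= layer_moment 2 1 z.
  move=> Sz; rewrite ger0_norm ?f0 //; have /andP[y0 y1] := Sz.
  have [zn|zn] := leqP z.1 n.+2; last by rewrite /edge_deg leqNgt zn mul0r layer_moment_ge0.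
  rewrite /edge_deg zn mul1r /layer_moment expr1 -mulrA ler_piMr ?mulr_ge0 // ler_pdivrMr // mul1r.
  apply: (@le_trans _ _ (1 + (z.1 - 2)%N%:R)).
    by rewrite lerD2l ler_piMr.
  by rewrite nat1r ler_nat; lia.
have fc n z : S0 z -> `|edge_deg n z| <= (z.1 ^_ 2 * z.1.+1)%N%:R / n.+1%:R.
  move=> Sz; rewrite ger0_norm ?f0 //; have /andP[y0 y1] := Sz.
  have [zn|zn] := leqP z.1 n.+2; last by rewrite /edge_deg leqNgt zn mul0r divr_ge0.
  have h1 : (z.1 ^_ 2)%:R * z.2 <= (z.1 ^_ 2)%:R by rewrite ler_piMr.
  have h2 : 1 + (z.1 - 2)%N%:R * z.2 <= z.1.+1%:R.
    rewrite (@le_trans _ _ (1 + (z.1 - 2)%N%:R)) ?lerD2l ?ler_piMr //.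
    by rewrite nat1r ler_nat; lia.
  have h3 : 0 <= 1 + (z.1 - 2)%N%:R * z.2 by rewrite addr_ge0 ?mulr_ge0.
  have h4 : n.+2%:R^-1 <= n.+1%:R^-1 :> R by rewrite lef_pV2 ?posrE // ler_nat.
  have h5 : 0 <= (z.1 ^_ 2)%:R * z.2 by rewrite mulr_ge0.
  rewrite /edge_deg zn mul1r natrM; apply: ler_pM => //.
  - exact: mulr_ge0.
  - exact: ler_pM.
have cE : \int[Pn n]_(z in S0) edge_deg n z @[n --> \oo] --> 0.
  apply: (@layer_cvg0 R Pn P wPn (layer_moment 2 1) _ _ _ _ _ edge_deg (fun x => (x ^_ 2 * x.+1)%N%:R)) => //.
  - exact: layer_moment_continuous.
  - exact: layer_moment_bounded.
  - exact: layer_moment_ge0.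
  - by case/andP: P21.
have near_f := dominated_near near_psi21 cf fpsi.
have : (m n)%:R / n.+1%:R * \int[Pn n]_(z in S0) edge_deg n z @[n --> \oo] --> mu * 0.
  by apply: cvgM => //; exact: cvg_layers_pred.
rewrite mulr0; apply: cvg_trans; apply: near_eq_cvg; near=> n.
rewrite /ex (layer_expectation_ext (model n) (f := fun z => edge_deg n z * n.+1%:R^-1)).
- rewrite RintegralZr //; last 2 first.
  + exact: measurable_layer_space.
  + by near: n.
  by rewrite mulrCA mulrC.
- apply: strength_continuous_measurable => x y; apply: cvgM; last exact: cvg_cst.
  exact: cf.
move=> z zn Sz; rewrite kernel_mean_edge_deg // /edge_deg zn mul1r.
by rewrite (ffactnS n.+2) ffactn1 natrM invfM !mulrA.
Unshelve. all: by end_near. Qed.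

Let p n := ex (fun g : lgraph n.+2 => (edge (v1 n) (v2 n) g)%:R : R).

Lemma mean_edge_exchangeable n (i j : 'I_n.+2) : i != j ->
  ex (fun g : lgraph n.+2 => (edge i j g)%:R : R) = p n.
Proof.
move=> ij; pose f (z : nat * R) := (z.1 ^_ 2)%:R * z.2 / (n.+2 ^_ 2)%:R.
have mf : measurable_fun S0 f.
  apply: strength_continuous_measurable => x y; rewrite /f /=.
  apply: cvgM; last exact: cvg_cst.
  by apply: cvgM; [exact: cvg_cst|exact: cvg_id].
have E (a b : 'I_n.+2) : a != b ->
    ex (fun g : lgraph n.+2 => (edge a b g)%:R : R) = \int[Pn n]_(z in S0) f z.
  by move=> ab; apply: (layer_expectation_ext (model n)) => // z zn _; exact: kernel_mean_edge.
by rewrite /p !E.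
Qed.

Lemma mean_edge_asymptotic : n.+2%:R * (m n)%:R * p n @[n --> \oo] --> mu * p21.
Proof.
have := mean_edge_limit (s := 1) (t := 1).
rewrite ler01 lexx => /(_ isT isT); rewrite !mul1r => H.
have -> : p21 = \int[P]_(z in S0) size2_gf 1 1 z.
  rewrite /p21 /cross_moment /Rintegral; congr fine; apply: eq_integral => z _.
  by rewrite /size2_gf !mulr1 subrK !expr1n !mulr1 expr1.
apply: cvg_trans H; apply: near_eq_cvg; near=> n.
congr (_ * _); apply: eq_bigr => g _.
by rewrite !expr1n !mulr1.
Unshelve. all: by end_near. Qed.

Let err n : R := ((m n)%:R * p n) ^+ 2 + \sum_(u <- [:: v1 n; v2 n])
  (n.+2%:R * ((m n)%:R * p n) ^+ 3 + 2 * (m n)%:R * ((m n)%:R * p n)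
    * ex (fun g : lgraph n.+2 => (edge (v1 n) (v2 n) g)%:R * (gdeg u g)%:R)).

(** With [A] the convergent sequence [n.+2 * m * p], the product [m * p] is [A / n.+2]. The
    quadratic and cubic terms become [A^2 / n.+2] and [A^3 / n.+2], and the last ones are [2 A]
    times a null sequence. *)
Lemma gf_error_limit : n.+2%:R * err n @[n --> \oo] --> 0.
Proof.
have cA := mean_edge_asymptotic.
have c1 := edge_degree_limit (i := v1) (j := v2) v12.
have c2 := edge_degree_limit (i := v2) (j := v1) (fun n => isT).
set A := fun n => _ * _ * p n in cA.
set a1 := fun n => _ in c1; set a2 := fun n => _ in c2.
have : A n * A n * n.+2%:R^-1 + (A n * A n * A n * n.+2%:R^-1 + 2 * A n * a1 n
   + (A n * A n * A n * n.+2%:R^-1 + 2 * A n * a2 n)) @[n --> \oo]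
   --> mu * p21 * (mu * p21) * 0 + (mu * p21 * (mu * p21) * (mu * p21) * 0 + 2 * (mu * p21) * 0
   + (mu * p21 * (mu * p21) * (mu * p21) * 0 + 2 * (mu * p21) * 0)).
  have ci := cvg_inv_nat.
  have cAA : A n * A n @[n --> \oo] --> mu * p21 * (mu * p21) by apply: cvgM.
  have cAAA : A n * A n * A n * n.+2%:R^-1 @[n --> \oo] --> mu * p21 * (mu * p21) * (mu * p21) * 0.
    by apply: cvgM => //; apply: cvgM.
  have c2A : 2 * A n @[n --> \oo] --> 2 * (mu * p21) by apply: cvgM => //; exact: cvg_cst.
  by apply: cvgD; [apply: cvgM|apply: cvgD; apply: cvgD => //; apply: cvgM].
rewrite !mulr0 !addr0; apply: cvg_trans; apply: near_eq_cvg; near=> n.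
rewrite /err big_cons big_seq1 /a1 /a2 /A.
have -> : ex (fun g : lgraph n.+2 => (edge (v2 n) (v1 n) g)%:R * (gdeg (v2 n) g)%:R)
  = ex (fun g : lgraph n.+2 => (edge (v1 n) (v2 n) g)%:R * (gdeg (v2 n) g)%:R).
  by apply: eq_bigr => g _; rewrite /edge finset.setUC.
move: (m n)%:R (p n) (ex _) (ex _) => M q a b; have n0 : n.+2%:R != 0 :> R by [].
by move: n.+2%:R n0 => N n0; field.
Unshelve. all: by end_near. Qed.

Let bs n := @bidegree_sum R n.+2 (m n) (Pn n) (v1 n) (v2 n).

Let limit s t := mu * (s * t * \int[P]_(z in S0) size2_gf s t z)
  * expR (- (mu * (\int[P]_(z in S0) vertex_defect s z + \int[P]_(z in S0) vertex_defect t z))).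

(** The value 1 is allowed for [s] and [t]: it gives the asymptotic probability of adjacency, the
    denominator of the conditional law. *)
Lemma bidegree_gf_limit (s t : R) : 0 < s <= 1 -> 0 < t <= 1 ->
  n.+2%:R * bs n (fun z => s ^+ z.1 * t ^+ z.2) @[n --> \oo] --> limit s t.
Proof.
move=> s01 t01; have s01' : 0 <= s <= 1 by case/andP: s01 => /ltW -> ->.
have t01' : 0 <= t <= 1 by case/andP: t01 => /ltW -> ->.
set q := fun n => ex (fun g : lgraph n.+2 => (edge (v1 n) (v2 n) g)%:R
     * (s ^+ gdeg (v1 n) g * t ^+ gdeg (v2 n) g)).
have cmain : n.+2%:R * ((m n)%:R * (q n * U n s t ^+ (m n).-1)) @[n --> \oo] --> limit s t.
  have : n.+2%:R * (m n)%:R * q n * U n s t ^+ (m n).-1 @[n --> \oo] --> limit s t.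
    by apply: cvgM; [exact: mean_edge_limit|exact: vertex_power_limit].
  by under [X in X @ _ --> _ -> _]eq_fun do rewrite -!mulrA.
have cd : n.+2%:R * bs n (fun z => s ^+ z.1 * t ^+ z.2)
    - n.+2%:R * ((m n)%:R * (q n * U n s t ^+ (m n).-1)) @[n --> \oo] --> 0.
  apply/norm_cvg0P; apply: (squeeze_cvgr _ (cvg_cst 0) gf_error_limit); near=> n.
  rewrite normr_ge0 /= -mulrBr normrM normr_nat ler_wpM2l //.
  have w0 g := @layer_pmf_ge0 R n.+2 (Pn n) g.
  have p0 : 0 <= p n by apply: sumr_ge0 => g _; rewrite mulr_ge0.
  have := union_gf_error (m n) w0 (layer_pmf_sum1 (model n)) (@mean_edge_exchangeable n).
  by move=> /(_ p0 (v1 n) (v2 n) s t isT s01' t01').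
rewrite -[limit s t]add0r.
apply: cvg_trans (cvgD cd cmain); apply: near_eq_cvg; near=> n.
by rewrite /= subrK.
Unshelve. all: by end_near. Qed.

Let defect1 : \int[P]_(z in S0) vertex_defect 1 z = 0.
Proof.
rewrite -[RHS](Rintegral_cst0 P S0); apply: eq_Rintegral => z _.
by rewrite /vertex_defect mulr1 subrK expr1n subrr mulr0.
Qed.

Lemma bidegree_mass_limit : n.+2%:R * bs n (fun=> 1) @[n --> \oo] --> mu * p21.
Proof.
have := @bidegree_gf_limit 1 1; rewrite ltr01 lexx => /(_ isT isT).
rewrite /limit defect1 addr0 mulr0 oppr0 expR0 !mulr1 !mul1r.
have -> : \int[P]_(z in S0) size2_gf 1 1 z = p21.
  rewrite /p21 /cross_moment /Rintegral; congr fine; apply: eq_integral => z _.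
  by rewrite /size2_gf !mulr1 subrK !expr1n !mulr1 expr1.
apply: cvg_trans; apply: near_eq_cvg; near=> n.
congr (_ * _); apply: eq_iid_sum => x.
by rewrite !expr1n mulr1.
Unshelve. all: by end_near. Qed.

Let mup21 : 0 < mu * p21.
Proof. by rewrite mulr_gt0 // /p21 fine_gt0. Qed.

Lemma bidegree_mass_gt0 : \forall n \near \oo, 0 < bs n (fun=> 1).
Proof.
near=> n; have : 0 < n.+2%:R * bs n (fun=> 1).
  by near: n; apply: (cvgr_gt _ bidegree_mass_limit).
by rewrite pmulr_rgt0.
Unshelve. all: by end_near. Qed.

Lemma bidegree_ratio_limit (s t : R) : 0 < s <= 1 -> 0 < t <= 1 ->
  bs n (fun z => s ^+ z.1 * t ^+ z.2) / bs n (fun=> 1) @[n --> \oo] -->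
  s * t * (expR (mu * (\int[P]_(z in S0) size1_gf s z - p10))
         * expR (mu * (\int[P]_(z in S0) size1_gf t z - p10)))
      * ((\int[P]_(z in S0) size2_gf s t z) / p21).
Proof.
move=> s01 t01; have mS := @measurable_layer_space R.
have i1 : P.-integrable S0 (EFin \o (fun z : nat * R => z.1%:R : R)) := size1_integrable P10.
have defectE r : 0 < r <= 1 ->
    \int[P]_(z in S0) vertex_defect r z = p10 - \int[P]_(z in S0) size1_gf r z.
  move=> /andP[/ltW r0 r1]; have r01 : 0 <= r <= 1 by rewrite r0.
  have ir : P.-integrable S0 (EFin \o size1_gf r).
    apply: (@dominated_integrable _ _ _ _ (fun z : nat * R => z.1%:R)) => //.
    - by apply: strength_continuous_measurable; exact: (@size1_gf_continuous _ r).
    - move=> z Sz; have /andP[a b] := size1_gf_bound r01 Sz; by rewrite ger0_norm.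
  have -> : p10 = \int[P]_(z in S0) (z.1%:R : R).
    rewrite /p10 /cross_moment /Rintegral; congr fine; apply: eq_integral => z _.
    by rewrite ffactn1 expr0 mulr1.
  rewrite -RintegralB //; apply: eq_Rintegral => z _.
  by rewrite /vertex_defect /size1_gf mulrBr mulr1.
have : n.+2%:R * bs n (fun z => s ^+ z.1 * t ^+ z.2) * (n.+2%:R * bs n (fun=> 1))^-1
    @[n --> \oo] --> limit s t * (mu * p21)^-1.
  apply: cvgM; first exact: bidegree_gf_limit.
  by apply: cvgV; [exact: lt0r_neq0|exact: bidegree_mass_limit].
rewrite /limit !defectE // -expRD.
rewrite (_ : - (mu * _) = mu * (\int[P]_(z in S0) size1_gf s z - p10)
  + mu * (\int[P]_(z in S0) size1_gf t z - p10)); last by ring.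
have p210 : p21 != 0 by rewrite gt_eqF // /p21 fine_gt0.
have mu0' : mu != 0 by rewrite gt_eqF.
move: (expR _) => e; move: (Rintegral _ _ _) => g.
have -> : mu * (s * t * g) * e / (mu * p21) = s * t * e * (g / p21) by field; rewrite p210 mu0'.
apply: cvg_trans; apply: near_eq_cvg; near=> n.
rewrite /= invfM mulrACA divff ?mul1r //.
Unshelve. all: by end_near. Qed.

End gf_limit.

(** * Second moments *)

Section degree_tail.
Variables (n m : nat).
Implicit Types (x : {ffun 'I_m -> lgraph n}) (i j : 'I_n).

Lemma gdeg_le_vertices i (g : lgraph n) : (gdeg i g <= #|lgraph_vertices g|)%N.
Proof.
apply/subset_leq_card/fintype.subsetP => v; rewrite inE => /(fintype.subsetP (valP g)).
by rewrite pair_in_node_pairs => /and3P[].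
Qed.

(* One of [d], [S] is at least [D / 2 > K]; in the first case the layer has more
   than [K] vertices, in the second the cubic factorial moment of [S] gains a
   factor [K]. *)
Let square_tail_le (K d V S D : nat) : (1 < K)%N -> (d <= V)%N -> (D <= d + S)%N -> (2 * K < D)%N ->
  (K * D ^ 2 <= 8 * K * ((K < V) * d ^_ 2) + 20 * S ^_ 3)%N.
Proof.
(* If [S <= d] then [D <= 2 d] and [d^2 <= 2 (d)_2], whence 8. Otherwise [D <= 2 S] and
   [K S^2 <= 5 (S)_3], by [K <= S - 1] and [S <= 5 (S - 2)], whence 20. *)
move=> K1 dV DdS KD; have [Sd|dS] := leqP S d.
  have Kd : (K < d)%N by lia.
  rewrite (leq_trans Kd dV) mul1n (leq_trans _ (leq_addr _ _)) //.
  have DD : (D ^ 2 <= 4 * d ^ 2)%N by nia.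
  have dd : (d ^ 2 <= 2 * d ^_ 2)%N by rewrite ffactnS ffactn1; nia.
  nia.
rewrite (leq_trans _ (leq_addl _ _)) //.
have KS : (K < S)%N by lia.
have DD : (D ^ 2 <= 4 * S ^ 2)%N by nia.
have SS : (K * S ^ 2 <= 5 * S ^_ 3)%N.
  rewrite 2!ffactnS ffactn1; case: S KS {dS DdS DD} => [|[|S]] //= KS; nia.
nia.
Qed.

Lemma union_degree_tail_le (R : realFieldType) x i j K : (1 < K)%N ->
  [exists k, edge i j (x k)]%:R * ((2 * K < ldeg (union_edges x) i)%N%:R
      * (ldeg (union_edges x) i)%:R ^+ 2)
  <= \sum_k ((edge i j (x k))%:R * (8 * ((K < #|lgraph_vertices (x k)|)%N%:R * (gdeg i (x k) ^_ 2)%:R))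
     + 20 / K%:R * ((edge i j (x k))%:R * ((\sum_(l | l != k) gdeg i (x l)) ^_ 3)%:R)) :> R.
Proof.
move=> K1; pose F k : R := (edge i j (x k))%:R
       * (8 * ((K < #|lgraph_vertices (x k)|)%N%:R * (gdeg i (x k) ^_ 2)%:R))
     + 20 / K%:R * ((edge i j (x k))%:R * ((\sum_(l | l != k) gdeg i (x l)) ^_ 3)%:R).
rewrite -/(F _); have K0 : 0 < K%:R :> R by rewrite ltr0n; lia.
have F0 k : 0 <= F k.
  by apply: addr_ge0; rewrite !mulr_ge0 ?invr_ge0 ?(ltW K0).
case: existsP => [[k ek]|_]; last by rewrite mul0r sumr_ge0.
(* Any single linking layer [k] suffices; the terms of the other layers are nonnegative. *)
rewrite mul1r (bigD1 k) //= (le_trans (y := F k)) ?lerDl ?sumr_ge0 //.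
have [KD|_] := ltnP (2 * K) (ldeg (union_edges x) i); last by rewrite mul0r.
have DdS : (ldeg (union_edges x) i <= gdeg i (x k) + \sum_(l | l != k) gdeg i (x l))%N.
  by rewrite (leq_trans (ldeg_union_le x i)) // (bigD1 k).
have := square_tail_le K1 (gdeg_le_vertices i (x k)) DdS KD.
rewrite /F ek !mul1r -(ler_nat R) natrM natrX natrD (natrM _ (8 * K)) (natrM _ 8) (natrM _ 20) (natrM _ (K < _)%N).
move: (ldeg _ _)%:R (_ ^_ 2)%:R (_ ^_ 3)%:R (nat_of_bool _)%:R => D d S b H.
rewrite -(ler_pM2l K0) mulrDr mulrA [X in _ <= X + _](_ : _ = 8 * K%:R * (b * d)); last by ring.
rewrite [X in _ <= _ + X](_ : _ = 20 * S) //.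
by rewrite mulrA mulrCA divff ?gt_eqF // mulr1.
Qed.

(** The linking layer is independent of the others, so their third factorial moment factors out; the
    falling factorials of [m.-1] are then replaced by powers of [m], which pair with the [M r] into
    convergent products. *)
Lemma iid_degree_tail_le (R : realFieldType) (w : lgraph n -> R) i j K (M : nat -> R) : (1 < K)%N ->
  (forall g, 0 <= w g) -> \sum_g w g = 1 ->
  (forall r, M r = \sum_g w g * (gdeg i g ^_ r)%:R) ->
  iid_sum w (fun x : {ffun 'I_m -> lgraph n} => [exists k, edge i j (x k)]%:R
     * ((2 * K < ldeg (union_edges x) i)%N%:R * (ldeg (union_edges x) i)%:R ^+ 2))
  <= m%:R * (8 * \sum_g w g * ((K < #|lgraph_vertices g|)%N%:R * ((edge i j g)%:R * (gdeg i g ^_ 2)%:R))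
     + 20 / K%:R * ((\sum_g w g * (edge i j g)%:R)
         * ((m%:R * M 1%N) ^+ 3 + 3 * (m%:R * M 1%N) * (m%:R * M 2%N) + m%:R * M 3%N))).
Proof.
move=> K1 w0 w1 ME.
have M0 r : 0 <= M r by rewrite ME; apply: sumr_ge0 => g _; rewrite mulr_ge0.
have K0 : 0 < K%:R :> R by rewrite ltr0n; lia.
apply: (le_trans (le_iid_sum w0 (fun x => union_degree_tail_le R x i j K1))).
set B := 8 * _ + _; have -> : m%:R * B = \sum_(k < m) B.
  by rewrite sumr_const card_ord mulr_natl.
rewrite iid_sum_sum; apply: ler_sum => k _; rewrite /B.
rewrite iid_sumD; apply: lerD.
  rewrite (iid_sum1 w1 k (fun g => (edge i j g)%:R
    * (8 * ((K < #|lgraph_vertices g|)%N%:R * (gdeg i g ^_ 2)%:R)))).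
  rewrite mulr_sumr le_eqVlt; apply/orP; left; apply/eqP; apply: eq_bigr => g _.
  by ring.
rewrite iid_sumZ ler_wpM2l ?divr_ge0 // ?(ltW K0) //.
rewrite (iid_sum_ffact3 k (fun g => (edge i j g)%:R) (gdeg i) w1) -!ME.
rewrite ler_wpM2l //; first by rewrite sumr_ge0 // => g _; rewrite mulr_ge0.
have m1 : m.-1%:R <= m%:R :> R by rewrite ler_nat leq_pred.
have m2 : (m.-1 ^_ 2)%:R <= m%:R * m%:R :> R.
  by rewrite -natrM ler_nat ffactnS ffactn1; nia.
have m3 : (m.-1 ^_ 3)%:R <= m%:R ^+ 3 :> R.
  rewrite -natrX ler_nat 2!ffactnS ffactn1; case: (m) => [|[|[|k']]] //=; nia.
move: (M0 1%N) (M0 2%N) (M0 3%N) m1 m2 m3.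
move: (M 1%N) (M 2%N) (M 3%N) (m.-1%:R) (_ ^_ 2)%:R (_ ^_ 3)%:R (m%:R).
move=> A B' C a b c k' A0 B0 C0 ak bk ck.
apply: lerD; last by rewrite ler_wpM2r.
apply: lerD; first by rewrite exprMn ler_wpM2r ?exprn_ge0.
have -> : 3 * (k' * A) * (k' * B') = 3 * (k' * k' * A * B') by ring.
by rewrite -!(mulrA 3) ler_wpM2l // ler_wpM2r // ler_wpM2r.
Qed.

End degree_tail.

Section bidegree_tail.
Variables (R : realType) (m : nat -> nat) (mu : R).
Variables (Pn : nat -> probability (nat * R)%type R) (P : probability (nat * R)%type R).
Variables (d : nat -> measure_display) (Omega : forall n, measurableType (d n)).
Variables (Pr : forall n, probability (Omega n) R).
Variables (Z : forall n, 'I_(m n) -> {RV (Pr n) >-> (lgraph n.+2 * (nat * R))%type}).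
Hypothesis model : forall n, layer_model (Pn n) (@Z n).
Hypothesis cm : ((m n)%:R / n.+2%:R : R) @[n --> \oo] --> mu.
Hypothesis mu0 : 0 < mu.
Hypothesis wPn : weak_cvg_layer (fun n => Pn n) P.
Hypothesis c21 : cross_moment (Pn n) 2 1 @[n --> \oo] --> cross_moment P 2 1.
Hypothesis P21 : (0 < cross_moment P 2 1 < +oo)%E.
Hypothesis c32 : cross_moment (Pn n) 3 2 @[n --> \oo] --> cross_moment P 3 2.
Hypothesis c43 : cross_moment (Pn n) 4 3 @[n --> \oo] --> cross_moment P 4 3.
Hypotheses (P32 : (cross_moment P 3 2 < +oo)%E) (P43 : (cross_moment P 4 3 < +oo)%E).
Local Notation S0 := (@layer_space R).
Local Notation finite_moment r q := (cross_moment (Pn n) r q @[n --> \oo] --> cross_moment P r q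
  /\ (cross_moment P r q < +oo)%E).

Let mS := @measurable_layer_space R.

Let near_int r q : finite_moment r q ->
  \forall n \near \oo, (Pn n).-integrable S0 (EFin \o layer_moment r q).
Proof.
move=> [c f]; apply: (layer_near_integrable (P := P)) => //.
- exact: layer_moment_continuous.
- exact: layer_moment_ge0.
Qed.

Let moment_cvg r q : finite_moment r q ->
  \int[Pn n]_(z in S0) layer_moment r q z @[n --> \oo] --> \int[P]_(z in S0) layer_moment r q z.
Proof.
move=> [c f]; apply: (layer_cvg wPn (psi := layer_moment r q)) => //.
- exact: layer_moment_continuous.
- exact: layer_moment_bounded.
- exact: layer_moment_ge0.
- exact: layer_moment_continuous.
- by move=> z Sz; rewrite ger0_norm ?layer_moment_ge0.
Qed.

Let fm21 : finite_moment 2 1. Proof. by case/andP: P21. Qed.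
Let fm32 : finite_moment 3 2. Proof. by []. Qed.
Let fm43 : finite_moment 4 3. Proof. by []. Qed.

Let tail n K r q := \int[Pn n]_(z in S0 `\` size_le K) layer_moment r q z.

Let measurable_tail K : measurable (S0 `\` size_le K).
Proof. by apply: measurableD => //; exact: measurable_size_le. Qed.

(** Stated for all [K] beyond a threshold, so that a single [K] can serve both moments and a further
    lower bound. *)
Let tail_small r q eps : finite_moment r q -> 0 < eps ->
  exists K0, forall K, (K0 <= K)%N -> \forall n \near \oo, tail n K r q <= eps.
Proof.
move=> fm eps0.
have [K0 H] : exists K, \forall n \near \oo,
    (\int[Pn n]_(z in S0 `\` size_le K) (layer_moment r q z)%:E <= eps%:E)%E.
  apply: (layer_uniform_tails wPn _ _ _ fm.1 fm.2) => //.
  - exact: layer_moment_continuous.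
  - exact: layer_moment_bounded.
  - exact: layer_moment_ge0.
exists K0 => K K0K; have near_i := near_int fm; near=> n.
have i_n : (Pn n).-integrable S0 (EFin \o layer_moment r q) by near: n.
rewrite -lee_fin EFin_Rintegral //; last by apply: (integrableS mS) => // z [].
apply: (@le_trans _ _ (\int[Pn n]_(z in S0 `\` size_le K0) (layer_moment r q z)%:E)%E).
  apply: ge0_subset_integral => //.
  - apply/measurable_EFinP; apply: strength_continuous_measurable; exact: layer_moment_continuous.
  - by move=> z [Sz _]; rewrite lee_fin layer_moment_ge0.
  - by move=> z [Sz zK]; split => // zK0; apply: zK; exact: leq_trans K0K.
by near: n.
Unshelve. all: by end_near. Qed.

Variables i j : forall n, 'I_n.+2.
Hypothesis ij : forall n, i n != j n.

Let ex n (h : lgraph n.+2 -> R) := layer_expectation (Pn n) h.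
Let M n r := ex (fun g : lgraph n.+2 => (gdeg (i n) g ^_ r)%:R : R).

Let degree_moment_limit r : (0 < r)%N -> finite_moment r.+1 r ->
  (m n)%:R * M n r @[n --> \oo] --> mu * \int[P]_(z in S0) layer_moment r.+1 r z.
Proof.
move=> r0 fm; have := moment_cvg fm => /(cvgM cm).
have near_i := near_int fm; apply: cvg_trans; apply: near_eq_cvg; near=> n.
rewrite /M /ex (layer_expectation_ext (model n)
  (f := fun z => layer_moment r.+1 r z * n.+2%:R^-1)).
- by rewrite RintegralZr //; [rewrite mulrCA mulrC|near: n].
- apply: strength_continuous_measurable => x y; apply: cvgM; last exact: cvg_cst.
  exact: layer_moment_continuous.
- by move=> z zn Sz; rewrite kernel_mean_ffact.
Unshelve. all: by end_near. Qed.

Let large_layer K : \forall n \near \oo,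
  ex (fun g : lgraph n.+2 => (K < #|lgraph_vertices g|)%N%:R
     * ((edge (i n) (j n) g)%:R * (gdeg (i n) g ^_ 2)%:R))
  = (2 * tail n K 3 2 + tail n K 4 3) / (n.+2%:R * n.+1%:R).
Proof.
have i32 := near_int fm32; have i43 := near_int fm43; near=> n.
have j32 : (Pn n).-integrable S0 (EFin \o layer_moment 3 2) by near: n.
have j43 : (Pn n).-integrable S0 (EFin \o layer_moment 4 3) by near: n.
pose f (z : nat * R) := 2 * layer_moment 3 2 z + layer_moment 4 3 z.
have cf : strength_continuous f.
  move=> x y; apply: cvgD; last exact: layer_moment_continuous.
  by apply: cvgM; [exact: cvg_cst|exact: layer_moment_continuous].
rewrite /ex (layer_expectation_ext (model n)
  (f := fun z => (K < z.1)%N%:R * f z * (n.+2%:R * n.+1%:R)^-1)); last 2 first.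
- apply: strength_continuous_measurable => x y; apply: cvgM; last exact: cvg_cst.
  by apply: cvgM; [exact: cvg_cst|exact: cf].
- move=> z zn Sz; rewrite kernel_mean_edge_ffact2 // (ffactnS n.+2) ffactn1 natrM.
  by rewrite /f /layer_moment /=; ring.
have if' : (Pn n).-integrable S0 (EFin \o f).
  exact: (integrableD mS (integrableZl mS 2 j32) j43).
have inS g : (Pn n).-integrable S0 (EFin \o g) ->
    (Pn n).-integrable (S0 `\` size_le K) (EFin \o g).
  by move=> ig; apply: (integrableS mS) => // z [].
transitivity (\int[Pn n]_(z in S0 `\` size_le K) (f z * (n.+2%:R * n.+1%:R)^-1)).
  rewrite setDE Rintegral_mkcondr; apply: eq_Rintegral => z _.
  rewrite patchE /size_le; case: ifPn => [|]; rewrite ?notin_setE ?in_setE /=.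
    by move=> /negP; rewrite -ltnNge => ->; rewrite mul1r.
  by rewrite leqNgt => /contrapT/negbTE ->; rewrite !mul0r.
have mt := @measurable_tail K.
rewrite RintegralZr //; last exact: inS.
rewrite RintegralD //; [|exact: (inS _ (integrableZl mS 2 j32))|exact: inS].
by rewrite RintegralZl //; exact: inS.
Unshelve. all: by end_near. Qed.

(** The linking layer contributes 8 times [m / n.+1] times tails of orders 32 and 43, the other
    layers [20 / K] times the convergent sequence [A * F]. A large [K] brings each below
    [eps / 2]. *)
Lemma bidegree_tail_limit eps : 0 < eps -> exists K, \forall n \near \oo,
  n.+2%:R * iid_sum (layer_pmf (Pn n)) (fun x : {ffun 'I_(m n) -> lgraph n.+2} =>
    [exists k, edge (i n) (j n) (x k)]%:R
     * ((K < ldeg (union_edges x) (i n))%N%:R * (ldeg (union_edges x) (i n))%:R ^+ 2)) <= eps.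
Proof.
move=> eps0.
pose A n := n.+2%:R * (m n)%:R * ex (fun g : lgraph n.+2 => (edge (i n) (j n) g)%:R : R).
have cA : A n @[n --> \oo] --> mu * fine (cross_moment P 2 1).
  have := mean_edge_asymptotic model cm wPn c21 P21; apply: cvg_trans.
  apply: near_eq_cvg; near=> n; rewrite /A; congr (_ * _).
  by apply: esym; exact: (mean_edge_exchangeable model (ij n)).
pose F n := ((m n)%:R * M n 1) ^+ 3 + 3 * ((m n)%:R * M n 1) * ((m n)%:R * M n 2)
  + (m n)%:R * M n 3.
have [[l1 c1] [l2 c2] [l3 c3]] : [/\ exists l : R, (m n)%:R * M n 1 @[n --> \oo] --> l,
    exists l : R, (m n)%:R * M n 2 @[n --> \oo] --> l & exists l : R, (m n)%:R * M n 3 @[n --> \oo] --> l].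
  by split; eexists; apply: degree_moment_limit.
have [L cAF] : exists L : R, A n * F n @[n --> \oo] --> L.
  exists (mu * fine (cross_moment P 2 1) * (l1 ^+ 3 + 3 * l1 * l2 + l3)).
  apply: cvgM; first exact: cA.
  rewrite /F; apply: cvgD; last exact: c3.
  apply: cvgD; last by apply: cvgM => //; apply: cvgM => //; exact: cvg_cst.
  exact: (cvgM c1 (cvgM c1 c1)).
have [C C0 LC] : exists2 C, 0 < C & L < C.
  by exists (`|L| + 1); [rewrite ltr_wpDl|have := ler_norm L; lra].
have mu1 : 0 < mu + 1 by rewrite addr_gt0.
(* Eventually [m / n.+1 <= mu + 1] and the combination of the two tails is at most [3 * e'], so that
   8 times the product is [eps / 2]. *)
pose e' := eps / (48 * (mu + 1)); have e0 : 0 < e' by rewrite divr_gt0 // mulr_gt0.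
have [K1 H1] := tail_small fm32 e0; have [K2 H2] := tail_small fm43 e0.
(* For [K] at least this large, [20 / K * C <= eps / 2]. *)
have [K3 H3] : exists K3 : nat, 40 * C / eps <= K3%:R.
  exists (Num.truncn (40 * C / eps)).+1; rewrite ltW // truncnS_gt //.
have [K [K_gt1 KK1 KK2 KK3]] : exists K, [/\ 1 < K, K1 <= K, K2 <= K & K3 <= K]%N.
  by exists (maxn 2 (maxn K1 (maxn K2 K3))); rewrite !leq_max !leqnn !orbT.
have t32 : \forall n \near \oo, tail n K 3 2 <= e' by exact: H1.
have t43 : \forall n \near \oo, tail n K 4 3 <= e' by exact: H2.
have lK := large_layer K.
have K0 : 0 < K%:R :> R by rewrite ltr0n (ltn_trans _ K_gt1).
have CK : 20 / K%:R * C <= eps / 2.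
  have : 40 * C / eps <= K%:R by rewrite (le_trans H3) // ler_nat.
  rewrite ler_pdivrMr // => H.
  by rewrite mulrAC ler_pdivrMr //; move: H; move: K%:R => k; nra.
have cm1 := cvg_layers_pred cm.
(* The degree is cut at twice the size cut, since either the linking layer or the rest supplies at
   least half of it. *)
exists (2 * K)%N; near=> n.
have hE : ex (fun g : lgraph n.+2 => (K < #|lgraph_vertices g|)%N%:R
     * ((edge (i n) (j n) g)%:R * (gdeg (i n) g ^_ 2)%:R))
  = (2 * tail n K 3 2 + tail n K 4 3) / (n.+2%:R * n.+1%:R) by near: n.
have w0 g := @layer_pmf_ge0 R n.+2 (Pn n) g.
have le1 := @iid_degree_tail_le n.+2 (m n) R _ (i n) (j n) K (M n) K_gt1 w0
  (layer_pmf_sum1 (model n)) (fun=> erefl).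
apply: (@le_trans _ _ (8 * ((m n)%:R / n.+1%:R * (2 * tail n K 3 2 + tail n K 4 3))
   + 20 / K%:R * (A n * F n))).
  have N0 : 0 <= n.+2%:R :> R by [].
  apply: (le_trans (ler_wpM2l N0 le1)).
  rewrite [X in 8 * X]hE /F /A /ex /layer_expectation le_eqVlt; apply/orP; left; apply/eqP.
  move: (\sum_g _) (_ + _ + _) (tail _ _ _ _) (tail _ _ _ _) => a b t1 t2.
  have n1 : n.+1%:R != 0 :> R by []. have n2 : n.+2%:R != 0 :> R by [].
  move: n.+1%:R n.+2%:R (m n)%:R n1 n2 => N1 N2 M' n1 n2; field.
  by rewrite n1 n2 gt_eqF.
have AF : A n * F n <= C.
  by near: n; apply: (cvgr_le _ cAF).
have mn : (m n)%:R / n.+1%:R <= mu + 1.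
  by near: n; apply: (cvgr_le _ cm1); lra.
have T1 : tail n K 3 2 <= e' by near: n.
have T2 : tail n K 4 3 <= e' by near: n.
have mn0 : 0 <= (m n)%:R / n.+1%:R :> R by [].
have H4 : (m n)%:R / n.+1%:R * (2 * tail n K 3 2 + tail n K 4 3) <= (mu + 1) * (3 * e').
  apply: (@le_trans _ _ ((m n)%:R / n.+1%:R * (3 * e'))).
    by rewrite ler_wpM2l //; lra.
  by rewrite ler_wpM2r // mulr_ge0 // ltW.
have e'E : 8 * ((mu + 1) * (3 * e')) = eps / 2.
  by rewrite /e'; field; rewrite gt_eqF.
have H5 : 20 / K%:R * (A n * F n) <= 20 / K%:R * C.
  by rewrite ler_wpM2l // divr_ge0 // ltW.
move: H4 H5 (CK) e'E; move: (_ * (2 * _ + _)) (_ * (A n * F n)) (_ * C) (_ * (3 * e')) => a b c e; lra.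
Unshelve. all: by end_near. Qed.

End bidegree_tail.

(** * Dominated test functions on pairs of degrees *)

Section nat2_uniform_tails.
Variables (R : realType) (nun : nat -> probability (nat * nat)%type R).
Variable nu : probability (nat * nat)%type R.
Hypothesis gf : forall s t : R, 0 < s < 1 -> 0 < t < 1 ->
  \int[nun n]_z (s ^+ z.1 * t ^+ z.2) @[n --> \oo] --> \int[nu]_z (s ^+ z.1 * t ^+ z.2).
Implicit Types phi psi : nat * nat -> R.

Let nun1 n : (nun n setT <= 1)%E. Proof. exact: probability_le1. Qed.
Let nu1 : (nu setT <= 1)%E. Proof. exact: probability_le1. Qed.

Let local_cvg u K : \int[nun n]_(z in setT `&` box K) u z @[n --> \oo]
  --> \int[nu]_(z in setT `&` box K) u z.
Proof. exact: (nat2_local_cvg nun1 nu1 gf). Qed.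

Let mbox K : measurable (box K). Proof. exact: measurable_nat2. Qed.

Let box_mono : {homo box : K L / (K <= L)%N >-> K `<=` L}.
Proof. by move=> K L KL z [a b]; split; exact: leq_trans KL. Qed.

Let box_cover : setT `<=` \bigcup_K box K.
Proof. by move=> z _; exists (maxn z.1 z.2) => //; split; rewrite leq_max leqnn ?orbT. Qed.

Let box_int (m : probability (nat * nat)%type R) psi K :
  m.-integrable (setT `&` box K) (EFin \o psi).
Proof.
apply: measurable_bounded_integrable => //.
- exact: measurable_nat2.
- exact: (le_lt_trans (probability_le1 m (measurable_nat2 _)) (ltry _)).
- exact: measurable_fun_nat2.
- exists (\sum_(a < K.+1) \sum_(b < K.+1) `|psi (val a, val b)|); split; first exact: num_real.
  move=> M' /ltW MM' [a b] [_ [/= aK bK]]; rewrite (le_trans _ MM') //.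
  rewrite (bigD1 (Ordinal (aK : (a < K.+1)%N))) //= (bigD1 (Ordinal (bK : (b < K.+1)%N))) //=.
  by rewrite -addrA lerDl addr_ge0 ?sumr_ge0 // => i _; rewrite sumr_ge0.
Qed.

Lemma nat2_uniform_tails_cvg psi : (forall z, 0 <= psi z) ->
  uniform_tails (fun n => nun n) setT box psi ->
  forall phi, (forall z, `|phi z| <= psi z) -> nu.-integrable setT (EFin \o phi) /\
    (\int[nun n]_z phi z @[n --> \oo] --> \int[nu]_z phi z).
Proof.
move=> psi0 tails phi phipsi.
have mf D f : measurable_fun D (f : nat * nat -> R) by exact: measurable_fun_nat2.
split.
  apply: (@dominated_integrable _ _ _ _ psi) => //.
  apply: (uniform_tails_integrable (mun := fun n => nun n) (B := box)) tails => //.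
  - by move=> n K; exact: box_int.
  - by move=> K; exact: box_int.
apply: (uniform_tails_cvg (mun := fun n => nun n) (B := box) (psi := psi)) => //.
- by move=> n K; exact: box_int.
- by move=> K; exact: box_int.
Qed.

(** This is tightness: all total masses equal 1 and masses of boxes converge, so nothing escapes to
    infinity. Bounded test functions are thereby the case of a constant dominating function. *)
Lemma nat2_uniform_tails_cst (c : R) : 0 <= c ->
  uniform_tails (fun n => nun n) setT box (fun=> c).
Proof.
move=> c0.
have ci (m : probability (nat * nat)%type R) : m.-integrable setT (EFin \o fun=> c).
  apply: measurable_bounded_integrable => //.
  - exact: (le_lt_trans (probability_le1 m measurableT) (ltry _)).
  - by exists c; split; [exact: num_real|move=> M' /ltW MM' z _; rewrite ger0_norm].
have cE (m : probability (nat * nat)%type R) : \int[m]_z c = c.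
  by rewrite Rintegral_cst // [X in fine X]probability_setT mulr1.
apply: (total_cvg_uniform_tails (mun := fun n => nun n) (mu := nu)) => //.
- by apply: nearW => n; exact: ci.
- exact: ci.
- by apply: cvg_near_cst; apply: nearW => n; exact: etrans (cE _) (esym (cE _)).
Qed.

End nat2_uniform_tails.

(** * Convergence of the bidegree laws *)

Section bidegree_limit.
Variables (R : realType) (m : nat -> nat) (mu : R).
Variables (Pn : nat -> probability (nat * R)%type R) (P : probability (nat * R)%type R).
Variables (d : nat -> measure_display) (Omega : forall n, measurableType (d n)).
Variables (Pr : forall n, probability (Omega n) R).
Variables (Z : forall n, 'I_(m n) -> {RV (Pr n) >-> (lgraph n.+2 * (nat * R))%type}).
Variables (d' : measure_display) (Omega' : measurableType d') (Q : probability Omega' R).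
Variables (Lambda : {RV Q >-> nat}) (H : nat -> {RV Q >-> nat}).
Hypothesis model : forall n, layer_model (Pn n) (@Z n).
Hypothesis cm : ((m n)%:R / n.+2%:R : R) @[n --> \oo] --> mu.
Hypothesis mu0 : 0 < mu.
Hypothesis wPn : weak_cvg_layer (fun n => Pn n) P.
Hypothesis c10 : cross_moment (Pn n) 1 0 @[n --> \oo] --> cross_moment P 1 0.
Hypothesis c21 : cross_moment (Pn n) 2 1 @[n --> \oo] --> cross_moment P 2 1.
Hypotheses (P10 : (0 < cross_moment P 1 0 < +oo)%E) (P21 : (0 < cross_moment P 2 1 < +oo)%E).
Hypothesis cp : compound_poisson_variables (mu * fine (cross_moment P 1 0)) (g_pmf P) Lambda H.

Let law n := bidegree_law (fun k => Z k : Omega n -> lgraph n.+2 * (nat * R)) (Pr n) (node1 n) (node2 n).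
Let f2b := f2bar (compound_law Q Lambda (fun k => H k)) P.
Let bs n (h : nat * nat -> R) := bidegree_sum (m n) (Pn n) (node1 n) (node2 n) h.

Let bs_limit : n.+2%:R * bs n (fun=> 1) @[n --> \oo] --> mu * fine (cross_moment P 2 1).
Proof. exact: (bidegree_mass_limit model). Qed.

Let bs_gt0 : \forall n \near \oo, 0 < bs n (fun=> 1).
Proof. exact: (bidegree_mass_gt0 model cm mu0 wPn). Qed.

Lemma bidegree_probabilities : exists nun : nat -> probability (nat * nat)%type R,
  forall n, 0 < bs n (fun=> 1) -> law n = nun n :> (set (nat * nat) -> \bar R)
    /\ forall h, (nun n).-integrable setT (EFin \o h)
         /\ \int[nun n]_z h z = bs n h / bs n (fun=> 1).
Proof.
have /choice[nun nunP] : forall n, exists nu : probability (nat * nat)%type R,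
    0 < bs n (fun=> 1) -> law n = nu :> (set (nat * nat) -> \bar R)
    /\ forall h, nu.-integrable setT (EFin \o h)
         /\ \int[nu]_z h z = bs n h / bs n (fun=> 1).
  move=> n; have [bs0|bs0] := ltP 0 (bs n (fun=> 1)).
    by have [nu nuP] := bidegree_probability (model n) bs0; exists nu.
  (* An arbitrary probability for the indices at which adjacency has probability 0; these are finite
     in number by [bs_gt0]. *)
  by exists (\d_(0%N, 0%N)).
by exists nun.
Qed.

Section with_probabilities.
Variable nun : nat -> probability (nat * nat)%type R.
Hypothesis nunP : forall n, 0 < bs n (fun=> 1) -> law n = nun n :> (set (nat * nat) -> \bar R)
    /\ forall h, (nun n).-integrable setT (EFin \o h)
         /\ \int[nun n]_z h z = bs n h / bs n (fun=> 1).

Let nun_gf : exists nu : probability (nat * nat)%type R,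
  (forall s t : R, 0 < s < 1 -> 0 < t < 1 ->
    \int[nun n]_z (s ^+ z.1 * t ^+ z.2) @[n --> \oo] --> \int[nu]_z (s ^+ z.1 * t ^+ z.2))
  /\ f2b = nu :> (set (nat * nat) -> \bar R).
Proof.
have [nu [nuE nu_gf]] := f2bar_law P10 P21 mu0 cp.
exists nu; split => // s t /andP[s0 s1] /andP[t0 t1]; rewrite nu_gf ?ltW //.
have := @bidegree_ratio_limit R m mu Pn P d Omega Pr Z model cm mu0 wPn c10 c21 P10 P21 s t.
rewrite s0 t0 !ltW // => /(_ isT isT); apply: cvg_trans; apply: near_eq_cvg; near=> n.
have bs0 : 0 < bs n (fun=> 1) by near: n.
by have [_ /(_ (fun z => s ^+ z.1 * t ^+ z.2))[_ ->]] := nunP bs0.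
Unshelve. all: by end_near. Qed.

Let law_cvg psi : (forall z, 0 <= psi z) -> uniform_tails (fun n => nun n) setT box psi ->
  forall phi, (forall z, `|phi z| <= psi z) ->
    f2b.-integrable [set: (nat * nat)%type] (EFin \o phi) /\
    (\int[law n]_z (phi z)%:E)%E @[n --> \oo] --> (\int[f2b]_z (phi z)%:E)%E.
Proof.
move=> psi0 tails phi phipsi.
have [nu [gf nuE]] := nun_gf.
have [i_phi c_phi] := nat2_uniform_tails_cvg gf psi0 tails phipsi.
rewrite nuE; split => //.
rewrite -(EFin_Rintegral measurableT i_phi).
have : (\int[nun n]_z phi z)%:E @[n --> \oo] --> (\int[nu]_z phi z)%:E.
  exact: (cvg_comp _ _ c_phi).
apply: cvg_trans; apply: near_eq_cvg; near=> n.
have bs0 : 0 < bs n (fun=> 1) by near: n.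
have [-> /(_ phi)[i_n _]] := nunP bs0.
by rewrite (EFin_Rintegral measurableT i_n).
Unshelve. all: by end_near. Qed.

Lemma law_cvg_bounded phi (M : R) : (forall z, `|phi z| <= M) ->
  (\int[law n]_z (phi z)%:E)%E @[n --> \oo] --> (\int[f2b]_z (phi z)%:E)%E.
Proof.
move=> phiM; have M0 : 0 <= M by rewrite (le_trans _ (phiM (0%N, 0%N))).
have [nu [gf _]] := nun_gf.
by have [] := law_cvg (psi := fun=> M) (fun=> M0) (nat2_uniform_tails_cst gf M0) phiM.
Qed.

Section second_moments.
Hypothesis c32 : cross_moment (Pn n) 3 2 @[n --> \oo] --> cross_moment P 3 2.
Hypothesis c43 : cross_moment (Pn n) 4 3 @[n --> \oo] --> cross_moment P 4 3.
Hypotheses (P32 : (cross_moment P 3 2 < +oo)%E) (P43 : (cross_moment P 4 3 < +oo)%E).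

Let tail1 K (z : nat * nat) : R := (K < z.1)%N%:R * z.1%:R ^+ 2.
Let tail2 K (z : nat * nat) : R := (K < z.2)%N%:R * z.2%:R ^+ 2.

Let tail1_small eps : 0 < eps -> exists K, \forall n \near \oo, n.+2%:R * bs n (tail1 K) <= eps.
Proof.
move=> eps0; apply: (@bidegree_tail_limit R m mu Pn P d Omega Pr Z) => //.
Qed.

Let tail2_small eps : 0 < eps -> exists K, \forall n \near \oo, n.+2%:R * bs n (tail2 K) <= eps.
Proof.
move=> eps0; have [K HK] := @bidegree_tail_limit R m mu Pn P d Omega Pr Z model cm mu0 wPn c21 P21
  c32 c43 P32 P43 (fun n => node2 n) (fun n => node1 n) (fun n => isT) eps eps0.
exists K; apply: filterS HK => n; congr (_ * _ <= _); apply: eq_iid_sum => x.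
by congr ((nat_of_bool _)%:R * _); apply: eq_existsb => k; rewrite /edge finset.setUC.
Qed.

(** Outside the box the larger coordinate exceeds its own cut and is at least 1, so each of the
    three terms is at most its square. *)
Let square_sum_tail K1 K2 z : ~ box (maxn K1 K2) z ->
  1 + z.1%:R ^+ 2 + z.2%:R ^+ 2 <= 3 * (tail1 K1 z + tail2 K2 z).
Proof.
case: z => x y; rewrite /box /tail1 /tail2 /= => xyK.
rewrite -!natrX -!natrM -natrD -natrM -[1]/(1%:R) -!natrD ler_nat.
have [yx|xy] := leqP y x.
  have -> : (K1 < x)%N by rewrite ltnNge; apply/negP => xK; apply: xyK; lia.
  have x0 : (0 < x)%N by rewrite lt0n; apply/eqP => x0; apply: xyK; lia.
  rewrite mul1n; nia.
have -> : (K2 < y)%N by rewrite ltnNge; apply/negP => yK; apply: xyK; lia.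
by rewrite mul1n; nia.
Qed.

(** A tail under the conditional law is a quotient of two quantities that are compared after
    multiplication by [n.+2]: the numerator is then small and the denominator tends to
    [mu P_21 > 0]. *)
Let quadratic_tails (c : R) : 0 <= c ->
  uniform_tails (fun n => nun n) setT box (fun z => c * (1 + z.1%:R ^+ 2 + z.2%:R ^+ 2)).
Proof.
move=> c0; set psi := fun z : nat * nat => _; move=> eps eps0.
pose p := mu * fine (cross_moment P 2 1).
have p0 : 0 < p by rewrite mulr_gt0 // fine_gt0.
(* The denominator is eventually at least [p / 2], and the numerator at most
   [3 * c * (e' + e') = 6 * c * e']; dividing by [c + 1] also covers [c = 0]. *)
pose e' := eps * (p / 2) / (6 * (c + 1)).
have c1 : 0 < c + 1 by rewrite ltr_wpDl.
have e0 : 0 < e' by apply: divr_gt0; apply: mulr_gt0 => //; apply: divr_gt0.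
have [K1 H1] := tail1_small e0; have [K2 H2] := tail2_small e0.
pose K := maxn K1 K2; exists K; near=> n.
have bs0 : 0 < bs n (fun=> 1) by near: n.
have [_ nunE] := nunP bs0.
have mT : measurable (setT `\` box K) by exact: measurable_nat2.
have [i_psi _] := nunE psi.
rewrite -EFin_Rintegral //; last by apply: (integrableS measurableT).
rewrite lee_fin setDE Rintegral_mkcondr (nunE (psi \_ (~` box K))).2 ler_pdivrMr //.
have N0 : 0 < n.+2%:R :> R by [].
rewrite -(ler_pM2l N0).
have b1 : n.+2%:R * bs n (tail1 K1) <= e' by near: n.
have b2 : n.+2%:R * bs n (tail2 K2) <= e' by near: n.
have b3 : p / 2 <= n.+2%:R * bs n (fun=> 1).
  by near: n; apply: (cvgr_ge _ bs_limit); rewrite ltr_pdivrMr // mulr2n mulrDr mulr1 ltrDl.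
have le_bs : bs n (psi \_ (~` box K)) <= 3 * c * (bs n (tail1 K1) + bs n (tail2 K2)).
  rewrite /bs /bidegree_sum -iid_sumD -iid_sumZ; apply: le_iid_sum => [g|x].
    exact: layer_pmf_ge0.
  rewrite -mulrDr mulrCA ler_wpM2l //.
  move: (_, _) => z; rewrite patchE; case: ifPn => [|_]; last first.
    by rewrite !mulr_ge0 // addr_ge0 // mulr_ge0 ?exprn_ge0.
  rewrite in_setE => zK; rewrite /psi [3 * c]mulrC -mulrA ler_wpM2l //.
  exact: square_sum_tail.
apply: (le_trans (ler_wpM2l (ltW N0) le_bs)).
have -> : n.+2%:R * (3 * c * (bs n (tail1 K1) + bs n (tail2 K2)))
  = 3 * c * (n.+2%:R * bs n (tail1 K1) + n.+2%:R * bs n (tail2 K2)) by ring.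
apply: (@le_trans _ _ (3 * c * (e' + e'))).
  by rewrite ler_wpM2l ?mulr_ge0 // lerD.
apply: (@le_trans _ _ (eps * (p / 2))); last by rewrite [leRHS]mulrCA ler_pM2l.
have -> : 3 * c * (e' + e') = eps * (p / 2) * (c / (c + 1)).
  by rewrite /e'; field; rewrite gt_eqF.
have p2 : 0 <= p / 2 by rewrite divr_ge0 // ltW.
rewrite ler_piMr //; first by rewrite mulr_ge0 // ltW.
by rewrite ler_pdivrMr // mul1r lerDl.
Unshelve. all: by end_near. Qed.

Lemma law_cvg_quadratic phi (c : R) :
  (forall x y, `|phi (x, y)| <= c * (1 + x%:R ^+ 2 + y%:R ^+ 2)) ->
  f2b.-integrable [set: (nat * nat)%type] (EFin \o phi) /\
  (\int[law n]_z (phi z)%:E)%E @[n --> \oo] --> (\int[f2b]_z (phi z)%:E)%E.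
Proof.
move=> phic; have c0 : 0 <= c.
  by have := phic 0%N 0%N; rewrite expr0n /= !addr0 mulr1; apply: le_trans.
apply: (law_cvg _ (quadratic_tails c0)) => [z|[x y]]; last exact: phic.
by rewrite mulr_ge0 // !addr_ge0 ?exprn_ge0.
Qed.

End second_moments.

End with_probabilities.

Lemma bidegree_law_cvg_bounded phi (M : R) : (forall z, `|phi z| <= M) ->
  (\int[law n]_z (phi z)%:E)%E @[n --> \oo] --> (\int[f2b]_z (phi z)%:E)%E.
Proof. by have [nun nunP] := bidegree_probabilities; exact: (law_cvg_bounded nunP). Qed.

Lemma bidegree_law_cvg_quadratic :
  cross_moment (Pn n) 3 2 @[n --> \oo] --> cross_moment P 3 2 ->
  cross_moment (Pn n) 4 3 @[n --> \oo] --> cross_moment P 4 3 ->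
  (cross_moment P 3 2 < +oo)%E -> (cross_moment P 4 3 < +oo)%E ->
  forall phi (c : R), (forall x y, `|phi (x, y)| <= c * (1 + x%:R ^+ 2 + y%:R ^+ 2)) ->
  f2b.-integrable [set: (nat * nat)%type] (EFin \o phi) /\
  (\int[law n]_z (phi z)%:E)%E @[n --> \oo] --> (\int[f2b]_z (phi z)%:E)%E.
Proof.
move=> c32 c43 P32 P43 phi c; have [nun nunP] := bidegree_probabilities.
exact: (law_cvg_quadratic nunP).
Qed.

End bidegree_limit.

(** Nodes 1 and 2 exist only in graphs with at least two nodes, so [f2n n] refers to [n.+2] nodes;
    every hypothesis is moved to that index. *)
Lemma cvg_shift2 (T : Type) (f : nat -> T) (F : set_system T) :
  f n @[n --> \oo] --> F -> f n.+2 @[n --> \oo] --> F.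
Proof.
move=> fF A /fF[N _ HN]; exists N => // n Nn; apply: HN => /=.
by rewrite (leq_trans Nn) // -addn2 leq_addr.
Qed.

Theorem theorem1 (R : realType)
  (m : nat -> nat) (mu : R)
  (Pn : nat -> probability (nat * R)%type R)
  (P : probability (nat * R)%type R)
  (d : nat -> measure_display) (Omega : forall n : nat, measurableType (d n))
  (Pr : forall n : nat, probability (Omega n) R)
  (Z : forall n : nat, 'I_(m n) -> {RV (Pr n) >-> (lgraph n * (nat * R))%type})
  (d' : measure_display) (Omega' : measurableType d')
  (Q : probability Omega' R)
  (Lambda : {RV Q >-> nat}) (H : nat -> {RV Q >-> nat}) :
  (forall n : nat, layer_model (Pn n) (@Z n)) ->
  ((m n)%:R : R) @[n --> \oo] --> +oo ->
  ((m n)%:R / n%:R : R) @[n --> \oo] --> mu ->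
  0 < mu ->
  P (@layer_space R) = 1%E ->
  weak_cvg_layer (fun n => Pn n) P ->
  compound_poisson_variables (mu * fine (cross_moment P 1 0)) (g_pmf P)
    Lambda H ->
  let f2n := fun n : nat => bidegree_law (@Z n.+2) (Pr n.+2) (node1 n) (node2 n) in
  let f2b := f2bar (compound_law Q Lambda (fun k => H k)) P in
  cross_moment (Pn n) 1 0 @[n --> \oo] --> cross_moment P 1 0 ->
  cross_moment (Pn n) 2 1 @[n --> \oo] --> cross_moment P 2 1 ->
  (0 < cross_moment P 1 0 < +oo)%E ->
  (0 < cross_moment P 2 1 < +oo)%E ->
  weak_cvg_nat2 f2n f2b /\
  (cross_moment (Pn n) 3 2 @[n --> \oo] --> cross_moment P 3 2 ->
   cross_moment (Pn n) 4 3 @[n --> \oo] --> cross_moment P 4 3 ->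
   (cross_moment P 3 2 < +oo)%E ->
   (cross_moment P 4 3 < +oo)%E ->
   forall phi : nat * nat -> R,
     (exists c : R, forall x y : nat,
        `|phi (x, y)| <= c * (1 + x%:R ^+ 2 + y%:R ^+ 2)) ->
     f2b.-integrable [set: (nat * nat)%type] (EFin \o phi) /\
     (\int[f2n n]_z (phi z)%:E)%E @[n --> \oo] --> (\int[f2b]_z (phi z)%:E)%E).
Proof.
move=> model _ cm mu0 _ wPn cp f2n f2b c10 c21 P10 P21.
have model2 n := model n.+2.
have cm2 := cvg_shift2 cm.
have wPn2 : weak_cvg_layer (fun n => Pn n.+2) P.
  by move=> phi bphi; exact: cvg_shift2 (wPn phi bphi).
have c10' := cvg_shift2 c10; have c21' := cvg_shift2 c21.
split=> [phi [_ [M phiM]]|c32 c43 P32 P43 phi [c phic]].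
  have phiM' z : `|phi z| <= M by exact: phiM.
  exact: (bidegree_law_cvg_bounded model2 cm2 mu0 wPn2 c10' c21' P10 P21 cp phiM').
have c32' := cvg_shift2 c32; have c43' := cvg_shift2 c43.
exact: (bidegree_law_cvg_quadratic model2 cm2 mu0 wPn2 c10' c21' P10 P21 cp c32' c43' P32 P43 phic).
Qed.
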